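(* Let $q>1$ be a real number, let $\mathbb{E}$ be a complex Banach space, and let $m=(m_p)_{p\ge0}$ be a sequence of positive real numbers with $m_0=1$. If $m$ preserves $q$-Gevrey asymptotic expansions, then $m$ preserves summability.
   Context: $\mathbb{E}$ is a complex Banach space with norm $\|\cdot\|_{\mathbb{E}}$; $\mathbb{E}[[t]]$ is the space of formal power series in $t$ with coefficients in $\mathbb{E}$ and $\mathbb{E}\{t\}$ is the subspace of those which converge on some neighborhood of the origin. Infinite sector: for $d\in\mathbb{R}$, an infinite sector with vertex at the origin, bisecting direction $d$ and positive opening $\delta>0$ is $S=\{re^{i\varphi}: r>0,\ |\varphi-d|<\delta/2\}$. A convergent power series $g$ can be extended on $S$ if there are $\rho>0$ and a holomorphic function on $S\cup D_\rho$ ($D_\rho$ the open disc of radius $\rho$ centered at $0$) which coincides with the sum of $g$ on $D_\rho$; ''can be extended on an infinite sector of bisecting direction $d$'' means that this holds for some such $S$ (some positive opening). $q$-exponential growth: for $s>0$, a holomorphic function $f:S\to\mathbb{E}$ is of $q$-exponential growth of order $1/s$ on $S$ if there exist $C,h>0$ and $\alpha\in\mathbb{R}$ such that $\|f(z)\|_{\mathbb{E}}\le C\exp\left(\frac{\log^2(|z|+h)}{2s\log(q)}\right)(|z|+h)^{\alpha}$ for every $z\in S$. Formal Borel operators: for a sequence $m=(m_p)_{p\ge0}$ of positive real numbers, $\mathcal{B}_{m,t}\left(\sum_{p\ge0}a_pt^p\right)=\sum_{p\ge0}\frac{a_p}{m_p}t^p$. For $s>0$, $\mathcal{B}_{q;s}\left(\sum_{p\ge0}a_pt^p\right)=\sum_{p\ge0}\frac{a_p}{q^{s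 p(p-1)/2}}t^p$. Definition: $m$ preserves $q$-Gevrey asymptotic expansions if for every $s>0$, $d\in\mathbb{R}$ and $\hat{u}\in\mathbb{E}[[t]]$ the following two statements are equivalent: (i) $\mathcal{B}_{q;s}(\hat{u})\in\mathbb{E}\{t\}$, and this function can be extended on an infinite sector of bisecting direction $d$ with $q$-exponential growth of order $1/s$ on such sector; (ii) $\mathcal{B}_{q;s}\mathcal{B}_{m,t}(\hat{u})\in\mathbb{E}\{t\}$, and this function can be extended on an infinite sector of bisecting direction $d$ with $q$-exponential growth of order $1/s$ on such sector. Summability: for $k>0$ and $d\in\mathbb{R}$, a series $\hat{u}(t)=\sum_{p\ge0}a_pt^p\in\mathbb{E}[[t]]$ is $k$-summable along direction $d$, written $\hat{u}\in\mathbb{E}\{t\}_{k,d}$, if $\sum_{p\ge0}\frac{a_p}{\Gamma(1+p/k)}t^p$ converges on some neighborhood of the origin and can be extended analytically, as a function $v$, to an infinite sector $S$ of bisecting direction $d$, with $k$-exponential growth there, i.e. there exist $A,B>0$ such that $\|v(t)\|_{\mathbb{E}}\le Ae^{B|t|^{k}}$ for all $t\in S$. Definition: $m$ preserves summability if for every $k>0$, $d\in\mathbb{R}$ and $\hat{u}\in\mathbb{E}[[t]]$ one has $\hat{u}\in\mathbb{E}\{t\}_{k,d}$ if and only if $\mathcal{B}_{m,t}\hat{u}\in\mathbb{E}\{t\}_{k,d}$. *)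

(* Defs.v *)
(* A complex Banach space is a [CompleteNormedModule C_AbsRing]; a formal power
   series with coefficients in it is its coefficient sequence [nat -> E]. *)
From Stdlib Require Import Reals.
From Coquelicot Require Import Coquelicot.
Open Scope R_scope.

Definition disc (rho : R) (z : C) : Prop := Cmod z < rho.

(* The infinite sector with vertex 0, bisecting direction d and opening delta. *)
Definition sector (d delta : R) (z : C) : Prop :=
  exists r phi : R,
    0 < r /\ Rabs (phi - d) < delta / 2 /\ z = (r * cos phi, r * sin phi).

(* Meant for open U: functions are total, but their values off U do not
   affect differentiability at points of U. *)
Definition holomorphic_on {E : CompleteNormedModule C_AbsRing}
    (U : C -> Prop) (f : C -> E) : Prop :=
  forall z : C, U z -> ex_derive (K := C_AbsRing) (V := E) f z.

Definition convergent {E : CompleteNormedModule C_AbsRing}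
    (a : nat -> E) : Prop :=
  exists r : R, 0 < r /\
    forall z : C, disc r z -> ex_pseries (K := C_AbsRing) (V := E) a z.

(* f is an extension to S of the sum of the series a: holomorphic on the union
   of S and some disc on which f coincides with the sum. *)
Definition extends_on {E : CompleteNormedModule C_AbsRing}
    (a : nat -> E) (S : C -> Prop) (f : C -> E) : Prop :=
  exists rho : R, 0 < rho /\
    holomorphic_on (fun z => S z \/ disc rho z) f /\
    forall z : C, disc rho z -> is_pseries (K := C_AbsRing) (V := E) a z (f z).

Definition q_exp_growth {E : CompleteNormedModule C_AbsRing}
    (q s : R) (S : C -> Prop) (f : C -> E) : Prop :=
  exists A h alpha : R, 0 < A /\ 0 < h /\
    forall z : C, S z ->
      norm (f z) <=
        A * exp ((ln (Cmod z + h)) ^ 2 / (2 * s * ln q))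
          * Rpower (Cmod z + h) alpha.

(* [Rpower x k] is x^k only for x > 0; sectors do not contain 0. *)
Definition exp_growth {E : CompleteNormedModule C_AbsRing}
    (k : R) (S : C -> Prop) (f : C -> E) : Prop :=
  exists A B : R, 0 < A /\ 0 < B /\
    forall z : C, S z -> norm (f z) <= A * exp (B * Rpower (Cmod z) k).

Definition borel {E : CompleteNormedModule C_AbsRing}
    (m : nat -> R) (a : nat -> E) : nat -> E :=
  fun p => scal (RtoC (/ m p)) (a p).

Definition borel_q {E : CompleteNormedModule C_AbsRing}
    (q s : R) (a : nat -> E) : nat -> E :=
  borel (fun p => Rpower q (s * INR p * (INR p - 1) / 2)) a.

(* Euler's integral, convergent for x > 0. *)
Definition Gamma (x : R) : R :=
  RInt_gen (fun t => Rpower t (x - 1) * exp (- t))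
           (at_right 0) (Rbar_locally p_infty).

(* a converges, and its sum extends, with q-exponential growth of order 1/s,
   to some infinite sector of bisecting direction d. *)
Definition q_extendable {E : CompleteNormedModule C_AbsRing}
    (q s d : R) (a : nat -> E) : Prop :=
  convergent a /\
  exists (delta : R) (f : C -> E), 0 < delta /\
    extends_on a (sector d delta) f /\ q_exp_growth q s (sector d delta) f.

Definition preserves_q_Gevrey (E : CompleteNormedModule C_AbsRing)
    (q : R) (m : nat -> R) : Prop :=
  forall (s d : R) (u : nat -> E), 0 < s ->
    (q_extendable q s d (borel_q q s u) <->
     q_extendable q s d (borel_q q s (borel m u))).

Definition summable {E : CompleteNormedModule C_AbsRing}
    (k d : R) (u : nat -> E) : Prop :=
  let b := borel (fun p => Gamma (1 + INR p / k)) u in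
  convergent b /\
  exists (delta : R) (v : C -> E), 0 < delta /\
    extends_on b (sector d delta) v /\ exp_growth k (sector d delta) v.

Definition preserves_summability (E : CompleteNormedModule C_AbsRing)
    (m : nat -> R) : Prop :=
  forall (k d : R) (u : nat -> E), 0 < k ->
    (summable k d u <-> summable k d (borel m u)).

(* Main.v *)
Require Import Defs.
From Stdlib Require Import Reals Lra Lia Psatz List Classical ClassicalEpsilon
  FunctionalExtensionality.
From Coquelicot Require Import Coquelicot.
Open Scope R_scope.

(* Write w = exp (x + i y), so that circles, rays and sectors become segments and strips. The
   Gamma factors of summability commute with the multiplication by 1/m_p, so it suffices to show:
   if a sequence of multipliers l_p preserves q-extendability in every direction, it preserves
   extendability with k-exponential growth (then take l = 1/m and l = m). Given v = sum b_p z^p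
   extended to a sector around d, Cauchy's formula splits b_p, the mean of w^(-p) v(w) over a small
   circle, into the mean over a short arc around d and the mean over the complementary arc.

   The far arc gives the Cauchy-type integral of v(w) / (1 - t/w), which is bounded on a sector
   around d, so the hypothesis on l applies to it directly. For the near arc one needs the function
   G(z) = sum l_p z^p, which the hypothesis applied to e / (1 - z) continues, with slow growth, to
   sectors around the two directions +-eta (the continuation stays on the line C e by a chain of
   Taylor discs, hence is scalar). Then l_p times the near coefficients are those of the integral of
   v(w) G(t/w) over the near arc, and Cauchy's theorem pushes this arc out to a radius proportional
   to |t|, at the expense of two rays on which t/w has argument close to +-eta. The deformed
   integral extends the function to a sector around d, and it grows at most like v does. *)

(** * Linear identities in a complex vector space *)

(** The hypothesis cannot be applied to v itself: v may grow like exp (B |z|^k), beyond any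
    q-exponential bound. It is applied only to series with bounded extensions, the geometric series
    and the far arc, and what it returns is weakened to growth of order k, since exp (c log^2 |z|)
    lies below exp (B |z|^k) for every k > 0. The growth of v is carried by the deformed contour
    alone: its radius is a multiple of |t| + 1, and order k survives this dilation as well as the
    product with the kernel on the rays. The kernel is continued in the directions +-eta and not 0
    because 1 / (1 - z) is singular at 1. For t near direction d, the quotient t/w has argument near
    eta on the ray at angle d - eta and near -eta on the other one. The two continuations are only
    known to agree near 0; this suffices, as t/w stays there on the pushed-out arc. *)

Lemma Rinv_nonneg x : 0 < x -> 0 <= / x.
Proof. intros H; left; apply Rinv_0_lt_compat, H. Qed.

Notation cscal := (@scal (AbsRing.Ring C_AbsRing) _).

Inductive vexp : Type :=
| VAtom (n : nat)
| VZero
| VPlus (a b : vexp)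
| VOpp (a : vexp)
| VScal (c : C) (a : vexp).

Fixpoint vcoef (e : vexp) (i : nat) : C :=
  match e with
  | VAtom n => if Nat.eqb n i then RtoC 1 else RtoC 0
  | VZero => RtoC 0
  | VPlus a b => (vcoef a i + vcoef b i)%C
  | VOpp a => (- vcoef a i)%C
  | VScal c a => (c * vcoef a i)%C
  end.

Fixpoint vwf (n : nat) (e : vexp) : bool :=
  match e with
  | VAtom i => Nat.ltb i n
  | VZero => true
  | VPlus a b => andb (vwf n a) (vwf n b)
  | VOpp a => vwf n a
  | VScal _ a => vwf n a
  end.

(** A conjunction built by recursion instead of a bounded quantifier, so that it computes to one
    coefficient identity per atom. *)
Fixpoint vcoefs_eq (n : nat) (e1 e2 : vexp) : Prop :=
  match n with
  | O => True
  | S n' => vcoef e1 n' = vcoef e2 n' /\ vcoefs_eq n' e1 e2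
  end.

Lemma vcoefs_eq_correct n e1 e2 : vcoefs_eq n e1 e2 ->
  forall i, (i < n)%nat -> vcoef e1 i = vcoef e2 i.
Proof.
  induction n as [|n IH]; simpl; intros H i Hi; [lia|].
  destruct H as [H1 H2]; destruct (Nat.eq_dec i n) as [->|Hn]; [exact H1|].
  apply IH; [exact H2|lia].
Qed.

Section VecEval.
Context {E : CompleteNormedModule C_AbsRing}.

Fixpoint veval (l : list E) (e : vexp) : E :=
  match e with
  | VAtom n => nth n l zero
  | VZero => zero
  | VPlus a b => plus (veval l a) (veval l b)
  | VOpp a => opp (veval l a)
  | VScal c a => cscal c (veval l a)
  end.

(** The offset [k] is the index of the first vector of the list, so that inductions on [l] shift it
    and leave [f] unchanged. *)
Fixpoint vlin (l : list E) (k : nat) (f : nat -> C) : E :=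
  match l with
  | nil => zero
  | x :: l' => plus (cscal (f k) x) (vlin l' (S k) f)
  end.

Lemma vlin_ext (l : list E) k f g :
  (forall i, (k <= i < k + length l)%nat -> f i = g i) -> vlin l k f = vlin l k g.
Proof.
  revert k; induction l as [|x l IH]; intros k H; simpl; [reflexivity|].
  rewrite (H k) by (simpl; lia); f_equal; apply IH; intros i Hi; apply H; simpl; lia.
Qed.

Lemma vlin_zero (l : list E) k : vlin l k (fun _ => RtoC 0) = zero.
Proof.
  revert k; induction l as [|x l IH]; intros k; simpl; [reflexivity|].
  rewrite IH, plus_zero_r; exact (scal_zero_l x).
Qed.

Lemma vlin_plus (l : list E) k f g :
  vlin l k (fun i => (f i + g i)%C) = plus (vlin l k f) (vlin l k g).
Proof.
  revert k; induction l as [|x l IH]; intros k; simpl; [rewrite plus_zero_l; reflexivity|].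
  rewrite IH.
  replace (cscal (f k + g k)%C x)
    with (plus (cscal (f k) x) (cscal (g k) x))
    by (symmetry; exact (scal_distr_r (f k : C_AbsRing) (g k) x)).
  rewrite <- !plus_assoc; f_equal.
  rewrite !plus_assoc; f_equal; apply plus_comm.
Qed.

Lemma vlin_scal (l : list E) k c f :
  vlin l k (fun i => (c * f i)%C) = cscal c (vlin l k f).
Proof.
  revert k; induction l as [|x l IH]; intros k; simpl; [exact (eq_sym (scal_zero_r (c :
      C_AbsRing)))|].
  rewrite IH.
  transitivity (plus (cscal c (cscal (f k) x))
                     (cscal c (vlin l (S k) f))).
  - f_equal; exact (eq_sym (scal_assoc (c : C_AbsRing) (f k) x)).
  - exact (eq_sym (scal_distr_l (c : C_AbsRing) _ _)).
Qed.

Lemma vlin_atom (l : list E) k n : (k <= n < k + length l)%nat ->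
  vlin l k (fun i => if Nat.eqb n i then RtoC 1 else RtoC 0) = nth (n - k) l zero.
Proof.
  revert k; induction l as [|x l IH]; intros k H; simpl in *; [lia|].
  destruct (Nat.eqb_spec n k) as [->|Hn].
  - rewrite Nat.sub_diag.
    rewrite (vlin_ext _ _ _ (fun _ => RtoC 0)).
    + rewrite vlin_zero, plus_zero_r; exact (scal_one x).
    + intros i Hi; destruct (Nat.eqb_spec k i); [lia|reflexivity].
  - rewrite IH by lia. replace (n - k)%nat with (S (n - S k)) by lia; simpl.
    rewrite <- (plus_zero_l (nth _ _ _)) at 2; f_equal; exact (scal_zero_l x).
Qed.

Lemma veval_vlin (l : list E) e : vwf (length l) e = true ->
  veval l e = vlin l 0 (vcoef e).
Proof.
  induction e as [n| |a IHa b IHb|a IHa|c a IHa]; simpl; intros H.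
  - apply Nat.ltb_lt in H. rewrite vlin_atom by lia. now rewrite Nat.sub_0_r.
  - now rewrite vlin_zero.
  - apply andb_prop in H; destruct H as [H1 H2].
    rewrite (IHa H1), (IHb H2); symmetry; apply vlin_plus.
  - rewrite (IHa H).
    transitivity (vlin l 0 (fun i => (Copp (RtoC 1) * vcoef a i)%C));
      [|apply vlin_ext; intros; ring].
    rewrite vlin_scal. exact (eq_sym (scal_opp_one (vlin l 0 (vcoef a)))).
  - rewrite (IHa H); symmetry; apply vlin_scal.
Qed.

Lemma veval_eq (l : list E) e1 e2 :
  vwf (length l) e1 = true -> vwf (length l) e2 = true ->
  vcoefs_eq (length l) e1 e2 ->
  veval l e1 = veval l e2.
Proof.
  intros H1 H2 H0; pose proof (vcoefs_eq_correct _ _ _ H0) as H; rewrite (veval_vlin l e1 H1),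
      (veval_vlin l e2 H2).
  apply vlin_ext; intros i Hi; apply H; lia.
Qed.

End VecEval.

Ltac vec_mem x l :=
  lazymatch l with
  | nil => constr:(false)
  | cons x _ => constr:(true)
  | cons _ ?l' => vec_mem x l'
  end.

Ltac vec_atoms t l :=
  lazymatch t with
  | @plus _ ?a ?b => let l' := vec_atoms a l in vec_atoms b l'
  | @minus _ ?a ?b => let l' := vec_atoms a l in vec_atoms b l'
  | @opp _ ?a => vec_atoms a l
  | @scal _ _ _ ?a => vec_atoms a l
  | @zero _ => l
  | _ => let b := vec_mem t l in
         lazymatch b with true => l | false => constr:(cons t l) end
  end.

Ltac vec_pos x l :=
  lazymatch l with
  | cons x _ => constr:(O)
  | cons _ ?l' => let n := vec_pos x l' in constr:(S n)
  end.

Ltac vec_reify t l :=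
  lazymatch t with
  | @plus _ ?a ?b => let u := vec_reify a l in let v := vec_reify b l in constr:(VPlus u v)
  | @minus _ ?a ?b => let u := vec_reify a l in let v := vec_reify b l in constr:(VPlus u (VOpp v))
  | @opp _ ?a => let u := vec_reify a l in constr:(VOpp u)
  | @scal _ _ ?c ?a => let u := vec_reify a l in constr:(VScal c u)
  | @zero _ => constr:(VZero)
  | _ => let n := vec_pos t l in constr:(VAtom n)
  end.

(* Proof by reflection: one goal per atom, an identity between its complex coefficients. *)
Ltac vec_coefs :=
  lazymatch goal with
  | |- @eq ?T ?a ?b =>
      let l0 := vec_atoms a (@nil T) in
      let l := vec_atoms b l0 in
      let u := vec_reify a l in
      let v := vec_reify b l in
      refine (veval_eq l u v eq_refl eq_refl _);
      cbn [vcoefs_eq vcoef length Nat.eqb]; repeat split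
  end.

Ltac vec := vec_coefs; ring.

(* Rewriting under a norm fails when the two sides carry different (convertible)
   projections of the algebraic structure of the space; this goes through conversion. *)
Ltac norm_replace u :=
  lazymatch goal with
  | |- @norm ?K ?V ?t <= _ =>
      apply Rle_trans with (@norm K V u); [right; apply (f_equal (@norm K V))|]
  | |- @norm ?K ?V ?t < _ =>
      apply Rle_lt_trans with (@norm K V u); [right; apply (f_equal (@norm K V))|]
  end.

(* Restriction of scalars to the reals: [RInt] integrates functions into real spaces only. *)
Section Restriction.
Context (E : CompleteNormedModule C_AbsRing).

(** Left transparent: the integral lemmas below identify scaling by a real number with [cscal] of
    its image in C by conversion. *)
Definition ER_ModuleSpace_mixin :
  ModuleSpace.mixin_of R_Ring (CompleteNormedModule.AbelianGroup C_AbsRing E).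
Proof.
  refine (ModuleSpace.Mixin R_Ring (CompleteNormedModule.AbelianGroup C_AbsRing E)
    (fun r x => cscal (RtoC r) x) _ _ _ _).
  - intros x y u. etransitivity; [apply (scal_assoc (RtoC x : C_AbsRing) (RtoC y))|].
    f_equal. symmetry; exact (RtoC_mult x y).
  - intros u; exact (scal_one u).
  - intros x u v; exact (scal_distr_l (RtoC x : C_AbsRing) u v).
  - intros x y u. etransitivity; [|exact (scal_distr_r (RtoC x : C_AbsRing) (RtoC y) u)].
    f_equal. exact (RtoC_plus x y).
Defined.

(** Carrier, additive group and, further down, uniform structure and norm are those of [E] itself,
    so that limits and continuity need no translation between the two spaces. *)
Definition ER_ModuleSpace : ModuleSpace R_Ring :=
  ModuleSpace.Pack R_Ring E
    (ModuleSpace.Class R_Ring E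
       (AbelianGroup.class (CompleteNormedModule.AbelianGroup C_AbsRing E))
       ER_ModuleSpace_mixin) E.

Definition ER_NormedModuleAux : NormedModuleAux R_AbsRing :=
  NormedModuleAux.Pack R_AbsRing E
    (NormedModuleAux.Class R_AbsRing E (ModuleSpace.class R_Ring ER_ModuleSpace)
       (UniformSpace.class (CompleteNormedModule.UniformSpace C_AbsRing E))) E.

Definition ER_NormedModule_mixin : NormedModule.mixin_of R_AbsRing ER_NormedModuleAux.
Proof.
  refine (NormedModule.Mixin R_AbsRing ER_NormedModuleAux
    (fun x => @norm C_AbsRing E x) (@norm_factor C_AbsRing E) _ _ _ _ _).
  - exact (@norm_triangle C_AbsRing E).
  - intros l x. etransitivity; [exact (@norm_scal C_AbsRing E (RtoC l) x)|].
    right; f_equal. exact (Cmod_R l).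
  - exact (@norm_compat1 C_AbsRing E).
  - exact (@norm_compat2 C_AbsRing E).
  - exact (@norm_eq_zero C_AbsRing E).
Defined.

Definition ER_NormedModule : NormedModule R_AbsRing :=
  NormedModule.Pack R_AbsRing E
    (NormedModule.Class R_AbsRing E (NormedModuleAux.class R_AbsRing ER_NormedModuleAux)
       ER_NormedModule_mixin) E.

Definition ER : CompleteNormedModule R_AbsRing :=
  CompleteNormedModule.Pack R_AbsRing E
    (CompleteNormedModule.Class R_AbsRing E
       (NormedModule.class R_AbsRing ER_NormedModule)
       (CompleteSpace.class (CompleteNormedModule.CompleteSpace C_AbsRing E))) E.

End Restriction.

(** * Integrals of E-valued functions over real segments *)

Section Integral.
Context {E : CompleteNormedModule C_AbsRing}.

Definition ex_int (f : R -> E) (a b : R) : Prop := ex_RInt (V := ER E) f a b.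
Definition int (f : R -> E) (a b : R) : E := RInt (V := ER E) f a b.

Lemma ex_int_continuous (f : R -> E) a b : a <= b ->
  (forall x, a <= x <= b -> continuous f x) -> ex_int f a b.
Proof.
  intros Hab H; apply (ex_RInt_continuous (V := ER E)).
  rewrite Rmin_left, Rmax_right by exact Hab; exact H.
Qed.

Lemma int_ext (f g : R -> E) a b : a <= b ->
  (forall x, a <= x <= b -> f x = g x) -> int f a b = int g a b.
Proof.
  intros Hab H; apply (RInt_ext (V := ER E)).
  rewrite Rmin_left, Rmax_right by exact Hab; intros x Hx; apply H; lra.
Qed.

Lemma ex_int_ext (f g : R -> E) a b : a <= b ->
  (forall x, a <= x <= b -> f x = g x) -> ex_int f a b -> ex_int g a b.
Proof.
  intros Hab H; apply (ex_RInt_ext (V := ER E)).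
  rewrite Rmin_left, Rmax_right by exact Hab; intros x Hx; apply H; lra.
Qed.

Lemma ex_int_plus (f g : R -> E) a b : ex_int f a b -> ex_int g a b ->
  ex_int (fun x => plus (f x) (g x)) a b.
Proof. exact (ex_RInt_plus (V := ER E) f g a b). Qed.

Lemma int_plus (f g : R -> E) a b : ex_int f a b -> ex_int g a b ->
  int (fun x => plus (f x) (g x)) a b = plus (int f a b) (int g a b).
Proof. exact (RInt_plus (V := ER E) f g a b). Qed.

Lemma ex_int_minus (f g : R -> E) a b : ex_int f a b -> ex_int g a b ->
  ex_int (fun x => minus (f x) (g x)) a b.
Proof. exact (ex_RInt_minus (V := ER E) f g a b). Qed.

Lemma int_minus (f g : R -> E) a b : ex_int f a b -> ex_int g a b ->
  int (fun x => minus (f x) (g x)) a b = minus (int f a b) (int g a b).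
Proof. exact (RInt_minus (V := ER E) f g a b). Qed.

Lemma int_const (c : E) a b : int (fun _ => c) a b = cscal (RtoC (b - a)) c.
Proof. exact (RInt_const (V := ER E) a b c). Qed.

Lemma ex_int_const (c : E) a b : ex_int (fun _ => c) a b.
Proof. exact (ex_RInt_const (V := ER E) a b c). Qed.

Lemma int_chasles (f : R -> E) a b c : ex_int f a b -> ex_int f b c ->
  plus (int f a b) (int f b c) = int f a c.
Proof. exact (RInt_Chasles (V := ER E) f a b c). Qed.

Lemma norm_int_le (f : R -> E) a b M : a <= b -> ex_int f a b ->
  (forall x, a <= x <= b -> norm (f x) <= M) -> norm (int f a b) <= (b - a) * M.
Proof.
  intros Hab Hf H.
  apply (norm_RInt_le_const (V := ER E) f a b (int f a b) M Hab H).
  exact (RInt_correct (V := ER E) f a b Hf).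
Qed.

Lemma int_translate (f : R -> E) v a b : ex_int f (a + v) (b + v) ->
  int (fun x => f (x + v)) a b = int f (a + v) (b + v).
Proof.
  intros H.
  pose proof (RInt_comp_lin (V := ER E) f 1 v a b) as H0.
  rewrite !Rmult_1_l in H0. specialize (H0 H). etransitivity; [|exact H0].
  apply (RInt_ext (V := ER E)); intros x _.
  rewrite Rmult_1_l. symmetry; exact (scal_one (f (x + v))).
Qed.

(** The integral over [ER] is only real linear by construction. Complex linearity holds because each
    Riemann sum commutes with [c], and multiplication by [c] is continuous. *)
Lemma is_int_scal (c : C) (f : R -> E) a b If : is_RInt (V := ER E) f a b If ->
  is_RInt (V := ER E) (fun x => cscal c (f x)) a b (cscal c If).
Proof.
  intros H. unfold is_RInt in *.
  apply filterlim_ext with (fun ptd => cscal c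
      (@scal R_Ring (ER E) (sign (b - a)) (Riemann_sum (V := ER E) f ptd))).
  - intros ptd.
    assert (Hs : Riemann_sum (V := ER E) (fun x => cscal c (f x)) ptd
                 = cscal c (Riemann_sum (V := ER E) f ptd)).
    { pattern ptd; apply SF_cons_ind; clear.
      - intros x0; unfold Riemann_sum; simpl. symmetry; exact (scal_zero_r (V := E) (c :
          C_AbsRing)).
      - intros h s IH.
        etransitivity; [apply (Riemann_sum_cons (V := ER E))|].
        rewrite IH. rewrite (Riemann_sum_cons (V := ER E) f).
        generalize (Riemann_sum (V := ER E) f s : E) as y; intros y.
        change (plus (cscal (RtoC (SF_h s - fst h)) (cscal c (f (snd h))))
                  (cscal c y)
                = cscal c (plus (cscal (RtoC (SF_h s - fst h)) (f (snd h))) y)).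
        vec. }
    transitivity (@scal R_Ring (ER E) (sign (b - a)) (cscal c (Riemann_sum (V := ER E) f ptd : E)));
      [|f_equal; exact (eq_sym Hs)].
    change (cscal c (cscal (RtoC (sign (b - a))) (Riemann_sum (V := ER E) f ptd : E)) =
        cscal (RtoC (sign (b - a))) (cscal c (Riemann_sum (V := ER E) f ptd : E))).
    vec.
  - eapply filterlim_comp; [exact H|].
    exact (filterlim_scal_r (K := C_AbsRing) (V := E) c If).
Qed.

Lemma ex_int_scal (c : C) (f : R -> E) a b : ex_int f a b ->
  ex_int (fun x => cscal c (f x)) a b.
Proof. intros [l Hl]; eexists; exact (is_int_scal c f a b l Hl). Qed.

Lemma int_scal (c : C) (f : R -> E) a b : ex_int f a b ->
  int (fun x => cscal c (f x)) a b = cscal c (int f a b).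
Proof.
  intros H. apply (is_RInt_unique (V := ER E)), is_int_scal.
  exact (RInt_correct (V := ER E) f a b H).
Qed.

(** Serves to integrate affine functions, the first-order part in Goursat's local estimate. *)
Lemma int_id_scal (w : E) a b :
  ex_int (fun x => cscal (RtoC x) w) a b /\
  int (fun x => cscal (RtoC x) w) a b
  = cscal (RtoC ((b ^ 2 - a ^ 2) / 2)) w.
Proof.
  assert (H : is_RInt (V := ER E) (fun x => cscal (RtoC x) w) a b
                (cscal (RtoC ((b ^ 2 - a ^ 2) / 2)) w)).
  { replace (cscal (RtoC ((b ^ 2 - a ^ 2) / 2)) w)
      with (@minus (ER E) (@scal R_Ring (ER E) (b ^ 2 / 2) w) (@scal R_Ring (ER E) (a ^ 2 / 2) w)).
    - apply (is_RInt_derive (V := ER E) (fun x => @scal R_Ring (ER E) (x ^ 2 / 2) w)).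
      + intros x _. apply (is_derive_scal_l (V := ER E) (fun x : R => x ^ 2 / 2) x x w).
        auto_derive; [trivial|field].
      + intros x _.
        apply (continuous_scal (K := R_AbsRing) (V := ER E) (fun x : R => x) (fun _ => w));
          [apply continuous_id|apply continuous_const].
    - change (minus (cscal (RtoC (b ^ 2 / 2)) w) (cscal (RtoC (a ^ 2 / 2)) w)
              = cscal (RtoC ((b ^ 2 - a ^ 2) / 2)) w).
      replace ((b ^ 2 - a ^ 2) / 2) with (b ^ 2 / 2 - a ^ 2 / 2) by field.
      rewrite RtoC_minus. vec. }
  split; [eexists; exact H|exact (is_RInt_unique (V := ER E) _ _ _ _ H)].
Qed.

End Integral.

(** * Norms, continuity and complex derivatives *)

Notation CN := (AbsRing_NormedModule C_AbsRing).
Notation CU := (AbsRing_UniformSpace C_AbsRing).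
Notation cderivable := (@ex_derive C_AbsRing _).
Notation cderivable1 := (@ex_derive C_AbsRing CN).

Lemma Cmod_le_minus (z w : C) : Cmod z <= Cmod (z - w) + Cmod w.
Proof. replace z with (z - w + w)%C at 1 by ring. apply Cmod_triangle. Qed.

Lemma Cminus_0_eq (z w : C) : (z - w)%C = RtoC 0 -> z = w.
Proof. intros H. rewrite <- (Cplus_0_l w), <- H. ring. Qed.

Lemma Cmod_RtoC_pos (r : R) : 0 <= r -> Cmod (RtoC r) = r.
Proof. intros H. rewrite Cmod_R. apply Rabs_pos_eq, H. Qed.

Section Norms.
Context {E : CompleteNormedModule C_AbsRing}.

Lemma enorm_zero : norm (zero : E) = 0.
Proof. exact (norm_zero (V := E)). Qed.

Lemma enorm_eq_zero (x : E) : norm x = 0 -> x = zero.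
Proof. exact (norm_eq_zero x). Qed.

Lemma enorm_plus_le (x y : E) : norm (plus x y) <= norm x + norm y.
Proof. exact (norm_triangle x y). Qed.

Lemma enorm_opp (x : E) : norm (opp x) = norm x.
Proof. exact (norm_opp x). Qed.

Lemma enorm_minus_sym (x y : E) : norm (minus x y) = norm (minus y x).
Proof. rewrite <- enorm_opp. f_equal. vec. Qed.

Lemma enorm_minus_triangle (x y z : E) :
  norm (minus x z) <= norm (minus x y) + norm (minus y z).
Proof. replace (minus x z) with (plus (minus x y) (minus y z)) by vec. apply enorm_plus_le. Qed.

Lemma enorm_minus_le (x y : E) : norm (minus x y) <= norm x + norm y.
Proof. rewrite <- (enorm_opp y). apply enorm_plus_le. Qed.

Lemma enorm_scal_le (c : C) (x : E) : norm (cscal c x) <= Cmod c * norm x.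
Proof. exact (norm_scal (c : C_AbsRing) x). Qed.

(** A normed module only postulates one inequality; the other one is the same inequality for the
    inverse scalar. *)
Lemma enorm_scal (c : C) (x : E) : norm (cscal c x) = Cmod c * norm x.
Proof.
  apply Rle_antisym; [apply enorm_scal_le|].
  destruct (Ceq_dec c 0) as [->|Hc].
  { rewrite Cmod_0, Rmult_0_l; apply norm_ge_0. }
  assert (Hx : cscal (/ c)%C (cscal c x) = x)
    by (vec_coefs; field; exact Hc).
  assert (H : norm x <= Cmod (/ c) * norm (cscal c x)).
  { rewrite <- Hx at 1. apply enorm_scal_le. }
  rewrite Cmod_inv in H by exact Hc.
  pose proof (proj1 (Cmod_gt_0 c) Hc) as Hp.
  apply (Rmult_le_compat_l (Cmod c)) in H; [|lra].
  rewrite <- Rmult_assoc, Rinv_r, Rmult_1_l in H by lra. exact H.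
Qed.

Lemma enorm_le_minus (x y : E) : norm x <= norm (minus x y) + norm y.
Proof.
  assert (H : plus (minus x y : E) y = x) by vec. rewrite <- H at 1. apply enorm_plus_le.
Qed.

Lemma enorm_minus_eq_zero (x y : E) : norm (minus x y) = 0 -> x = y.
Proof.
  intros H. apply enorm_eq_zero in H.
  transitivity (plus (minus x y) y); [vec|]. rewrite H. vec.
Qed.

End Norms.

Section Derivatives.
Context {V : NormedModule C_AbsRing}.

Lemma continuous_eps (f : R -> V) (x : R) :
  continuous f x <->
  (forall eps, 0 < eps -> exists del, 0 < del /\
     forall y, Rabs (y - x) < del -> norm (minus (f y) (f x)) < eps).
Proof.
  destruct (filterlim_locally_ball_norm (F := locally (T := R_UniformSpace) x) f (f x))
      as [A B]. split.
  - intros H eps He. destruct (A H (mkposreal eps He)) as [d Hd].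
    exists d; split; [apply cond_pos|]. intros y Hy; exact (Hd y Hy).
  - intros H; apply B; intros eps. destruct (H eps (cond_pos eps)) as [d [Hd1 Hd2]].
    exists (mkposreal d Hd1); intros y Hy; exact (Hd2 y Hy).
Qed.

Lemma continuous_C_eps (f : C -> V) (x : C) :
  continuous (T := CU) f x <->
  (forall eps, 0 < eps -> exists del, 0 < del /\
     forall y, Cmod (y - x) < del -> norm (minus (f y) (f x)) < eps).
Proof.
  destruct (filterlim_locally_ball_norm (F := locally (T := CU) x) f (f x)) as [A B]. split.
  - intros H eps He. destruct (A H (mkposreal eps He)) as [d Hd].
    exists d; split; [apply cond_pos|]. intros y Hy; exact (Hd y Hy).
  - intros H; apply B; intros eps. destruct (H eps (cond_pos eps)) as [d [Hd1 Hd2]].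
    exists (mkposreal d Hd1); intros y Hy; exact (Hd2 y Hy).
Qed.

Lemma is_derive_eps (f : C -> V) z D :
  is_derive (K := C_AbsRing) f z D <->
  (forall eps, 0 < eps -> exists del, 0 < del /\
     forall h, Cmod h < del ->
       norm (minus (minus (f (z + h)%C) (f z)) (cscal h D)) <= eps * Cmod h).
Proof.
  split.
  - intros [_ H] eps He.
    destruct (H z (fun P HP => HP) (mkposreal eps He)) as [d Hd].
    exists d; split; [apply cond_pos|]. intros h Hh.
    assert (Hd' : Cmod ((z + h) - z)%C < d -> norm (minus (minus (f (z + h)%C) (f z))
              (cscal ((z + h) - z)%C D)) <= eps * Cmod ((z + h) - z)%C)
      by exact (Hd (z + h)%C).
    replace (z + h - z)%C with h in Hd' by ring. exact (Hd' Hh).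
  - intros H. split; [apply is_linear_scal_l|].
    intros x Hx eps.
    rewrite <- (is_filter_lim_locally_unique z x Hx).
    destruct (H eps (cond_pos eps)) as [d [Hd1 Hd2]].
    exists (mkposreal d Hd1). intros y Hy.
    specialize (Hd2 (y - z)%C Hy). replace (z + (y - z))%C with (y : C) in Hd2 by (symmetry;
        change (z + (y - z) = y :> C)%C; ring). exact Hd2.
Qed.

Lemma cderivable_scal (k : C -> C) (f : C -> V) z :
  cderivable1 k z -> cderivable f z ->
  cderivable (fun z => cscal (k z) (f z)) z.
Proof.
  intros [dk Hk] [df Hf].
  exists (plus (cscal dk (f z)) (cscal (k z) df)).
  pose proof (filterdiff_scal_fct (K := C_AbsRing) (V := V) (U := CN)
      z k f _ _ (fun n m => Cmult_comm n m) Hk Hf) as H.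
  eapply filterdiff_ext_lin; [exact H|].
  intros y; cbv beta.
  rewrite scal_distr_l, !scal_assoc. f_equal. f_equal. exact (Cmult_comm _ _).
Qed.

Lemma cderivable_comp (f : C -> V) (g : C -> C) z :
  cderivable1 g z -> cderivable f (g z) -> cderivable (fun z => f (g z)) z.
Proof.
  intros [dg Hg] [df Hf]. eexists. exact (is_derive_comp f g z df dg Hf Hg).
Qed.

Lemma cderivable_continuous (f : C -> V) z : cderivable f z -> continuous (T := CU) f z.
Proof. exact (ex_derive_continuous (K := C_AbsRing) f z). Qed.

Lemma cderivable_ext_loc (f g : C -> V) z r : 0 < r ->
  (forall y, Cmod (y - z) < r -> f y = g y) -> cderivable f z -> cderivable g z.
Proof.
  intros Hr H. apply (ex_derive_ext_loc (K := C_AbsRing)).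
  exists (mkposreal r Hr); exact H.
Qed.

End Derivatives.

Lemma cderivable_id z : cderivable1 (fun z : C => z) z.
Proof. exists one. exact (is_derive_id (K := C_AbsRing) z). Qed.

Lemma cderivable_cst {V : NormedModule C_AbsRing} (c : V) z : cderivable (fun _ : C => c) z.
Proof. exact (ex_derive_const (K := C_AbsRing) c z). Qed.

Lemma cderivable1_cst (c : C) z : cderivable1 (fun _ : C => c) z.
Proof. exact (cderivable_cst (V := CN) c z). Qed.

Lemma cderivable1_continuous (f : C -> C) z :
  cderivable1 f z -> continuous (T := CU) (U := CU) f z.
Proof. exact (cderivable_continuous (V := CN) f z). Qed.

Section VectorDerivatives.
Context {E : CompleteNormedModule C_AbsRing}.

Lemma holo_continuous (f : C -> E) z : cderivable f z -> continuous (T := CU) f z.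
Proof. exact (cderivable_continuous (V := E) f z). Qed.

Lemma holo_cst (c : E) z : cderivable (fun _ : C => c) z.
Proof. exact (cderivable_cst (V := E) c z). Qed.

Lemma holo_scal (k : C -> C) (f : C -> E) z : cderivable1 k z -> cderivable f z ->
  cderivable (fun z => cscal (k z) (f z)) z.
Proof. exact (cderivable_scal (V := E) k f z). Qed.

Lemma holo_plus (f g : C -> E) z : cderivable f z -> cderivable g z ->
  cderivable (fun z => plus (f z) (g z)) z.
Proof. exact (ex_derive_plus (K := C_AbsRing) (V := E) f g z). Qed.

Lemma holo_minus (f g : C -> E) z : cderivable f z -> cderivable g z ->
  cderivable (fun z => minus (f z) (g z)) z.
Proof. exact (ex_derive_minus (K := C_AbsRing) (V := E) f g z). Qed.

Lemma holo_comp (f : C -> E) (g : C -> C) z :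
  cderivable1 g z -> cderivable f (g z) -> cderivable (fun z => f (g z)) z.
Proof. exact (cderivable_comp (V := E) f g z). Qed.

Lemma holo_ext_loc (f g : C -> E) z r : 0 < r ->
  (forall y, Cmod (y - z) < r -> f y = g y) -> cderivable f z -> cderivable g z.
Proof. exact (cderivable_ext_loc (V := E) f g z r). Qed.

End VectorDerivatives.

Lemma cderivable_Cmult (f g : C -> C) z : cderivable1 f z ->
  cderivable1 g z -> cderivable1 (fun z => f z * g z)%C z.
Proof. exact (cderivable_scal (V := CN) f g z). Qed.

Lemma cderivable_Cplus (f g : C -> C) z : cderivable1 f z ->
  cderivable1 g z -> cderivable1 (fun z => f z + g z)%C z.
Proof. exact (ex_derive_plus (K := C_AbsRing) (V := CN) f g z). Qed.

Lemma cderivable_Cminus (f g : C -> C) z : cderivable1 f z ->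
  cderivable1 g z -> cderivable1 (fun z => f z - g z)%C z.
Proof. exact (ex_derive_minus (K := C_AbsRing) (V := CN) f g z). Qed.

Lemma cderivable_inv z : z <> RtoC 0 -> cderivable1 (fun z => / z)%C z.
Proof.
  intros Hz. pose proof (proj1 (Cmod_gt_0 z) Hz) as Hp.
  exists (- / (z * z))%C. apply is_derive_eps. intros eps He.
  (* The linearisation error is h^2 / (z^2 (z + h)). The first bound keeps |z + h| above |z| / 2,
     the second one then makes the error at most eps |h|. *)
  exists (Rmin (Cmod z / 2) (eps * (Cmod z) ^ 3 / 2)). split.
  { apply Rmin_pos; [lra|]. assert (0 < Cmod z ^ 3) by (apply pow_lt; lra). nra. }
  intros h Hh.
  assert (Hh1 : Cmod h < Cmod z / 2) by (eapply Rlt_le_trans; [exact Hh|apply Rmin_l]).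
  assert (Hh2 : Cmod h < eps * (Cmod z) ^ 3 / 2) by (eapply Rlt_le_trans; [exact Hh|apply Rmin_r]).
  assert (Hzh : Cmod z / 2 <= Cmod (z + h)).
  { pose proof (Cmod_triangle (z + h) (- h)) as T. replace (z + h + - h)%C with z in T by ring.
    rewrite Cmod_opp in T. lra. }
  assert (Hzh0 : (z + h)%C <> RtoC 0).
  { intros Hc. rewrite Hc, Cmod_0 in Hzh. lra. }
  change (Cmod (/ (z + h) - / z - h * (- / (z * z)))%C <= eps * Cmod h).
  replace (/ (z + h) - / z - h * (- / (z * z)))%C with (h * (h * (/ (z * z) * / (z + h))))%C
    by (field; auto).
  rewrite !Cmod_mult, !Cmod_inv, Cmod_mult by (try apply Cmult_neq_0; assumption).
  rewrite (Rmult_comm eps). apply Rmult_le_compat_l; [apply Cmod_ge_0|].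
  apply Rle_trans with (eps * Cmod z ^ 3 / 2 * (/ (Cmod z * Cmod z) * / (Cmod z / 2))).
  - apply Rmult_le_compat; [apply Cmod_ge_0| |lra|].
    + apply Rmult_le_pos; apply Rinv_nonneg; nra.
    + apply Rmult_le_compat_l; [apply Rinv_nonneg; nra|].
      apply Rinv_le_contravar; lra.
  - right; field; lra.
Qed.

Lemma cderivable_Cinv (f : C -> C) z : cderivable1 f z -> f z <> RtoC 0 ->
  cderivable1 (fun z => / f z)%C z.
Proof.
  intros Hf Hz. apply (cderivable_comp (V := CN) (fun z => / z)%C f); [exact Hf|].
  apply cderivable_inv, Hz.
Qed.

(** * The complex exponential and polar coordinates *)

Definition cexp (z : C) : C := (exp (fst z) * cos (snd z), exp (fst z) * sin (snd z)).

Lemma cexp_plus z w : cexp (z + w)%C = (cexp z * cexp w)%C.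
Proof.
  destruct z as [a b], w as [c d]; unfold cexp; simpl.
  rewrite exp_plus, cos_plus, sin_plus. apply injective_projections; simpl; ring.
Qed.

Lemma cexp_0 : cexp 0 = RtoC 1.
Proof. unfold cexp; simpl. rewrite exp_0, cos_0, sin_0. apply injective_projections; simpl;
    ring. Qed.

Lemma Cmod_cexp z : Cmod (cexp z) = exp (fst z).
Proof.
  unfold Cmod, cexp; simpl.
  replace (_ + _) with (exp (fst z) ^ 2 * (Rsqr (sin (snd z)) + Rsqr (cos (snd z))))
    by (unfold Rsqr; ring).
  rewrite sin2_cos2, Rmult_1_r, sqrt_pow2; [reflexivity|left; apply exp_pos].
Qed.

Lemma cexp_neq_0 z : cexp z <> RtoC 0.
Proof.
  apply Cmod_gt_0. rewrite Cmod_cexp. apply exp_pos.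
Qed.

Lemma cexp_opp z : cexp (- z)%C = (/ cexp z)%C.
Proof.
  assert (H : (cexp (- z) * cexp z)%C = RtoC 1)
    by (rewrite <- cexp_plus, <- cexp_0; f_equal; ring).
  rewrite <- (Cmult_1_l (/ cexp z)), <- H. field. apply cexp_neq_0.
Qed.

Lemma cexp_minus z w : cexp (z - w)%C = (cexp z / cexp w)%C.
Proof. unfold Cminus. rewrite cexp_plus, cexp_opp. reflexivity. Qed.

Lemma cexp_periodic x y : cexp (x, y + 2 * PI) = cexp (x, y).
Proof.
  unfold cexp; simpl. rewrite cos_plus, sin_plus, cos_2PI, sin_2PI.
  apply injective_projections; simpl; ring.
Qed.

Lemma Cmod_le_Rabs (z : C) : Cmod z <= Rabs (fst z) + Rabs (snd z).
Proof.
  destruct z as [a b]; simpl.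
  replace (a, b) with (RtoC a + (0, b))%C
    by (apply injective_projections; simpl; ring).
  eapply Rle_trans; [apply Cmod_triangle|]. rewrite Cmod_R. apply Rplus_le_compat_l.
  right. unfold Cmod; simpl. rewrite <- sqrt_Rsqr_abs. f_equal. unfold Rsqr; ring.
Qed.

Lemma little_o_of_derivable (f : R -> R) l : derivable_pt_lim f 0 l ->
  forall eps, 0 < eps -> exists del, 0 < del /\
    forall x, Rabs x < del -> Rabs (f x - f 0 - l * x) <= eps * Rabs x.
Proof.
  intros H eps He. destruct (H eps He) as [d Hd].
  exists d; split; [apply cond_pos|]. intros x Hx.
  destruct (Req_dec x 0) as [->|Hx0].
  { replace (f 0 - f 0 - l * 0) with 0 by ring. rewrite Rabs_R0; lra. }
  specialize (Hd x Hx0 Hx). rewrite Rplus_0_l in Hd.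
  replace (f x - f 0 - l * x) with (((f x - f 0) / x - l) * x) by (field; exact Hx0).
  rewrite Rabs_mult. apply Rmult_le_compat_r; [apply Rabs_pos|lra].
Qed.

Lemma cexp_derivative z : is_derive (K := C_AbsRing) (V := CN) cexp z (cexp z).
Proof.
  apply is_derive_eps. intros eps0 He0.
  set (M := Cmod (cexp z)).
  assert (HM : 0 < M) by (unfold M; rewrite Cmod_cexp; apply exp_pos).
  (* By the addition formula only the expansion at 0 matters. Its real and imaginary errors will be
     at most 3 eps |h| and 4 eps |h|, whence the 8; the bound 1/2 controls 1 + x and the quadratic
     terms. *)
  set (eps := Rmin (eps0 / (8 * M)) (1 / 2)).
  assert (He : 0 < eps) by (apply Rmin_pos; [apply Rdiv_lt_0_compat; lra|lra]).
  assert (He1 : eps <= 1 / 2) by apply Rmin_r.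
  assert (He2 : 8 * eps * M <= eps0).
  { assert (H : eps <= eps0 / (8 * M)) by apply Rmin_l.
    apply (Rmult_le_compat_r (8 * M)) in H; [|lra].
    replace (eps0 / (8 * M) * (8 * M)) with eps0 in H by (field; lra). lra. }
  destruct (little_o_of_derivable exp 1 (derivable_pt_lim_exp_0) eps He) as [d1 [Hd1 H1]].
  destruct (little_o_of_derivable sin 1 ltac:(rewrite <- cos_0; apply derivable_pt_lim_sin) eps He)
      as [d2 [Hd2 H2]].
  destruct (little_o_of_derivable cos 0 ltac:(replace 0 with (- sin 0) at 2 by (rewrite sin_0;
      ring); apply derivable_pt_lim_cos) eps He) as [d3 [Hd3 H3]].
  exists (Rmin eps (Rmin d1 (Rmin d2 d3))). split; [repeat (assumption || apply Rmin_pos)|].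
  intros h Hh.
  assert (Hb : Cmod h < eps /\ Cmod h < d1 /\ Cmod h < d2 /\ Cmod h < d3).
  { pose proof (Rmin_l eps (Rmin d1 (Rmin d2 d3))); pose proof (Rmin_r eps (Rmin d1 (Rmin d2 d3))).
    pose proof (Rmin_l d1 (Rmin d2 d3)); pose proof (Rmin_r d1 (Rmin d2 d3)).
    pose proof (Rmin_l d2 d3); pose proof (Rmin_r d2 d3). repeat split; lra. }
  destruct Hb as [Hb0 [Hb1 [Hb2 Hb3]]].
  change (Cmod (cexp (z + h) - cexp z - h * cexp z)%C <= eps0 * Cmod h).
  rewrite cexp_plus.
  replace (cexp z * cexp h - cexp z - h * cexp z)%C with (cexp z * (cexp h - 1 - h))%C by ring.
  rewrite Cmod_mult. fold M.
  assert (Hmain : Cmod (cexp h - 1 - h)%C <= 8 * eps * Cmod h).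
  { pose proof (re_le_Cmod h) as Hr. pose proof (Rmax_Cmod h) as Hi0.
    assert (Hi : Rabs (snd h) <= Cmod h) by (eapply Rle_trans; [apply Rmax_r|exact Hi0]).
    unfold Re in Hr.
    destruct h as [x y]; simpl in Hr, Hi. set (m := Cmod (x, y)) in *.
    specialize (H1 x ltac:(lra)). specialize (H2 y ltac:(lra)). specialize (H3 y ltac:(lra)).
    rewrite exp_0 in H1. rewrite sin_0 in H2. rewrite cos_0 in H3.
    pose proof (COS_bound y) as Hc. 
    assert (Hm : 0 <= m) by apply Cmod_ge_0.
    eapply Rle_trans; [apply Cmod_le_Rabs|]. unfold cexp; simpl.
    assert (A1 : Rabs (exp x - 1 - x) <= eps * m).
    { replace (exp x - 1 - 1 * x) with (exp x - 1 - x) in H1 by ring. nra. }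
    assert (A2 : Rabs (sin y - y) <= eps * m).
    { replace (sin y - 0 - 1 * y) with (sin y - y) in H2 by ring. nra. }
    assert (A3 : Rabs (cos y - 1) <= eps * m).
    { replace (cos y - 1 - 0 * y) with (cos y - 1) in H3 by ring. nra. }
    assert (Hx1 : Rabs x <= 1 / 2) by lra. assert (Hy1 : Rabs y <= 1 / 2) by lra.
    assert (Hxe : Rabs x <= eps) by lra.
    assert (B1 : Rabs (exp x * cos y - 1 - x) <= 3 * eps * m).
    { replace (exp x * cos y - 1 - x) with ((exp x - 1 - x) * cos y + (1 + x) * (cos y - 1)) by
        ring.
      eapply Rle_trans; [apply Rabs_triang|]. rewrite !Rabs_mult.
      assert (Rabs (cos y) <= 1) by (apply Rabs_le; lra).
      assert (Rabs (1 + x) <= 2) by (eapply Rle_trans; [apply Rabs_triang|]; rewrite Rabs_R1; lra).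
      pose proof (Rabs_pos (cos y)); pose proof (Rabs_pos (exp x - 1 - x)).
      pose proof (Rabs_pos (1 + x)); pose proof (Rabs_pos (cos y - 1)). nra. }
    assert (B2 : Rabs (exp x * sin y - y) <= 4 * eps * m).
    { replace (exp x * sin y - y) with ((exp x - 1 - x) * sin y + x * (sin y - y)
        + x * y + (sin y - y)) by ring.
      assert (S : Rabs (sin y) <= 1) by (apply Rabs_le; apply SIN_bound).
      pose proof (Rabs_triang ((exp x - 1 - x) * sin y + x * (sin y - y) + x * y) (sin y - y)).
      pose proof (Rabs_triang ((exp x - 1 - x) * sin y + x * (sin y - y)) (x * y)).
      pose proof (Rabs_triang ((exp x - 1 - x) * sin y) (x * (sin y - y))).
      rewrite !Rabs_mult in *.
      pose proof (Rabs_pos (sin y)); pose proof (Rabs_pos (exp x - 1 - x)).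
      pose proof (Rabs_pos x); pose proof (Rabs_pos (sin y - y)); pose proof (Rabs_pos y).
      assert (Rabs (exp x - 1 - x) * Rabs (sin y) <= eps * m * 1) by (apply Rmult_le_compat; lra).
      assert (Rabs x * Rabs (sin y - y) <= 1 / 2 * (eps * m)) by (apply Rmult_le_compat; lra).
      assert (Rabs x * Rabs y <= eps * m) by (apply Rmult_le_compat; lra).
      nra. }
    replace (exp x * cos y + - (1) + - x) with (exp x * cos y - 1 - x) by ring.
    replace (exp x * sin y + - 0 + - y) with (exp x * sin y - y) by ring.
    assert (0 <= eps * m) by nra. nra. }
  pose proof (Cmod_ge_0 h). pose proof (Cmod_ge_0 (cexp h - 1 - h)%C).
  assert (M * Cmod (cexp h - 1 - h)%C <= M * (8 * eps * Cmod h)) by (apply Rmult_le_compat_l; lra).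
  assert (8 * eps * M * Cmod h <= eps0 * Cmod h) by (apply Rmult_le_compat_r; lra). nra.
Qed.

Lemma cderivable_cexp z : cderivable1 cexp z.
Proof. eexists; apply cexp_derivative. Qed.

(** The argument is the arc cosine of Re z / |z|, with the sign of Im z. Keeping it in a compact
    interval allows suprema over circles. *)
Lemma polar_principal z : z <> RtoC 0 ->
  exists y, Rabs y <= PI /\ z = cexp (ln (Cmod z), y).
Proof.
  intros Hz. pose proof (proj1 (Cmod_gt_0 z) Hz) as Hp.
  destruct z as [a b]. set (m := Cmod (a, b)) in *.
  assert (Hm : m ^ 2 = a ^ 2 + b ^ 2).
  { unfold m. rewrite Cmod2_alt. reflexivity. }
  unfold cexp; simpl fst; simpl snd. rewrite exp_ln by exact Hp.
  assert (Hab : (a / m) ^ 2 + (b / m) ^ 2 = 1).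
  { replace ((a / m) ^ 2 + (b / m) ^ 2) with ((a ^ 2 + b ^ 2) / m ^ 2) by (field; lra).
    rewrite <- Hm. field; lra. }
  assert (Ha : -1 <= a / m <= 1) by nra.
  assert (Hs : sin (acos (a / m)) = Rabs (b / m)).
  { rewrite sin_acos by exact Ha. rewrite <- sqrt_Rsqr_abs. f_equal. unfold Rsqr; nra. }
  destruct (Rle_dec 0 (b / m)) as [Hb|Hb].
  - exists (acos (a / m)). split; [apply Rabs_le; pose proof (acos_bound (a / m));
      pose proof PI_RGT_0; lra|]. rewrite cos_acos, Hs, Rabs_pos_eq by assumption.
    apply injective_projections; simpl; field; lra.
  - exists (- acos (a / m)). split; [apply Rabs_le; pose proof (acos_bound (a / m));
      pose proof PI_RGT_0; lra|]. rewrite cos_neg, sin_neg, cos_acos, Hs, Rabs_left by lra.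
    apply injective_projections; simpl; field; lra.
Qed.

Lemma polar z : z <> RtoC 0 -> exists y, z = cexp (ln (Cmod z), y).
Proof. intros Hz; destruct (polar_principal z Hz) as [y [_ Hy]]; exists y; exact Hy. Qed.

Lemma cos_eq_1_small t : Rabs t <= PI -> cos t = 1 -> t = 0.
Proof.
  assert (A : forall t, 0 <= t <= PI -> cos t = 1 -> t = 0).
  { intros s Hs H. destruct (Req_dec s 0) as [|Hn]; [assumption|].
    pose proof (cos_decreasing_1 0 s ltac:(lra) ltac:(lra) ltac:(lra) ltac:(lra) ltac:(lra)) as H1.
    rewrite cos_0 in H1; lra. }
  intros Ht H. destruct (Rle_dec 0 t) as [H0|H0].
  - apply A; [rewrite Rabs_pos_eq in Ht; lra|exact H].
  - rewrite Rabs_left in Ht by lra.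
    enough (- t = 0) by lra. apply A; [lra|rewrite cos_neg; exact H].
Qed.

(** The range covers the strips of height 2 PI centred at y', which is how the logarithm of a point
    gets isolated in Cauchy's theorem. *)
Lemma cexp_inj x y x' y' : Rabs (y - y') <= PI -> cexp (x, y) = cexp (x', y') ->
  x = x' /\ y = y'.
Proof.
  intros Hy H.
  assert (Hx : x = x').
  { apply exp_inv. transitivity (Cmod (cexp (x, y))); [symmetry; apply Cmod_cexp|].
    rewrite H; apply Cmod_cexp. }
  split; [exact Hx|]. subst x'.
  enough (y - y' = 0) by lra. apply cos_eq_1_small; [exact Hy|].
  unfold cexp in H; simpl in H. injection H as H1 H2.
  pose proof (exp_pos x) as Hp.
  apply Rmult_eq_reg_l in H1; [|lra]. apply Rmult_eq_reg_l in H2; [|lra].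
  rewrite cos_minus, H1, H2. pose proof (sin2_cos2 y') as S. unfold Rsqr in S; lra.
Qed.

Lemma sector_cexp d delta x y : Rabs (y - d) < delta / 2 -> sector d delta (cexp (x, y)).
Proof.
  intros H. exists (exp x), y. split; [apply exp_pos|]. split; [exact H|reflexivity].
Qed.

Lemma sector_polar d delta z : sector d delta z ->
  exists x y, z = cexp (x, y) /\ Rabs (y - d) < delta / 2.
Proof.
  intros [r [phi [Hr [Hp ->]]]]. exists (ln r), phi. split; [|exact Hp].
  unfold cexp; simpl. rewrite exp_ln by exact Hr. reflexivity.
Qed.

Lemma sector_neq_0 d delta z : sector d delta z -> z <> RtoC 0.
Proof. intros H; destruct (sector_polar d delta z H) as [x [y [-> _]]]. apply cexp_neq_0. Qed.

Lemma sector_mono d delta delta' z : delta <= delta' -> sector d delta z -> sector d delta' z.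
Proof.
  intros Hd [r [phi [Hr [Hp Hz]]]]. exists r, phi. repeat split; [exact Hr|lra|exact Hz].
Qed.

(** Each point of a sector is the centre of a disc inside a wider sector, with radius proportional
    to the distance to the vertex: z'/z is close to 1, hence its argument is small uniformly in z.
    Every passage to a smaller opening below relies on this. *)
Lemma sector_thick d delta1 delta2 : 0 < delta1 -> delta1 < delta2 ->
  exists kappa, 0 < kappa < 1 /\ forall z z', sector d delta1 z ->
    Cmod (z' - z) < kappa * Cmod z -> sector d delta2 z'.
Proof.
  intros H1 H2. set (g := (delta2 - delta1) / 2). assert (Hg : 0 < g) by (unfold g; lra).
  (* With |z'/z - 1| < k, the real part of z'/z exceeds 1/2, so its argument is at most 2k in
     modulus, within the gap g between the half-openings. *)
  set (k := Rmin (1 / 2) (g / 2)).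
  assert (Hk : 0 < k) by (apply Rmin_pos; lra).
  assert (Hk1 : k <= 1 / 2) by apply Rmin_l. assert (Hk2 : k <= g / 2) by apply Rmin_r.
  exists k; split; [lra|]. intros z z' Hz Hzz.
  destruct (sector_polar d delta1 z Hz) as [x [y [-> Hy]]].
  set (w := cexp (x, y)) in *.
  assert (Hw : w <> RtoC 0) by apply cexp_neq_0.
  pose proof (proj1 (Cmod_gt_0 w) Hw) as Hwp.
  destruct (polar (z' / w)%C) as [t Ht].
  { apply Cmod_gt_0. rewrite Cmod_div by exact Hw. apply Rdiv_lt_0_compat; [|exact Hwp].
    pose proof (Cmod_triangle z' (w - z')) as T. replace (z' + (w - z'))%C with w in T by ring.
    replace (w - z')%C with (- (z' - w))%C in T by ring. rewrite Cmod_opp in T. nra. }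
  set (u := (z' / w)%C) in *.
  assert (Hu : Cmod (u - 1) < k).
  { replace (u - 1)%C with ((z' - w) / w)%C by (unfold u; field; exact Hw).
    rewrite Cmod_div by exact Hw. apply (Rmult_lt_reg_r (Cmod w)); [exact Hwp|].
    unfold Rdiv. rewrite Rmult_assoc, Rinv_l, Rmult_1_r by lra. exact Hzz. }
  destruct u as [a b] eqn:Eu.
  assert (Ha : Rabs (a - 1) < k).
  { eapply Rle_lt_trans; [|exact Hu]. pose proof (re_le_Cmod ((a, b) - 1)%C)
      as R. simpl in R. exact R. }
  assert (Hb : Rabs b < k).
  { eapply Rle_lt_trans; [|exact Hu]. pose proof (Rmax_Cmod ((a, b) - 1)%C) as R.
    pose proof (Rmax_r (Rabs (fst ((a, b) - 1)%C)) (Rabs (snd ((a, b) - 1)%C))) as R'.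
    simpl in R, R'. replace (b + - 0) with b in * by ring. lra. }
  apply Rabs_def2 in Ha. assert (Ha0 : 1 / 2 < a) by lra.
  set (p := atan (b / a)).
  assert (Hp : Rabs p < g).
  { assert (Q : forall s, Rabs (atan s) <= Rabs s).
    { intros s. destruct (MVT_abs atan (fun c => / (1 + c ^ 2)) 0 s) as [c [Hc _]].
      - intros c _. exact (derivable_pt_lim_atan c).
      - rewrite atan_0, !Rminus_0_r in Hc. rewrite Hc.
        rewrite <- (Rmult_1_l (Rabs s)) at 2. apply Rmult_le_compat_r; [apply Rabs_pos|].
        rewrite Rabs_pos_eq by (apply Rinv_nonneg; nra).
        rewrite <- Rinv_1. apply Rinv_le_contravar; nra. }
    eapply Rle_lt_trans; [apply Q|]. unfold Rdiv. rewrite Rabs_mult, Rabs_inv.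
    rewrite (Rabs_pos_eq a) by lra.
    apply Rmult_lt_reg_r with a; [lra|]. rewrite Rmult_assoc, Rinv_l, Rmult_1_r by lra.
    assert (g * (1 / 2) < g * a) by (apply Rmult_lt_compat_l; lra). lra. }
  assert (Hpz : (a, b) = cexp (ln (a * sqrt (1 + (b / a) ^ 2)), p)).
  { assert (Hs : 0 < sqrt (1 + (b / a) ^ 2)) by (apply sqrt_lt_R0; pose proof (pow2_ge_0 (b / a));
      lra).
    unfold cexp; cbn [fst snd]. unfold p. rewrite exp_ln by (apply Rmult_lt_0_compat; lra).
    rewrite cos_atan, sin_atan. unfold Rsqr.
    replace (1 + b / a * (b / a)) with (1 + (b / a) ^ 2) by ring.
    set (s := sqrt (1 + (b / a) ^ 2)) in *. clearbody s.
    apply injective_projections; cbn [fst snd]; field; lra. }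
  replace z' with (w * (a, b))%C.
  2:{ rewrite <- Eu. unfold u. field; exact Hw. }
  rewrite Hpz. unfold w. rewrite <- cexp_plus.
  apply sector_cexp. simpl.
  replace (y + p - d) with ((y - d) + p) by ring.
  eapply Rle_lt_trans; [apply Rabs_triang|]. unfold g in Hp. lra.
Qed.

Lemma continuous_vertical (x y : R) : continuous (T := R_UniformSpace) (U := CU) (fun y : R => (x,
    y) : C) y.
Proof.
  apply (continuous_eps (V := CN)). intros eps He. exists eps; split; [exact He|].
  intros y' Hy. change (Cmod ((x, y') - (x, y))%C < eps).
  eapply Rle_lt_trans; [apply Cmod_le_Rabs|]. simpl.
  replace (x + - x) with 0 by ring. rewrite Rabs_R0. fold (y' - y). lra.
Qed.

Lemma continuous_horizontal (x y : R) : continuous (T := R_UniformSpace) (U := CU) (fun x :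
    R => (x, y) : C) x.
Proof.
  apply (continuous_eps (V := CN)). intros eps He. exists eps; split; [exact He|].
  intros x' Hx. change (Cmod ((x', y) - (x, y))%C < eps).
  eapply Rle_lt_trans; [apply Cmod_le_Rabs|]. simpl.
  replace (y + - y) with 0 by ring. rewrite Rabs_R0. fold (x' - x). lra.
Qed.

(** * Cauchy's theorem for rectangles *)

Lemma nested_intervals (u w : nat -> R) :
  (forall n, u n <= u (S n)) -> (forall n, w (S n) <= w n) -> (forall n, u n <= w n) ->
  exists X, forall n, u n <= X <= w n.
Proof.
  intros Hu Hw Huw.
  assert (Iu : forall n k, u n <= u (n + k)%nat).
  { intros n k; induction k as [|k IH]; [rewrite Nat.add_0_r; lra|].
    rewrite Nat.add_succ_r; specialize (Hu (n + k)%nat); lra. }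
  assert (Iw : forall n k, w (n + k)%nat <= w n).
  { intros n k; induction k as [|k IH]; [rewrite Nat.add_0_r; lra|].
    rewrite Nat.add_succ_r; specialize (Hw (n + k)%nat); lra. }
  assert (Hmn : forall m n, u m <= w n).
  { intros m n. pose proof (Iu m n); pose proof (Iw n m); specialize (Huw (m + n)%nat).
    rewrite (Nat.add_comm n m) in *; lra. }
  destruct (completeness (fun x => exists n, x = u n)) as [X [HX1 HX2]].
  - exists (w O). intros x [n ->]; apply Hmn.
  - exists (u O), O; reflexivity.
  - exists X. intros n; split.
    + apply HX1; exists n; reflexivity.
    + apply HX2. intros x [m ->]; apply Hmn.
Qed.

Section Rectangles.
Context {E : CompleteNormedModule C_AbsRing}.

(** The integral of F dz along the positively oriented boundary: bottom minus top, then right minus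
    left with dz = i dy. *)
Definition rect (F : C -> E) (x0 x1 y0 y1 : R) : E :=
  plus (minus (int (fun x => F (x, y0)) x0 x1) (int (fun x => F (x, y1)) x0 x1))
       (cscal Ci
          (minus (int (fun y => F (x1, y)) y0 y1) (int (fun y => F (x0, y)) y0 y1))).

Definition continuous_rect (F : C -> E) (x0 x1 y0 y1 : R) : Prop :=
  forall x y, x0 <= x <= x1 -> y0 <= y <= y1 -> continuous (T := CU) F (x, y).

Lemma continuous_rect_sub (F : C -> E) x0 x1 y0 y1 x0' x1' y0' y1' :
  x0 <= x0' -> x1' <= x1 -> y0 <= y0' -> y1' <= y1 ->
  continuous_rect F x0 x1 y0 y1 -> continuous_rect F x0' x1' y0' y1'.
Proof. intros H1 H2 H3 H4 H x y Hx Hy; apply H; lra. Qed.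

Lemma continuous_along_vertical (F : C -> E) (x y : R) :
  continuous (T := CU) F (x, y) -> continuous (T := R_UniformSpace) (fun y => F (x, y)) y.
Proof.
  intros H. exact (continuous_comp (U := R_UniformSpace) (V := CU) (fun y : R => (x, y))
      F y (continuous_vertical x y) H).
Qed.

Lemma continuous_along_horizontal (F : C -> E) (x y : R) :
  continuous (T := CU) F (x, y) -> continuous (T := R_UniformSpace) (fun x => F (x, y)) x.
Proof.
  intros H. exact (continuous_comp (U := R_UniformSpace) (V := CU) (fun x : R => (x, y))
      F x (continuous_horizontal x y) H).
Qed.

Lemma ex_int_horizontal (F : C -> E) x0 x1 y0 y1 y :
  x0 <= x1 -> y0 <= y <= y1 -> continuous_rect F x0 x1 y0 y1 ->
  ex_int (fun x => F (x, y)) x0 x1.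
Proof.
  intros Hx Hy H. apply ex_int_continuous; [exact Hx|].
  intros x Hxx; apply continuous_along_horizontal, H; assumption.
Qed.

Lemma ex_int_vertical (F : C -> E) x0 x1 y0 y1 x :
  y0 <= y1 -> x0 <= x <= x1 -> continuous_rect F x0 x1 y0 y1 ->
  ex_int (fun y => F (x, y)) y0 y1.
Proof.
  intros Hx Hy H. apply ex_int_continuous; [exact Hx|].
  intros y Hyy; apply continuous_along_vertical, H; assumption.
Qed.

Lemma rect_split_x (F : C -> E) x0 xm x1 y0 y1 :
  x0 <= xm <= x1 -> y0 <= y1 -> continuous_rect F x0 x1 y0 y1 ->
  rect F x0 x1 y0 y1 = plus (rect F x0 xm y0 y1) (rect F xm x1 y0 y1).
Proof.
  intros Hx Hy H. unfold rect.
  assert (A : forall y, y0 <= y <= y1 ->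
    int (fun x => F (x, y)) x0 x1
    = plus (int (fun x => F (x, y)) x0 xm) (int (fun x => F (x, y)) xm x1)).
  { intros y Hyy. symmetry; apply int_chasles.
    - apply (ex_int_horizontal F x0 xm y0 y1); [lra|exact Hyy|].
      eapply continuous_rect_sub; [..|exact H]; lra.
    - apply (ex_int_horizontal F xm x1 y0 y1); [lra|exact Hyy|].
      eapply continuous_rect_sub; [..|exact H]; lra. }
  rewrite (A y0), (A y1) by lra. vec.
Qed.

Lemma rect_split_y (F : C -> E) x0 x1 y0 ym y1 :
  x0 <= x1 -> y0 <= ym <= y1 -> continuous_rect F x0 x1 y0 y1 ->
  rect F x0 x1 y0 y1 = plus (rect F x0 x1 y0 ym) (rect F x0 x1 ym y1).
Proof.
  intros Hx Hy H. unfold rect.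
  assert (A : forall x, x0 <= x <= x1 ->
    int (fun y => F (x, y)) y0 y1
    = plus (int (fun y => F (x, y)) y0 ym) (int (fun y => F (x, y)) ym y1)).
  { intros x Hxx. symmetry; apply int_chasles.
    - apply (ex_int_vertical F x0 x1 y0 ym); [lra|exact Hxx|].
      eapply continuous_rect_sub; [..|exact H]; lra.
    - apply (ex_int_vertical F x0 x1 ym y1); [lra|exact Hxx|].
      eapply continuous_rect_sub; [..|exact H]; lra. }
  rewrite (A x0), (A x1) by lra. vec.
Qed.

Lemma norm_rect_le (F : C -> E) x0 x1 y0 y1 M :
  x0 <= x1 -> y0 <= y1 -> continuous_rect F x0 x1 y0 y1 ->
  (forall x y, x0 <= x <= x1 -> y0 <= y <= y1 -> norm (F (x, y)) <= M) ->
  norm (rect F x0 x1 y0 y1) <= 2 * ((x1 - x0) + (y1 - y0)) * M.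
Proof.
  intros Hx Hy H HM. unfold rect.
  assert (A : forall y, y0 <= y <= y1 -> norm (int (fun x => F (x, y)) x0 x1) <= (x1 - x0) * M).
  { intros y Hyy; apply norm_int_le; [exact Hx| |intros x Hxx; apply HM; assumption].
    apply (ex_int_horizontal F x0 x1 y0 y1); assumption. }
  assert (B : forall x, x0 <= x <= x1 -> norm (int (fun y => F (x, y)) y0 y1) <= (y1 - y0) * M).
  { intros x Hxx; apply norm_int_le; [exact Hy| |intros y Hyy; apply HM; assumption].
    apply (ex_int_vertical F x0 x1 y0 y1); assumption. }
  eapply Rle_trans; [apply enorm_plus_le|].
  pose proof (enorm_minus_le (int (fun x => F (x, y0)) x0 x1) (int (fun x => F (x, y1)) x0 x1)).
  pose proof (enorm_minus_le (int (fun y => F (x1, y)) y0 y1) (int (fun y => F (x0, y)) y0 y1)).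
  pose proof (enorm_scal_le Ci (minus (int (fun y => F (x1, y)) y0 y1) (int (fun y => F (x0, y))
      y0 y1))) as S.
  rewrite Cmod_Ci, Rmult_1_l in S.
  pose proof (A y0 ltac:(lra)); pose proof (A y1 ltac:(lra)).
  pose proof (B x0 ltac:(lra)); pose proof (B x1 ltac:(lra)). lra.
Qed.

(** Affine functions have primitives. This lets the tangent of F be subtracted at no cost in the
    next estimate. *)
Lemma rect_affine (u w : E) x0 x1 y0 y1 :
  rect (fun z => plus u (cscal z w)) x0 x1 y0 y1 = zero.
Proof.
  assert (A : forall c (d : E) a b, int (fun x => plus c (cscal (RtoC x) d)) a b
     = plus (cscal (RtoC (b - a)) c) (cscal (RtoC ((b ^ 2 - a ^ 2) / 2)) d)).
  { intros c d a b. destruct (int_id_scal d a b) as [I1 I2].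
    etransitivity; [apply (int_plus (fun _ => c)); [apply ex_int_const|exact I1]|].
    rewrite I2, int_const. reflexivity. }
  assert (H : forall y, int (fun x => plus u (cscal ((x, y)) w)) x0 x1
     = int (fun x => plus (plus u (cscal ((0, y)) w)) (cscal (RtoC x) w)) x0 x1).
  { intros y. f_equal. apply functional_extensionality; intros x.
    vec_coefs; apply injective_projections; simpl; ring. }
  assert (V : forall x, int (fun y => plus u (cscal ((x, y)) w)) y0 y1
     = int (fun y => plus (plus u (cscal (RtoC x) w)) (cscal (RtoC y) (cscal Ci w))) y0 y1).
  { intros x. f_equal. apply functional_extensionality; intros y.
    vec_coefs; apply injective_projections; simpl; ring. }
  unfold rect. rewrite !H, !V, !A.
  vec_coefs; apply injective_projections; simpl; field.
Qed.

Lemma rect_minus (F G : C -> E) x0 x1 y0 y1 :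
  x0 <= x1 -> y0 <= y1 -> continuous_rect F x0 x1 y0 y1 -> continuous_rect G x0 x1 y0 y1 ->
  rect (fun z => minus (F z) (G z)) x0 x1 y0 y1
  = minus (rect F x0 x1 y0 y1) (rect G x0 x1 y0 y1).
Proof.
  intros Hx Hy HF HG. unfold rect.
  assert (A : forall y, y0 <= y <= y1 -> int (fun x => minus (F (x, y)) (G (x, y))) x0 x1
     = minus (int (fun x => F (x, y)) x0 x1) (int (fun x => G (x, y)) x0 x1)).
  { intros y Hyy. apply (int_minus (fun x => F (x, y)) (fun x => G (x, y)));
      apply (ex_int_horizontal _ x0 x1 y0 y1); assumption. }
  assert (B : forall x, x0 <= x <= x1 -> int (fun y => minus (F (x, y)) (G (x, y))) y0 y1
     = minus (int (fun y => F (x, y)) y0 y1) (int (fun y => G (x, y)) y0 y1)).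
  { intros x Hxx. apply (int_minus (fun y => F (x, y)) (fun y => G (x, y)));
      apply (ex_int_vertical _ x0 x1 y0 y1); assumption. }
  rewrite (A y0), (A y1), (B x0), (B x1) by lra. vec.
Qed.

(** After subtraction of the tangent at (X, Y), the integrand is at most eps/2 times the
    half-perimeter, and the path is twice the half-perimeter long. *)
Lemma rect_local_bound (F : C -> E) X Y eps :
  cderivable F (X, Y) -> 0 < eps -> exists del, 0 < del /\
    forall x0 x1 y0 y1, x0 <= X <= x1 -> y0 <= Y <= y1 -> (x1 - x0) + (y1 - y0) < del ->
      continuous_rect F x0 x1 y0 y1 ->
      norm (rect F x0 x1 y0 y1) <= eps * ((x1 - x0) + (y1 - y0)) ^ 2.
Proof.
  intros [D HD] He. destruct (proj1 (is_derive_eps F (X, Y) D) HD (eps / 2) ltac:(lra))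
      as [del [Hdel H]].
  exists del; split; [exact Hdel|].
  intros x0 x1 y0 y1 HX HY Hd HF.
  set (G := fun z : C => plus (minus (F (X, Y)) (cscal ((X, Y)) D)) (cscal z D) : E).
  assert (HG : continuous_rect G x0 x1 y0 y1).
  { intros x y _ _. apply holo_continuous. unfold G.
    apply holo_plus; [apply holo_cst|].
    apply (holo_scal (fun z => z)); [apply cderivable_id|apply holo_cst]. }
  assert (HFG : rect (fun z => minus (F z) (G z)) x0 x1 y0 y1 = rect F x0 x1 y0 y1).
  { rewrite rect_minus by (assumption || lra).
    unfold G at 1. rewrite rect_affine. vec. }
  rewrite <- HFG. set (s := x1 - x0 + (y1 - y0)) in *.
  assert (Hs : 0 <= s) by (unfold s; lra).
  eapply Rle_trans; [apply (norm_rect_le _ x0 x1 y0 y1 (eps / 2 * s)); [lra|lra| |]|].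
  - intros x y Hx Hy. 
    apply (continuous_minus (U := CU) (V := E) F G); [apply HF|apply HG]; assumption.
  - intros x y Hx Hy.
    assert (Hm : Cmod ((x, y) - (X, Y))%C <= s).
    { eapply Rle_trans; [apply Cmod_le_Rabs|]. simpl. unfold s.
      apply Rplus_le_compat; apply Rabs_le; lra. }
    specialize (H ((x, y) - (X, Y))%C ltac:(lra)).
    replace ((X, Y) + ((x, y) - (X, Y)))%C with ((x, y) : C) in H
      by (apply injective_projections; simpl; ring).
    replace (minus (F (x, y)) (G (x, y))) with
      (minus (minus (F (x, y)) (F (X, Y))) (cscal ((x, y) - (X, Y))%C D)).
    + eapply Rle_trans; [exact H|]. apply Rmult_le_compat_l; lra.
    + unfold G. vec.
  - right; fold s; field.
Qed.

Lemma goursat (F : C -> E) x0 x1 y0 y1 : x0 <= x1 -> y0 <= y1 ->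
  (forall x y, x0 <= x <= x1 -> y0 <= y <= y1 -> cderivable F (x, y)) ->
  rect F x0 x1 y0 y1 = zero.
Proof.
  intros Hx01 Hy01 HF.
  assert (HFc : continuous_rect F x0 x1 y0 y1)
    by (intros x y Hx Hy; apply holo_continuous, HF; assumption).
  apply enorm_eq_zero. apply Rle_antisym; [|apply norm_ge_0].
  apply Rnot_lt_le; intros Hc. set (c := norm (rect F x0 x1 y0 y1)) in *.
  set (a := x1 - x0). set (b := y1 - y0).
  assert (Ha : 0 <= a) by (unfold a; lra). assert (Hb : 0 <= b) by (unfold b; lra).
  set (R n (p : R * R) := rect F (fst p) (fst p + a / 2 ^ n) (snd p) (snd p + b / 2 ^ n)).
  (* Goursat's bisection: [p] is the lower left corner of a rectangle of generation n, which is kept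
     if it carries at least its share c / 4^n of the integral. *)
  set (big n p := Rle_dec (c / 4 ^ n) (norm (R n p))).
  (* The last quarter is taken without a test: if the other three carry less than their share, it
     must carry more. *)
  set (step n p := let u := a / 2 ^ S n in let v := b / 2 ^ S n in
     if big (S n) p then p
     else if big (S n) (fst p + u, snd p) then (fst p + u, snd p)
     else if big (S n) (fst p, snd p + v) then (fst p, snd p + v)
     else (fst p + u, snd p + v)).
  set (p := fix p n := match n with O => (x0, y0) | S n' => step n' (p n') end).
  assert (Hpow : forall n, 0 < 2 ^ n) by (intros n; apply pow_lt; lra).
  assert (Hpow4 : forall n, 4 ^ n = 2 ^ n * 2 ^ n)
    by (intros n; rewrite <- Rpow_mult_distr; f_equal; lra).
  assert (Hhalf : forall t n, t / 2 ^ n = 2 * (t / 2 ^ S n)).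
  { intros t n; simpl; specialize (Hpow n); field; lra. }
  assert (Hpos : forall t n, 0 <= t -> 0 <= t / 2 ^ n).
  { intros t n Ht; apply Rmult_le_pos; [exact Ht|apply Rinv_nonneg, Hpow]. }
  assert (Hmv : forall n q, (fst (step n q) = fst q \/ fst (step n q) = fst q + a / 2 ^ S n) /\
                            (snd (step n q) = snd q \/ snd (step n q) = snd q + b / 2 ^ S n)).
  { intros n q. unfold step. 
    destruct (big (S n) q); [auto|]. destruct (big _ _); [simpl; auto|].
    destruct (big _ _); simpl; auto. }
  assert (Hin : forall n, x0 <= fst (p n) /\ fst (p n) + a / 2 ^ n <= x1 /\
                          y0 <= snd (p n) /\ snd (p n) + b / 2 ^ n <= y1).
  { induction n as [|n IH]; [simpl; unfold a, b; lra|].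
    change (p (S n)) with (step n (p n)). destruct (Hmv n (p n)) as [M1 M2].
    rewrite (Hhalf a n), (Hhalf b n) in IH.
    pose proof (Hpos a (S n) Ha); pose proof (Hpos b (S n) Hb).
    destruct M1 as [-> | ->], M2 as [-> | ->]; lra. }
  assert (Hbig : forall n, c / 4 ^ n <= norm (R n (p n))).
  { induction n as [|n IH].
    - unfold R; simpl. unfold c, a, b. right.
      replace (x0 + (x1 - x0) / 1) with x1 by field.
      replace (y0 + (y1 - y0) / 1) with y1 by field. field.
    - change (p (S n)) with (step n (p n)). unfold step.
      destruct (big (S n) (p n)) as [B1|B1]; [exact B1|].
      destruct (big (S n) (fst (p n) + a / 2 ^ S n, snd (p n))) as [B2|B2]; [exact B2|].
      destruct (big (S n) (fst (p n), snd (p n) + b / 2 ^ S n)) as [B3|B3]; [exact B3|].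
      destruct (Hin n) as [I1 [I2 [I3 I4]]].
      pose proof (Hpos a (S n) Ha) as Pa; pose proof (Hpos b (S n) Hb) as Pb.
      pose proof (Hhalf a n) as Ea; pose proof (Hhalf b n) as Eb.
      assert (Hsum : norm (R n (p n)) <= norm (R (S n) (p n)) + norm (R (S n) (fst (p n)
          + a / 2 ^ S n, snd (p n)))
         + (norm (R (S n) (fst (p n), snd (p n) + b / 2 ^ S n))
         + norm (R (S n) (fst (p n) + a / 2 ^ S n, snd (p n) + b / 2 ^ S n)))).
      { unfold R; cbn [fst snd]. rewrite Ea, Eb.
        set (u := a / 2 ^ S n) in *; set (v := b / 2 ^ S n) in *.
        set (X := fst (p n)) in *; set (Y := snd (p n)) in *.
        replace (X + u + u) with (X + 2 * u) by ring.
        replace (Y + v + v) with (Y + 2 * v) by ring.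
        rewrite (rect_split_y F X (X + 2 * u) Y (Y + v) (Y + 2 * v)) by
          first [lra | eapply continuous_rect_sub; [..|exact HFc]; lra].
        rewrite (rect_split_x F X (X + u) (X + 2 * u) Y (Y + v)) by
          first [lra | eapply continuous_rect_sub; [..|exact HFc]; lra].
        rewrite (rect_split_x F X (X + u) (X + 2 * u) (Y + v) (Y + 2 * v)) by
          first [lra | eapply continuous_rect_sub; [..|exact HFc]; lra].
        eapply Rle_trans; [apply enorm_plus_le|].
        apply Rplus_le_compat; apply enorm_plus_le. }
      assert (H4 : c / 4 ^ n = 4 * (c / 4 ^ S n)).
      { simpl. assert (0 < 4 ^ n) by (apply pow_lt; lra). field; lra. }
      lra. }
  destruct (nested_intervals (fun n => fst (p n)) (fun n => fst (p n) + a / 2 ^ n)) as [X HX].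
  { intros n. change (p (S n)) with (step n (p n)). destruct (Hmv n (p n)) as [M1 _].
    pose proof (Hpos a (S n) Ha). destruct M1 as [-> | ->]; lra. }
  { intros n. change (p (S n)) with (step n (p n)). destruct (Hmv n (p n)) as [M1 _].
    pose proof (Hpos a (S n) Ha). rewrite (Hhalf a n). destruct M1 as [-> | ->]; lra. }
  { intros n. pose proof (Hpos a n Ha). lra. }
  destruct (nested_intervals (fun n => snd (p n)) (fun n => snd (p n) + b / 2 ^ n)) as [Y HY].
  { intros n. change (p (S n)) with (step n (p n)). destruct (Hmv n (p n)) as [_ M1].
    pose proof (Hpos b (S n) Hb). destruct M1 as [-> | ->]; lra. }
  { intros n. change (p (S n)) with (step n (p n)). destruct (Hmv n (p n)) as [_ M1].
    pose proof (Hpos b (S n) Hb). rewrite (Hhalf b n). destruct M1 as [-> | ->]; lra. }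
  { intros n. pose proof (Hpos b n Hb). lra. }
  (* Chosen so that eps (a + b)^2 < c; the added 1 covers degenerate rectangles. *)
  set (eps := c / (2 * ((a + b) ^ 2 + 1))).
  assert (Hab : 0 < (a + b) ^ 2 + 1) by (pose proof (pow2_ge_0 (a + b)); lra).
  assert (He : 0 < eps) by (apply Rdiv_lt_0_compat; lra).
  destruct (rect_local_bound F X Y eps) as [del [Hdel Hloc]]; [|exact He|].
  { apply HF; [specialize (HX O)|specialize (HY O)]; simpl in *; unfold a, b in *; lra. }
  destruct (pow_lt_1_zero (1 / 2) ltac:(rewrite Rabs_pos_eq; lra) (del / (a + b + 1))
      ltac:(apply Rdiv_lt_0_compat; lra)) as [N HN].
  specialize (HN N (le_n N)). rewrite Rabs_pos_eq in HN by (apply pow_le; lra).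
  assert (HNi : (1 / 2) ^ N = / 2 ^ N) by (unfold Rdiv; rewrite Rmult_1_l; apply pow_inv).
  rewrite HNi in HN.
  destruct (Hin N) as [I1 [I2 [I3 I4]]].
  assert (Hsmall : norm (R N (p N)) <= eps * (a / 2 ^ N + b / 2 ^ N) ^ 2).
  { unfold R.
    replace (a / 2 ^ N + b / 2 ^ N) with
      ((fst (p N) + a / 2 ^ N - fst (p N)) + (snd (p N) + b / 2 ^ N - snd (p N))) by ring.
    apply Hloc.
    - apply HX.
    - apply HY.
    - replace (fst (p N) + a / 2 ^ N - fst (p N) + (snd (p N) + b / 2 ^ N - snd (p N)))
        with ((a + b) * / 2 ^ N) by (unfold Rdiv; ring).
      apply Rle_lt_trans with ((a + b) * (del / (a + b + 1))); [apply Rmult_le_compat_l; lra|].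
      apply Rmult_lt_reg_r with (a + b + 1); [lra|].
      replace ((a + b) * (del / (a + b + 1)) * (a + b + 1)) with ((a + b) * del) by (field;
          lra). nra.
    - eapply continuous_rect_sub; [..|exact HFc]; lra. }
  specialize (Hbig N).
  assert (Hq : eps * (a / 2 ^ N + b / 2 ^ N) ^ 2 < c / 4 ^ N).
  { rewrite Hpow4. unfold eps. specialize (Hpow N).
    replace (c / (2 * ((a + b) ^ 2 + 1)) * (a / 2 ^ N + b / 2 ^ N) ^ 2)
      with (c / (2 ^ N * 2 ^ N) * ((a + b) ^ 2 / (2 * ((a + b) ^ 2 + 1)))) by (field; lra).
    rewrite <- (Rmult_1_r (c / (2 ^ N * 2 ^ N))) at 2.
    apply Rmult_lt_compat_l; [apply Rdiv_lt_0_compat; [exact Hc|nra]|].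
    apply Rmult_lt_reg_r with (2 * ((a + b) ^ 2 + 1)); [lra|].
    unfold Rdiv. rewrite Rmult_assoc, Rinv_l, Rmult_1_r, Rmult_1_l by lra.
    pose proof (pow2_ge_0 (a + b)). lra. }
  lra.
Qed.

End Rectangles.

(** The common form of the limits below, where a square, a circle or an inverse radius t shrinks to
    0. *)
Lemma Rle_0_of_small (x M : R) : (exists t0, 0 < t0 /\ forall t, 0 < t < t0 -> x <= t * M) -> x <=
    0.
Proof.
  intros [t0 [Ht0 H]]. apply Rnot_lt_le; intros Hx.
  set (t := Rmin (t0 / 2) (x / (2 * (Rabs M + 1)))).
  pose proof (Rabs_pos M) as HM.
  assert (Ht : 0 < t) by (apply Rmin_pos; [lra|apply Rdiv_lt_0_compat; lra]).
  assert (Ht1 : t <= t0 / 2) by apply Rmin_l.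
  assert (Ht2 : t <= x / (2 * (Rabs M + 1))) by apply Rmin_r.
  specialize (H t ltac:(lra)).
  assert (t * M <= x / (2 * (Rabs M + 1)) * (Rabs M + 1)).
  { apply Rle_trans with (t * (Rabs M + 1)).
    - apply Rmult_le_compat_l; [lra|]. pose proof (Rle_abs M); lra.
    - apply Rmult_le_compat_r; lra. }
  replace (x / (2 * (Rabs M + 1)) * (Rabs M + 1)) with (x / 2) in * by (field; lra). lra.
Qed.

(** * Cauchy's theorem on circles *)

Section Cauchy.
Context {E : CompleteNormedModule C_AbsRing}.

Lemma continuous_locally_bounded (F : C -> E) (z : C) : continuous (T := CU) F z ->
  exists r, 0 < r /\ forall y, Cmod (y - z) < r -> norm (F y) <= norm (F z) + 1.
Proof.
  intros H. destruct (proj1 (continuous_C_eps (V := E) F z) H 1 Rlt_0_1) as [r [Hr H1]].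
  exists r; split; [exact Hr|]. intros y Hy; specialize (H1 y Hy).
  assert (H2 : norm (minus (F y) (F z)) < 1) by exact H1.
  pose proof (enorm_le_minus (F y) (F z)). lra.
Qed.

(** Allows for the removable singularity of the difference quotient in Cauchy's formula. Cutting out
    a square of side 2t around the point leaves four rectangles with vanishing integral, and the
    square contributes at most its perimeter 8t times a local bound. *)
Lemma goursat_except (F : C -> E) x0 x1 y0 y1 X Y :
  x0 < X < x1 -> y0 < Y < y1 -> continuous_rect F x0 x1 y0 y1 ->
  (forall x y, x0 <= x <= x1 -> y0 <= y <= y1 -> (x, y) <> (X, Y) -> cderivable F (x, y)) ->
  rect F x0 x1 y0 y1 = zero.
Proof.
  intros HX HY HFc HF.
  apply enorm_eq_zero, Rle_antisym; [|apply norm_ge_0].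
  destruct (continuous_locally_bounded F (X, Y)) as [r [Hr HM]]; [apply HFc; lra|].
  apply Rle_0_of_small with (8 * (norm (F (X, Y)) + 1)).
  set (t0 := Rmin (r / 2) (Rmin (Rmin (X - x0) (x1 - X)) (Rmin (Y - y0) (y1 - Y)))).
  exists t0. split; [unfold t0; repeat apply Rmin_pos; lra|].
  intros t Ht.
  assert (Hs : t < r / 2 /\ t < X - x0 /\ t < x1 - X /\ t < Y - y0 /\ t < y1 - Y).
  { destruct Ht as [_ Ht]. unfold t0 in Ht.
    repeat match goal with
    | H : _ < Rmin ?a ?b |- _ =>
        pose proof (Rlt_le_trans _ _ _ H (Rmin_l a b));
        pose proof (Rlt_le_trans _ _ _ H (Rmin_r a b)); clear H
    end. tauto. }
  assert (Sub : forall a b c d, x0 <= a -> b <= x1 -> y0 <= c -> d <= y1 ->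
      continuous_rect F a b c d).
  { intros; eapply continuous_rect_sub; [..|exact HFc]; assumption. }
  assert (Z : forall a b c d, x0 <= a -> a <= b -> b <= x1 -> y0 <= c -> c <= d -> d <= y1 ->
     (forall x y, a <= x <= b -> c <= y <= d -> x <> X \/ y <> Y) -> rect F a b c d = zero).
  { intros a b c d H1 H2 H3 H4 H5 H6 H7. apply goursat; [assumption..|].
    intros x y Hx Hy. apply HF; [lra|lra|].
    intros Heq; injection Heq as E1 E2. destruct (H7 x y Hx Hy); contradiction. }
  assert (Heq : rect F x0 x1 y0 y1 = rect F (X - t) (X + t) (Y - t) (Y + t)).
  { rewrite (rect_split_x F x0 (X - t) x1) by first [lra | apply Sub; lra].
    rewrite (rect_split_x F (X - t) (X + t) x1) by first [lra | apply Sub; lra].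
    rewrite (rect_split_y F (X - t) (X + t) y0 (Y - t) y1) by first [lra | apply Sub; lra].
    rewrite (rect_split_y F (X - t) (X + t) (Y - t) (Y + t) y1) by first [lra | apply Sub; lra].
    rewrite (Z x0 (X - t) y0 y1), (Z (X + t) x1 y0 y1), (Z (X - t) (X + t) y0 (Y - t)),
      (Z (X - t) (X + t) (Y + t) y1) by first [lra | intros; lra].
    vec. }
  rewrite Heq.
  eapply Rle_trans; [apply (norm_rect_le F (X - t) (X + t) (Y - t) (Y + t) (norm (F (X, Y)) + 1))|].
  - lra.
  - lra.
  - apply Sub; lra.
  - intros x y Hx Hy. apply HM. eapply Rle_lt_trans; [apply Cmod_le_Rabs|]. simpl.
    assert (Rabs (x + - X) <= t) by (apply Rabs_le; lra).
    assert (Rabs (y + - Y) <= t) by (apply Rabs_le; lra). lra.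
  - right; ring.
Qed.

Lemma int_periodic (f : R -> E) T a b : (forall x, continuous f x) -> (forall x, f (x + T) = f x) ->
  int f a (a + T) = int f b (b + T).
Proof.
  intros Hf HT.
  assert (Hex : forall a b, ex_int f a b).
  { intros c d; apply (ex_RInt_continuous (V := ER E)); intros x _; apply Hf. }
  rewrite <- (int_chasles f a b (a + T)) by apply Hex.
  rewrite <- (int_chasles f b (b + T) (a + T)) by apply Hex.
  rewrite <- (int_translate f T b a) by apply Hex.
  replace (fun x => f (x + T)) with f
    by (apply functional_extensionality; intros x; symmetry; apply HT).
  assert (H : plus (int f a b) (int f b a) = zero).
  { rewrite int_chasles by apply Hex. exact (RInt_point (V := ER E) a f). }
  transitivity (plus (plus (int f a b) (int f b a)) (int f b (b + T))); [vec|].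
  rewrite H; vec.
Qed.

(** A rectangle of height 2 PI in the logarithmic plane is a slit annulus. By periodicity the two
    sides of the slit cancel, so the integral over a circle does not depend on its radius. *)
Lemma vertical_integrals_eq (F : C -> E) x0 x1 a :
  x0 <= x1 -> (forall x, F (x, a + 2 * PI) = F (x, a)) ->
  rect F x0 x1 a (a + 2 * PI) = zero ->
  int (fun y => F (x0, y)) a (a + 2 * PI) = int (fun y => F (x1, y)) a (a + 2 * PI).
Proof.
  intros Hx HT H. unfold rect in H.
  rewrite (int_ext (fun x => F (x, a + 2 * PI)) (fun x => F (x, a))) in H by auto.
  set (I0 := int (fun y => F (x0, y)) a (a + 2 * PI)) in *.
  set (I1 := int (fun y => F (x1, y)) a (a + 2 * PI)) in *.
  set (J := int (fun x => F (x, a)) x0 x1) in *.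
  (* Multiplication of the boundary integral by i turns i (I1 - I0) into I0 - I1. *)
  transitivity (plus (cscal Ci (plus (minus J J) (cscal Ci (minus I1 I0)))) I1).
  - vec_coefs; apply injective_projections; simpl; ring.
  - rewrite H. vec.
Qed.

Lemma continuous_cexp (f : C -> E) (z : C) : continuous (T := CU) f (cexp z) ->
  continuous (T := CU) (fun z => f (cexp z)) z.
Proof.
  intros H. apply (continuous_comp (U := CU) (V := CU) cexp f); [|exact H].
  apply cderivable1_continuous, cderivable_cexp.
Qed.

(** The circle is shrunk to radius t, where the integrand w g(w) has size O(t). The circles have to
    pass over the point z, at which g is only continuous. *)
Lemma cauchy_circle (g : C -> E) (R x : R) (z : C) a :
  (forall w, Cmod w < R -> continuous (T := CU) g w) ->
  (forall w, Cmod w < R -> w <> z -> cderivable g w) ->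
  Cmod z < exp x < R ->
  int (fun y => cscal (cexp (x, y)) (g (cexp (x, y)))) a (a + 2 * PI) = zero.
Proof.
  intros Hc Hd [Hz Hx].
  set (F := fun zeta : C => cscal (cexp zeta) (g (cexp zeta)) : E).
  assert (HFc : forall u v, u <= x -> continuous (T := CU) F (u, v)).
  { intros u v Hu. apply (continuous_scal (U := CU) (K := C_AbsRing) (V := E)).
    - apply cderivable1_continuous, cderivable_cexp.
    - apply continuous_cexp, Hc. rewrite Cmod_cexp. simpl.
      destruct Hu as [Hu| ->]; [pose proof (exp_increasing u x Hu)|]; lra. }
  assert (HFd : forall u v, u <= x -> cexp (u, v) <> z -> cderivable F (u, v)).
  { intros u v Hu Hn. apply (holo_scal cexp); [apply cderivable_cexp|].
    apply (holo_comp g cexp); [apply cderivable_cexp|]. apply Hd; [|exact Hn].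
    rewrite Cmod_cexp. simpl.
    destruct Hu as [Hu| ->]; [pose proof (exp_increasing u x Hu)|]; lra. }
  assert (HFp : forall u v, F (u, v + 2 * PI) = F (u, v)).
  { intros u v. unfold F. rewrite cexp_periodic. reflexivity. }
  change (int (fun y => F (x, y)) a (a + 2 * PI) = zero).
  pose proof PI_RGT_0 as HPI.
  (* For z <> 0 the rectangle starts at the angle of z minus PI, so that the logarithm of z is an
     interior point and the only preimage of z in it. The point 0 has no preimage at all. *)
  assert (Hb : exists b, forall L, L < x -> (z = RtoC 0 \/ L < ln (Cmod z)) ->
             rect F L x b (b + 2 * PI) = zero).
  { destruct (Ceq_dec z 0) as [->|Hz0].
    - exists 0. intros L HL _. apply goursat; [lra|lra|].
      intros u v Hu Hv. apply HFd; [lra|]. apply cexp_neq_0.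
    - destruct (polar z Hz0) as [y Hy]. exists (y - PI). intros L HL [H0|HLz]; [contradiction|].
      pose proof (proj1 (Cmod_gt_0 z) Hz0) as Hzp.
      apply (goursat_except F _ _ _ _ (ln (Cmod z)) y).
      + split; [exact HLz|]. rewrite <- (ln_exp x). apply ln_increasing; assumption.
      + lra.
      + intros u v Hu Hv; apply HFc; lra.
      + intros u v Hu Hv Hn. apply HFd; [lra|]. intros He. apply Hn.
        rewrite Hy in He. destruct (cexp_inj u v (ln (Cmod z)) y) as [E1 E2].
        * apply Rabs_le; lra.
        * exact He.
        * rewrite E1, E2; reflexivity. }
  destruct Hb as [b Hb].
  rewrite (int_periodic (fun y => F (x, y)) (2 * PI) a b).
  2:{ intros y. apply continuous_along_vertical, HFc; lra. }
  2:{ intros y; apply HFp. }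
  assert (HR : 0 < R) by (pose proof (exp_pos x); lra).
  destruct (continuous_locally_bounded g 0) as [r0 [Hr0 Hg]]; [apply Hc; rewrite Cmod_0; exact HR|].
  apply enorm_eq_zero, Rle_antisym; [|apply norm_ge_0].
  apply Rle_0_of_small with (2 * PI * (norm (g 0) + 1)).
  (* The inner circle must lie where g is bounded, inside the given circle, and inside |z| when z <>
     0; the value 1 for z = 0 imposes nothing else than positivity. *)
  set (t0 := Rmin (Rmin r0 (exp x)) (if Ceq_dec z 0 then 1 else Cmod z)).
  exists t0. split.
  { unfold t0. apply Rmin_pos; [apply Rmin_pos; [exact Hr0|apply exp_pos]|].
    destruct (Ceq_dec z 0) as [|Hn]; [lra|apply Cmod_gt_0, Hn]. }
  intros t Ht. set (L := ln t). assert (HL : exp L = t) by (apply exp_ln; lra).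
  assert (Ht1 : t < r0 /\ t < exp x /\ (z = RtoC 0 \/ t < Cmod z)).
  { destruct Ht as [_ Ht]. unfold t0 in Ht.
    pose proof (Rlt_le_trans _ _ _ Ht (Rmin_l _ _)) as A.
    pose proof (Rlt_le_trans _ _ _ Ht (Rmin_r _ _)) as B.
    pose proof (Rlt_le_trans _ _ _ A (Rmin_l _ _)).
    pose proof (Rlt_le_trans _ _ _ A (Rmin_r _ _)).
    destruct (Ceq_dec z 0); tauto. }
  assert (HLx : L < x) by (apply exp_lt_inv; lra).
  rewrite <- (vertical_integrals_eq F L x b).
  - replace (t * (2 * PI * (norm (g 0) + 1))) with ((b + 2 * PI - b) * (t * (norm (g 0) + 1))) by
      ring.
    apply norm_int_le; [lra| |].
    + apply ex_int_continuous; [lra|]. intros y _. apply continuous_along_vertical, HFc; lra.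
    + intros y _. unfold F. rewrite enorm_scal, Cmod_cexp. simpl. rewrite HL.
      apply Rmult_le_compat_l; [lra|]. apply Hg.
      replace (cexp (L, y) - 0)%C with (cexp (L, y)) by ring. rewrite Cmod_cexp. simpl. lra.
  - lra.
  - intros u; apply HFp.
  - apply Hb; [exact HLx|]. destruct Ht1 as [_ [_ [H0|H0]]]; [left; exact H0|right].
    apply ln_increasing; lra.
Qed.

End Cauchy.

(** * Cauchy's formula, Taylor expansions and integrals with a parameter *)

Section Taylor.
Context {E : CompleteNormedModule C_AbsRing}.

Lemma Cmod_kernel (w z : C) r : Cmod w = r -> Cmod z < r ->
  (w - z)%C <> RtoC 0 /\ Cmod (w / (w - z))%C <= r / (r - Cmod z).
Proof.
  intros Hw Hz.
  assert (Hwz : r - Cmod z <= Cmod (w - z)).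
  { pose proof (Cmod_le_minus w z) as T. lra. }
  assert (Hn : (w - z)%C <> RtoC 0) by (apply Cmod_gt_0; lra).
  split; [exact Hn|]. rewrite Cmod_div, Hw by exact Hn.
  pose proof (Cmod_ge_0 z). apply Rmult_le_compat_l; [lra|]. apply Rinv_le_contravar; lra.
Qed.

(** Computed by pushing the circle out to infinity, where w / (w - z) tends to 1. *)
Lemma kernel_integral (c : E) (z : C) x a : Cmod z < exp x ->
  int (fun y => cscal (cexp (x, y) / (cexp (x, y) - z))%C c) a (a + 2 * PI)
  = cscal (RtoC (2 * PI)) c.
Proof.
  intros Hz. pose proof PI_RGT_0 as HPI.
  set (F := fun zeta : C => cscal (cexp zeta / (cexp zeta - z))%C c : E).
  assert (Hn : forall u v, x <= u -> (cexp (u, v) - z)%C <> RtoC 0).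
  { intros u v Hu. apply (Cmod_kernel _ z (exp u)); [rewrite Cmod_cexp; reflexivity|].
    destruct Hu as [Hu| ->]; [pose proof (exp_increasing x u Hu)|]; lra. }
  assert (HFd : forall u v, x <= u -> cderivable F (u, v)).
  { intros u v Hu. apply (holo_scal (fun zeta => cexp zeta / (cexp zeta - z))%C); [|apply holo_cst].
    apply cderivable_Cmult; [apply cderivable_cexp|].
    apply (cderivable_Cinv (fun zeta => cexp zeta - z)%C); [|apply Hn, Hu].
    apply cderivable_Cminus; [apply cderivable_cexp|apply cderivable1_cst]. }
  change (int (fun y => F (x, y)) a (a + 2 * PI) = cscal (RtoC (2 * PI)) c).
  apply enorm_minus_eq_zero, Rle_antisym; [|apply norm_ge_0].
  apply Rle_0_of_small with (2 * PI * (2 * Cmod z * norm c)).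
  (* Here t is the inverse of the new radius, which is thus larger than the old one and than 2 |z|;
     the latter gives |w - z| >= |w| / 2. *)
  set (t0 := / (exp x + 2 * Cmod z)).
  pose proof (exp_pos x) as Hx. pose proof (Cmod_ge_0 z) as Hz0.
  exists t0; split; [apply Rinv_0_lt_compat; lra|].
  intros t [Ht Ht0].
  assert (Hti : exp x + 2 * Cmod z < / t).
  { unfold t0 in Ht0. apply Rinv_lt_contravar in Ht0; [rewrite Rinv_inv in Ht0; exact Ht0|].
    apply Rmult_lt_0_compat; [exact Ht|apply Rinv_0_lt_compat; lra]. }
  set (X := - ln t). assert (HX : exp X = / t) by (unfold X; rewrite exp_Ropp, exp_ln; auto).
  assert (HxX : x <= X) by (left; apply exp_lt_inv; lra).
  rewrite (vertical_integrals_eq F x X a HxX).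
  2:{ intros u; unfold F; rewrite cexp_periodic; reflexivity. }
  2:{ apply goursat; [exact HxX|lra|intros; apply HFd; lra]. }
  assert (Hex : ex_int (fun y => F (X, y)) a (a + 2 * PI)).
  { apply ex_int_continuous; [lra|]. intros y _.
    apply continuous_along_vertical, holo_continuous, HFd, HxX. }
  replace (cscal (RtoC (2 * PI)) c) with (int (fun _ => c) a (a + 2 * PI))
    by (rewrite int_const; f_equal; f_equal; ring).
  rewrite <- int_minus by (try exact Hex; apply ex_int_const).
  replace (t * (2 * PI * (2 * Cmod z * norm c))) with ((a + 2 * PI - a)
      * (2 * Cmod z * t * norm c)) by ring.
  apply norm_int_le; [lra|apply ex_int_minus; [exact Hex|apply ex_int_const]|].
  intros y _. specialize (Hn X y HxX). unfold F. set (w := cexp (X, y)) in *.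
  assert (Hw : Cmod w = / t) by (unfold w; rewrite Cmod_cexp; exact HX).
  norm_replace (cscal (z / (w - z))%C c); [vec_coefs; field; exact Hn|].
  eapply Rle_trans; [apply enorm_scal_le|]. apply Rmult_le_compat_r; [apply norm_ge_0|].
  rewrite Cmod_div by exact Hn.
  assert (Hwz : / t / 2 <= Cmod (w - z)).
  { pose proof (Cmod_le_minus w z) as T. lra. }
  replace (2 * Cmod z * t) with (Cmod z * / (/ t / 2)) by (field; lra).
  apply Rmult_le_compat_l; [exact Hz0|]. apply Rinv_le_contravar; [lra|exact Hwz].
Qed.

(** On w = exp (x + i y) one has dw = i w dy, hence the kernel w / (w - z) and the constant 2 PI.
    Subtracting f(z) leaves w times a difference quotient, to which [cauchy_circle] applies. *)
Lemma cauchy_formula (f : C -> E) (R x : R) (z : C) a :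
  holomorphic_on (Defs.disc R) f -> Cmod z < exp x < R ->
  int (fun y => cscal (cexp (x, y) / (cexp (x, y) - z))%C (f (cexp (x, y)))) a (a + 2 * PI)
  = cscal (RtoC (2 * PI)) (f z).
Proof.
  intros Hf Hz. pose proof PI_RGT_0 as HPI.
  destruct (Hf z ltac:(unfold Defs.disc; lra)) as [D HD].
  (* The value [D], the derivative at z, makes the quotient continuous there. *)
  set (g := fun w : C => if Ceq_dec w z then D
                         else cscal (/ (w - z))%C (minus (f w) (f z)) : E).
  assert (Hw : forall y, Cmod (cexp (x, y)) = exp x) by (intros; apply Cmod_cexp).
  assert (Hn : forall y, (cexp (x, y) - z)%C <> RtoC 0)
    by (intros y; apply (Cmod_kernel _ z (exp x)); [apply Hw|lra]).
  assert (Hgd : forall w, Cmod w < R -> w <> z -> cderivable g w).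
  { intros w Hw' Hwz.
    apply (holo_ext_loc (fun w => cscal (/ (w - z))%C (minus (f w) (f z))) g w (Cmod (w - z))).
    - apply Cmod_gt_0. intros H0; apply Hwz. apply Cminus_0_eq, H0.
    - intros y Hy. unfold g. destruct (Ceq_dec y z) as [->|]; [|reflexivity].
      exfalso. replace (z - w)%C with (- (w - z))%C in Hy by ring. rewrite Cmod_opp in Hy. lra.
    - apply (holo_scal (fun w => / (w - z))%C).
      + apply (cderivable_Cinv (fun w => w - z)%C).
        * apply cderivable_Cminus; [apply cderivable_id|apply cderivable1_cst].
        * intros H0; apply Hwz. apply Cminus_0_eq, H0.
      + apply (holo_minus f); [apply Hf, Hw'|apply holo_cst]. }
  assert (Hgc : forall w, Cmod w < R -> continuous (T := CU) g w).
  { intros w Hw'. destruct (Ceq_dec w z) as [->|Hwz]; [|apply holo_continuous, Hgd; assumption].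
    apply (continuous_C_eps (V := E)). intros eps He.
    destruct (proj1 (is_derive_eps (V := E) f z D) HD (eps / 2) ltac:(lra)) as [del [Hdel H]].
    exists del; split; [exact Hdel|]. intros y Hy.
    unfold g. destruct (Ceq_dec z z) as [_|]; [|contradiction].
    destruct (Ceq_dec y z) as [Hyz|Hyz].
    - norm_replace (zero : E); [vec|]. rewrite enorm_zero. exact He.
    - specialize (H (y - z)%C Hy). replace (z + (y - z))%C with y in H by ring.
      assert (H' : norm (minus (minus (f y) (f z)) (cscal (y - z)%C D)) <= eps / 2 * Cmod (y - z))
          by exact H.
      assert (Hyz0 : (y - z)%C <> RtoC 0)
        by (intros H0; apply Hyz; apply Cminus_0_eq, H0).
      change (norm (minus (cscal (/ (y - z))%C (minus (f y) (f z))) D) < eps).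
      norm_replace (cscal (/ (y - z))%C
                      (minus (minus (f y) (f z)) (cscal (y - z)%C D)));
        [vec_coefs; field; exact Hyz0|].
      pose proof (proj1 (Cmod_gt_0 _) Hyz0) as Hp.
      eapply Rle_lt_trans; [apply enorm_scal_le|]. rewrite Cmod_inv by exact Hyz0.
      apply Rle_lt_trans with (/ Cmod (y - z) * (eps / 2 * Cmod (y - z))).
      + apply Rmult_le_compat_l; [apply Rinv_nonneg, Hp|exact H'].
      + replace (/ Cmod (y - z) * (eps / 2 * Cmod (y - z))) with (eps / 2) by (field; lra). lra. }
  pose proof (cauchy_circle g R x z a Hgc Hgd Hz) as H0.
  assert (Hk : forall y, cscal (cexp (x, y)) (g (cexp (x, y)))
    = minus (cscal (cexp (x, y) / (cexp (x, y) - z))%C (f (cexp (x, y))))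
            (cscal (cexp (x, y) / (cexp (x, y) - z))%C (f z))).
  { intros y. unfold g. destruct (Ceq_dec (cexp (x, y)) z) as [Heq|_].
    - exfalso. apply (Hn y). rewrite Heq. ring.
    - vec_coefs; field; apply Hn. }
  assert (Hex : forall h : C -> E, (forall y, continuous (T := CU) h (cexp (x, y))) ->
    ex_int (fun y => cscal (cexp (x, y) / (cexp (x, y) - z))%C (h (cexp (x, y)))) a (a + 2 * PI)).
  { intros h Hh. apply ex_int_continuous; [lra|]. intros y _.
    apply (continuous_along_vertical (fun zeta => cscal (cexp zeta / (cexp zeta - z))%C (h (cexp
        zeta)))).
    apply (continuous_scal (U := CU) (K := C_AbsRing) (V := E)).
    - apply cderivable1_continuous.
      apply cderivable_Cmult; [apply cderivable_cexp|].
      apply (cderivable_Cinv (fun zeta => cexp zeta - z)%C); [|apply Hn].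
      apply cderivable_Cminus; [apply cderivable_cexp|apply cderivable1_cst].
    - apply continuous_cexp, Hh. }
  assert (Hpi : a <= a + 2 * PI) by lra.
  assert (H1 : minus (int (fun y => cscal (cexp (x, y) / (cexp (x, y) - z))%C (f (cexp (x, y))))
      a (a + 2 * PI))
    (int (fun y => cscal (cexp (x, y) / (cexp (x, y) - z))%C (f z)) a (a + 2 * PI)) = zero).
  { etransitivity; [|exact H0]. etransitivity; [symmetry; apply int_minus|].
    3:{ apply int_ext; [exact Hpi|]. intros y _; symmetry; apply Hk. }
    - apply Hex. intros y; apply holo_continuous, Hf. unfold Defs.disc. rewrite Hw. lra.
    - apply (Hex (fun _ => f z)). intros y. apply (continuous_const (U := CU) (V := E)). }
  rewrite kernel_integral in H1 by lra. apply enorm_minus_eq_zero.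
  etransitivity; [apply (f_equal norm H1)|apply enorm_zero].
Qed.

Lemma continuous_bounded (f : R -> E) a b : a <= b ->
  (forall x, a <= x <= b -> continuous f x) ->
  exists M, 0 <= M /\ forall x, a <= x <= b -> norm (f x) <= M.
Proof.
  intros Hab Hf.
  destruct (continuity_ab_maj (fun x => norm (f x)) a b Hab) as [m [Hm _]].
  - intros x Hx. apply continuity_pt_filterlim.
    apply (filterlim_comp _ _ _ f norm _ (locally (f x))).
    + apply Hf, Hx.
    + apply (filterlim_norm (V := E)).
  - exists (norm (f m)); split; [apply norm_ge_0|exact Hm].
Qed.

Lemma circle_bound (f : C -> E) (R r : R) : 0 < r < R -> holomorphic_on (Defs.disc R) f ->
  exists M, 0 <= M /\ forall w, Cmod w = r -> norm (f w) <= M.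
Proof.
  intros Hr Hf. set (x := ln r). assert (Hx : exp x = r) by (apply exp_ln; lra).
  pose proof PI_RGT_0 as HPI.
  destruct (continuous_bounded (fun y => f (cexp (x, y))) (- PI) PI ltac:(lra)) as [M [HM0 HM]].
  - intros y _. apply (continuous_along_vertical (fun z => f (cexp z))).
    apply continuous_cexp, holo_continuous, Hf. unfold Defs.disc. rewrite Cmod_cexp.
    cbn [fst]. lra.
  - exists M; split; [exact HM0|]. intros w Hw.
    destruct (polar_principal w) as [y [Hy Heq]]; [apply Cmod_gt_0; lra|].
    rewrite Heq, Hw. apply HM. apply Rabs_le_between, Hy.
Qed.

(** Expands w / (w - z) in Cauchy's formula as a finite geometric sum with its exact remainder
    (z/w)^(N+1) w / (w - z), so no series has to be integrated. *)
Lemma cauchy_taylor (f : C -> E) (R r M : R) :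
  0 < r < R -> holomorphic_on (Defs.disc R) f -> (forall w, Cmod w = r -> norm (f w) <= M) ->
  exists a : nat -> E, forall N (z : C), Cmod z < r ->
    norm (minus (f z) (sum_n (fun n => cscal (z ^ n)%C (a n)) N))
    <= M * (Cmod z / r) ^ S N * (r / (r - Cmod z)).
Proof.
  intros Hr Hf HM. pose proof PI_RGT_0 as HPI.
  set (x := ln r). assert (Hx : exp x = r) by (apply exp_ln; lra).
  assert (Hw : forall y, Cmod (cexp (x, y)) = r) by (intros; rewrite Cmod_cexp; exact Hx).
  assert (Hw0 : forall y, cexp (x, y) <> RtoC 0) by (intros; apply cexp_neq_0).
  set (p := RtoC (/ (2 * PI))).
  set (I := fun k : C -> C => int (fun y => cscal (k (cexp (x, y))) (f (cexp (x, y))))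
      0 (0 + 2 * PI)).
  set (a := fun n => cscal p (I (fun w => (/ w) ^ n)%C) : E).
  set (rem := fun N (z : C) => cscal p (I (fun w => (z / w) ^ N * (w / (w - z)))%C) : E).
  assert (Hex : forall k : C -> C, (forall y, cderivable1 k (cexp (x, y))) ->
    ex_int (fun y => cscal (k (cexp (x, y))) (f (cexp (x, y)))) 0 (0 + 2 * PI)).
  { intros k Hk. apply ex_int_continuous; [lra|]. intros y _.
    apply (continuous_along_vertical (fun zeta => cscal (k (cexp zeta)) (f (cexp zeta)))).
    apply holo_continuous, (holo_comp (fun w => cscal (k w) (f w)) cexp); [apply cderivable_cexp|].
    apply (holo_scal k); [apply Hk|]. apply Hf. unfold Defs.disc. rewrite Hw. lra. }
  assert (Hpow : forall (k : C -> C) w N, cderivable1 k w -> cderivable1 (fun w => k w ^ N)%C w).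
  { intros k w N Hk. induction N as [|N IH]; [exact (cderivable_cst (V := CN) (RtoC 1) w)|].
    apply cderivable_Cmult; [exact Hk|exact IH]. }
  assert (Hka : forall N y, cderivable1 (fun w => (/ w) ^ N)%C (cexp (x, y))).
  { intros N y. apply (Hpow (fun w => / w)%C). apply cderivable_inv, Hw0. }
  assert (Hkr : forall N z y, Cmod z < r -> cderivable1 (fun w => (z / w)
      ^ N * (w / (w - z)))%C (cexp (x, y))).
  { intros N z y Hz. apply cderivable_Cmult.
    - apply (Hpow (fun w => z / w)%C). apply cderivable_Cmult; [apply cderivable1_cst|].
      apply cderivable_inv, Hw0.
    - apply cderivable_Cmult; [apply cderivable_id|].
      apply (cderivable_Cinv (fun w => w - z)%C).
      + apply cderivable_Cminus; [apply cderivable_id|apply cderivable1_cst].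
      + apply (Cmod_kernel _ z r); [apply Hw|exact Hz]. }
  exists a.
  (* [sum_n] includes the index N, so the remainder carries the exponent [S N]. *)
  assert (Hrem : forall N z, Cmod z < r ->
     minus (f z) (sum_n (fun n => cscal (z ^ n)%C (a n)) N) = rem (S N) z).
  { assert (H0 : forall z, Cmod z < r -> rem O z = f z).
    { intros z Hz. unfold rem, I.
      rewrite (int_ext _ (fun y => cscal (cexp (x, y) / (cexp (x, y) - z))%C (f (cexp (x, y))))).
      - rewrite (cauchy_formula f R x z 0 Hf) by lra. unfold p.
        vec_coefs. rewrite RtoC_inv by lra. field.
        intros Hc. apply (RtoC_inj _ 0) in Hc. lra.
      - lra.
      - intros y _. f_equal. simpl. ring. }
    assert (HS : forall N z, Cmod z < r -> minus (rem N z) (cscal (z ^ N)%C (a N)) = rem (S N) z).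
    { intros N z Hz. unfold rem, a.
      transitivity (cscal p (minus (I (fun w => (z / w) ^ N * (w / (w - z)))%C)
        (cscal (z ^ N)%C (I (fun w => (/ w) ^ N)%C)))); [vec|].
      unfold I.
      f_equal. rewrite <- int_scal by apply (Hex (fun w => (/ w) ^ N)%C), Hka.
      rewrite <- int_minus.
      - apply int_ext; [lra|]. intros y _.
        assert (Hn : (cexp (x, y) - z)%C <> RtoC 0) by (apply (Cmod_kernel _ z r);
            [apply Hw|exact Hz]).
        specialize (Hw0 y). set (w := cexp (x, y)) in *.
        vec_coefs. unfold Cdiv. rewrite Cpow_S, Cpow_mult_l. field. split; assumption.
      - apply (Hex (fun w => (z / w) ^ N * (w / (w - z)))%C). intros y; apply Hkr, Hz.
      - apply ex_int_scal. apply (Hex (fun w => (/ w) ^ N)%C), Hka. }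
    intros N z Hz. induction N as [|N IH].
    - rewrite sum_O, <- HS, H0 by exact Hz. reflexivity.
    - rewrite <- HS, <- IH by exact Hz.
      change (sum_n (fun n => cscal (z ^ n)%C (a n)) (S N))
          with (sum_n (fun n => cscal (z ^ n)%C (a n)) (S N) : E).
      rewrite sum_Sn.
      generalize (sum_n (fun n => cscal (z ^ n)%C (a n)) N : E); intros s. vec. }
  intros N z Hz. rewrite Hrem by exact Hz. unfold rem, I.
  eapply Rle_trans; [apply enorm_scal_le|]. unfold p. rewrite Cmod_R, Rabs_pos_eq by
      (apply Rinv_nonneg; lra).
  apply Rle_trans with (/ (2 * PI) * ((0 + 2 * PI - 0) * (M * (Cmod z / r)
      ^ S N * (r / (r - Cmod z))))).
  2:{ right; field; lra. }
  apply Rmult_le_compat_l; [apply Rinv_nonneg; lra|].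
  apply norm_int_le; [lra|apply (Hex (fun w => (z / w) ^ S N * (w / (w - z)))%C); intros y;
      apply Hkr, Hz|].
  intros y _. eapply Rle_trans; [apply enorm_scal_le|]. rewrite Cmod_mult, Cmod_pow, Cmod_div,
      Hw by apply Hw0.
  rewrite (Rmult_comm M), !Rmult_assoc, (Rmult_comm M).
  assert (Hp : 0 <= (Cmod z / r) ^ S N).
  { apply pow_le. apply Rmult_le_pos; [apply Cmod_ge_0|apply Rinv_nonneg; lra]. }
  apply Rmult_le_compat_l; [exact Hp|].
  apply Rmult_le_compat; [apply Cmod_ge_0|apply norm_ge_0| |apply HM, Hw].
  apply (Cmod_kernel _ z r); [apply Hw|exact Hz].
Qed.

(** The constant depends on f only through its bound M, so the estimate is uniform over a family of
    functions; the integral with a parameter needs exactly this. *)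
Lemma taylor_quadratic (f : C -> E) (c : C) (R M : R) : 0 < R ->
  (forall z, Cmod (z - c) < R -> cderivable f z) ->
  (forall z, Cmod (z - c) < R -> norm (f z) <= M) ->
  exists D, forall h, Cmod h < R / 4 ->
    norm (minus (minus (f (c + h)%C) (f c)) (cscal h D)) <= 8 * M / R ^ 2 * Cmod h ^ 2.
Proof.
  intros HR Hf HM.
  destruct (cauchy_taylor (fun h => f (c + h)%C) R (R / 2) M) as [a Ha].
  - lra.
  - intros h Hh. apply (holo_comp f (fun h => c + h)%C).
    + apply cderivable_Cplus; [apply cderivable1_cst|apply cderivable_id].
    + apply Hf. replace (c + h - c)%C with h by ring. exact Hh.
  - intros w Hw. apply HM. replace (c + w - c)%C with w by ring. lra.
  - assert (HM0 : 0 <= M).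
    { apply Rle_trans with (norm (f c)); [apply norm_ge_0|apply (HM c)].
      replace (c - c)%C with (RtoC 0) by ring. rewrite Cmod_0; exact HR. }
    assert (H0 : a O = f c).
    { symmetry; apply enorm_minus_eq_zero, Rle_antisym; [|apply norm_ge_0].
      specialize (Ha O (RtoC 0)). rewrite Cmod_0, sum_O in Ha. specialize (Ha ltac:(lra)).
      replace (M * (0 / (R / 2)) ^ 1 * (R / 2 / (R / 2 - 0))) with 0 in Ha by (field; lra).
      norm_replace (minus (f (c + 0)%C) (cscal (0 ^ 0)%C (a O)));
        [|exact Ha]. rewrite Cplus_0_r. vec_coefs; simpl; ring. }
    exists (a 1%nat). intros h Hh.
    specialize (Ha 1%nat h ltac:(lra)). cbv beta in Ha. rewrite sum_Sn, sum_O in Ha.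
    norm_replace (minus (f (c + h)%C) (plus (cscal (h ^ 0)%C (a 0%nat))
                                         (cscal (h ^ 1)%C (a 1%nat)))).
    { rewrite H0. vec_coefs; simpl; ring. }
    eapply Rle_trans; [exact Ha|].
    pose proof (Cmod_ge_0 h) as Hh0.
    apply Rle_trans with (M * (Cmod h / (R / 2)) ^ 2 * 2).
    + apply Rmult_le_compat_l.
      * apply Rmult_le_pos; [exact HM0|apply pow2_ge_0].
      * apply Rmult_le_reg_r with (R / 2 - Cmod h); [lra|].
        unfold Rdiv at 1. rewrite Rmult_assoc, Rinv_l, Rmult_1_r by lra. lra.
    + right; field; lra.
Qed.

Lemma cauchy_sequence_limit (u : nat -> E) :
  (forall eps, 0 < eps -> exists N, forall n m, (N <= n)%nat -> (N <= m)%nat ->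
      norm (minus (u n) (u m)) < eps) ->
  exists L, forall eps, 0 < eps -> exists N, forall n, (N <= n)%nat -> norm (minus (u n) L) < eps.
Proof.
  intros H.
  destruct (proj1 (filterlim_locally_cauchy (U := E) (F := eventually) u)) as [L HL].
  - intros eps. destruct (H eps (cond_pos eps)) as [N HN].
    exists (fun n => (N <= n)%nat). split; [exists N; auto|].
    intros n m Hn Hm. apply (norm_compat1 (V := E)). apply HN; assumption.
  - exists L. intros eps He.
    destruct (proj1 (filterlim_locally_ball_norm (F := eventually) u L) HL (mkposreal eps He))
        as [N HN].
    exists N; exact HN.
Qed.

(* The difference quotients of the integral are uniformly Cauchy by the quadratic Taylor
   estimate, so no regularity of the derivative of the integrand in the parameter is needed. *)
Lemma holomorphic_parametric_integral (H : C -> R -> E) (t0 : C) (R M a b : R) : a <= b -> 0 < R ->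
  (forall t s, Cmod (t - t0) < R -> a <= s <= b -> cderivable (fun t => H t s) t) ->
  (forall t s, Cmod (t - t0) < R -> a <= s <= b -> norm (H t s) <= M) ->
  (forall t, Cmod (t - t0) < R -> ex_int (H t) a b) ->
  cderivable (fun t => int (H t) a b) t0.
Proof.
  intros Hab HR Hd HM Hex.
  set (K := 8 * Rabs M / R ^ 2).
  assert (HK : 0 <= K).
  { apply Rmult_le_pos; [pose proof (Rabs_pos M); lra|apply Rinv_nonneg, pow_lt, HR]. }
  set (q := fun (h : C) s => cscal (/ h)%C (minus (H (t0 + h)%C s) (H t0 s)) : E).
  set (J := fun t => int (H t) a b).
  set (Q := fun h : C => cscal (/ h)%C (minus (J (t0 + h)%C) (J t0)) : E).
  assert (Ht0 : Cmod (t0 - t0) < R) by (replace (t0 - t0)%C with (RtoC 0) by ring; rewrite Cmod_0;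
      exact HR).
  assert (Hth : forall h, Cmod h < R / 4 -> Cmod (t0 + h - t0) < R)
    by (intros h Hh; replace (t0 + h - t0)%C with h by ring; lra).
  assert (Hq : forall h h' s, h <> RtoC 0 -> h' <> RtoC 0 -> Cmod h < R / 4 -> Cmod h' < R / 4 ->
      a <= s <= b ->
     norm (minus (q h s) (q h' s)) <= K * (Cmod h + Cmod h')).
  { intros h h' s Hn Hn' Hh Hh' Hs.
    destruct (taylor_quadratic (fun t => H t s) t0 R (Rabs M) HR) as [D HD].
    - intros z Hz; apply Hd; assumption.
    - intros z Hz; eapply Rle_trans; [apply HM; assumption|apply Rle_abs].
    - fold K in HD.
      assert (HqD : forall h, h <> RtoC 0 -> Cmod h < R / 4 -> norm (minus (q h s) D) <=
          K * Cmod h).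
      { intros k Hk Hk4. specialize (HD k Hk4). unfold q.
        pose proof (proj1 (Cmod_gt_0 k) Hk) as Hp.
        norm_replace (cscal (/ k)%C
           (minus (minus (H (t0 + k)%C s) (H t0 s)) (cscal k D)));
          [vec_coefs; field; exact Hk|].
        eapply Rle_trans; [apply enorm_scal_le|]. rewrite Cmod_inv by exact Hk.
        apply Rle_trans with (/ Cmod k * (K * Cmod k ^ 2)).
        - apply Rmult_le_compat_l; [apply Rinv_nonneg, Hp|exact HD].
        - right; field; lra. }
      eapply Rle_trans; [apply (enorm_minus_triangle (q h s) D (q h' s))|].
      rewrite (enorm_minus_sym D). pose proof (HqD h Hn Hh). pose proof (HqD h' Hn' Hh'). lra. }
  assert (HqE : forall h, Cmod h < R / 4 -> ex_int (q h) a b).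
  { intros h Hh. apply ex_int_scal, ex_int_minus; [apply Hex, Hth, Hh|apply Hex, Ht0]. }
  assert (HQ : forall h, Cmod h < R / 4 -> Q h = int (q h) a b).
  { intros h Hh. unfold Q, J. rewrite <- int_minus by first [apply Hex, Hth, Hh | apply Hex, Ht0].
    rewrite <- int_scal; [reflexivity|]. apply ex_int_minus; [apply Hex, Hth, Hh|apply Hex, Ht0]. }
  set (K' := (b - a) * K). assert (HK' : 0 <= K') by (apply Rmult_le_pos; lra).
  assert (HQQ : forall h h', h <> RtoC 0 -> h' <> RtoC 0 -> Cmod h < R / 4 -> Cmod h' < R / 4 ->
     norm (minus (Q h) (Q h')) <= K' * (Cmod h + Cmod h')).
  { intros h h' Hn Hn' Hh Hh'. rewrite (HQ h Hh), (HQ h' Hh'), <- int_minus by (apply HqE;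
      assumption).
    unfold K'; rewrite Rmult_assoc. apply norm_int_le; [exact Hab|apply ex_int_minus; apply HqE;
        assumption|].
    intros s Hs; apply Hq; assumption. }
  (* The derivative is constructed along this one sequence of increments; [HQQ] then carries the
     limit over to all small h, with error K' |h|. *)
  set (hn := fun n : nat => RtoC (R / 8 * / (INR n + 1))).
  assert (Hn1 : forall n, 0 < INR n + 1) by (intros n; pose proof (pos_INR n); lra).
  assert (Hhn : forall n, Cmod (hn n) = R / 8 * / (INR n + 1)).
  { intros n; unfold hn. rewrite Cmod_R, Rabs_pos_eq; [reflexivity|].
    apply Rmult_le_pos; [lra|apply Rinv_nonneg, Hn1]. }
  assert (Hhnp : forall n, 0 < Cmod (hn n)).
  { intros n; rewrite Hhn; apply Rmult_lt_0_compat; [lra|apply Rinv_0_lt_compat, Hn1]. }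
  assert (Hhn4 : forall n, Cmod (hn n) < R / 4).
  { intros n; rewrite Hhn. apply Rle_lt_trans with (R / 8 * 1); [|lra].
    apply Rmult_le_compat_l; [lra|]. rewrite <- Rinv_1. apply Rinv_le_contravar; [lra|].
    pose proof (pos_INR n); lra. }
  assert (Hsmall : forall eps, 0 < eps -> exists N, forall n, (N <= n)%nat -> K' * Cmod (hn n)
      < eps).
  { intros eps He. destruct (nfloor_ex (K' * (R / 8) / eps)) as [N [_ HN]].
    { apply Rmult_le_pos; [apply Rmult_le_pos; lra|apply Rinv_nonneg, He]. }
    exists N. intros n Hn. rewrite Hhn.
    apply Rmult_lt_reg_r with ((INR n + 1) / eps); [apply Rdiv_lt_0_compat; [apply Hn1|exact He]|].
    replace (K' * (R / 8 * / (INR n + 1)) * ((INR n + 1) / eps)) with (K' * (R / 8) / eps)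
      by (field; split; [lra|specialize (Hn1 n); lra]).
    replace (eps * ((INR n + 1) / eps)) with (INR n + 1) by (field; lra).
    apply le_INR in Hn. lra. }
  destruct (cauchy_sequence_limit (fun n => Q (hn n))) as [L HL].
  { intros eps He. destruct (Hsmall (eps / 2) ltac:(lra)) as [N HN]. exists N.
    intros n m Hn Hm. eapply Rle_lt_trans; [apply HQQ; try apply Hhn4; apply Cmod_gt_0, Hhnp|].
    pose proof (HN n Hn); pose proof (HN m Hm). lra. }
  exists L. apply is_derive_eps. intros eps He.
  assert (HQL : forall h, h <> RtoC 0 -> Cmod h < R / 4 -> norm (minus (Q h) L) <= K' * Cmod h).
  { intros h Hn Hh. apply Rnot_lt_le; intros Hc.
    set (e := norm (minus (Q h) L) - K' * Cmod h).
    destruct (Hsmall (e / 2) ltac:(unfold e; lra)) as [N1 H1].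
    destruct (HL (e / 2) ltac:(unfold e; lra)) as [N2 H2].
    specialize (H1 (max N1 N2) (Nat.le_max_l _ _)). specialize (H2 (max N1 N2) (Nat.le_max_r _ _)).
    pose proof (HQQ h (hn (max N1 N2)) Hn (proj2 (Cmod_gt_0 _) (Hhnp _)) Hh (Hhn4 _)).
    pose proof (enorm_minus_triangle (Q h) (Q (hn (max N1 N2))) L). unfold e in *. lra. }
  exists (Rmin (R / 4) (eps / (K' + 1))). split.
  { apply Rmin_pos; [lra|apply Rdiv_lt_0_compat; lra]. }
  intros h Hh.
  pose proof (Rlt_le_trans _ _ _ Hh (Rmin_l _ _)) as Hh1.
  pose proof (Rlt_le_trans _ _ _ Hh (Rmin_r _ _)) as Hh2.
  destruct (Ceq_dec h 0) as [->|Hn].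
  - rewrite Cplus_0_r. norm_replace (zero : E); [vec|]. rewrite enorm_zero, Cmod_0. lra.
  - norm_replace (minus (minus (J (t0 + h)%C) (J t0)) (cscal h L)); [reflexivity|].
    norm_replace (cscal h (minus (Q h) L)).
    { unfold Q. vec_coefs; field; exact Hn. }
    eapply Rle_trans; [apply enorm_scal_le|]. rewrite Rmult_comm.
    apply Rmult_le_compat_r; [apply Cmod_ge_0|].
    eapply Rle_trans; [apply HQL; assumption|].
    apply Rle_trans with ((K' + 1) * (eps / (K' + 1))).
    + pose proof (Cmod_ge_0 h). apply Rmult_le_compat; lra.
    + right; field; lra.
Qed.

End Taylor.

(** * Power series and integration against a kernel *)

Notation is_cpseries := (@is_pseries C_AbsRing _).

Section PowerSeries.
Context {E : CompleteNormedModule C_AbsRing}.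

Definition psum (a : nat -> E) (z : C) (N : nat) : E :=
  sum_n (fun n => cscal (z ^ n)%C (a n)) N.

Lemma psum_0 a z : psum a z 0 = a 0%nat.
Proof. unfold psum. rewrite sum_O. exact (scal_one (a 0%nat)). Qed.

Lemma psum_S a z N : psum a z (S N) = plus (psum a z N) (cscal (z ^ S N)%C (a (S N))).
Proof. exact (sum_Sn (fun n => cscal (z ^ n)%C (a n)) N). Qed.

Lemma is_pseries_eps (a : nat -> E) (z : C) (l : E) :
  is_cpseries a z l <->
  (forall eps, 0 < eps -> exists N, forall n, (N <= n)%nat -> norm (minus (psum a z n) l) < eps).
Proof.
  assert (Hext : forall n, sum_n (fun k => scal (pow_n (K := C_AbsRing) z k) (a k)) n = psum a z n).
  { intros n. unfold psum. apply sum_n_ext. intros k. reflexivity. }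
  destruct (filterlim_locally_ball_norm (F := eventually)
    (sum_n (fun k => scal (pow_n (K := C_AbsRing) z k) (a k))) l) as [A B].
  split.
  - intros H eps He. destruct (A H (mkposreal eps He)) as [N HN].
    exists N. intros n Hn. rewrite <- Hext. exact (HN n Hn).
  - intros H. apply B. intros eps. destruct (H eps (cond_pos eps)) as [N HN].
    exists N. intros n Hn. rewrite Hext. exact (HN n Hn).
Qed.

Lemma pseries_sum_unique (a : nat -> E) (z : C) (l l' : E) : is_cpseries a z l ->
    is_cpseries a z l' -> l = l'.
Proof.
  intros H1 H2. apply enorm_minus_eq_zero, Rle_antisym; [|apply norm_ge_0].
  apply Rnot_lt_le; intros Hc.
  destruct (proj1 (is_pseries_eps a z l) H1 _ (Rdiv_lt_0_compat _ 2 Hc ltac:(lra))) as [N1 A1].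
  destruct (proj1 (is_pseries_eps a z l') H2 _ (Rdiv_lt_0_compat _ 2 Hc ltac:(lra))) as [N2 A2].
  specialize (A1 (max N1 N2) (Nat.le_max_l _ _)). specialize (A2 (max N1 N2) (Nat.le_max_r _ _)).
  pose proof (enorm_minus_triangle l (psum a z (max N1 N2)) l') as T.
  rewrite (enorm_minus_sym l (psum a z (max N1 N2))) in T. lra.
Qed.

Lemma is_cpseries_plus (a b : nat -> E) (z : C) (la lb : E) : is_cpseries a z la ->
    is_cpseries b z lb ->
  is_cpseries (fun n => plus (a n) (b n)) z (plus la lb).
Proof. exact (is_pseries_plus (K := C_AbsRing) (V := E) a b z la lb). Qed.

Lemma psum_opp a z N : psum (fun n => opp (a n)) z N = opp (psum a z N).
Proof.
  induction N as [|N IH]; [rewrite !psum_0; reflexivity|].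
  rewrite !psum_S, IH. vec.
Qed.

Lemma is_cpseries_opp (a : nat -> E) (z : C) (l : E) : is_cpseries a z l ->
  is_cpseries (fun n => opp (a n)) z (opp l).
Proof.
  intros H. apply is_pseries_eps. intros eps He.
  destruct (proj1 (is_pseries_eps a z l) H eps He) as [N HN]. exists N. intros n Hn.
  norm_replace (opp (minus (psum a z n) l)); [rewrite psum_opp; vec|].
  rewrite enorm_opp. apply HN, Hn.
Qed.

(** Beyond some index, consecutive partial sums are both within 1 of the limit, so a term is at most
    2; finitely many terms remain. *)
Lemma pseries_coef_bound (a : nat -> E) (z : C) (l : E) : is_cpseries a z l ->
  exists K, 0 <= K /\ forall n, norm (a n) * Cmod z ^ n <= K.
Proof.
  intros H. destruct (proj1 (is_pseries_eps a z l) H 1 Rlt_0_1) as [N HN].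
  assert (Hfin : forall m, exists K, 0 <= K /\ forall n, (n <= m)%nat -> norm (a n) * Cmod z ^ n <=
      K).
  { induction m as [|m [K [HK IH]]].
    - exists (norm (a 0%nat) * Cmod z ^ 0). split.
      + apply Rmult_le_pos; [apply norm_ge_0|apply pow_le, Cmod_ge_0].
      + intros n Hn. replace n with 0%nat by lia. lra.
    - exists (Rmax K (norm (a (S m)) * Cmod z ^ S m)). split.
      + eapply Rle_trans; [exact HK|apply Rmax_l].
      + intros n Hn. destruct (Nat.eq_dec n (S m)) as [->|Hne]; [apply Rmax_r|].
        eapply Rle_trans; [apply IH; lia|apply Rmax_l]. }
  destruct (Hfin N) as [K [HK0 HK]]. exists (Rmax K 2). split.
  { eapply Rle_trans; [exact HK0|apply Rmax_l]. }
  intros n. destruct (Nat.le_gt_cases n N) as [Hn|Hn].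
  - eapply Rle_trans; [apply HK, Hn|apply Rmax_l].
  - eapply Rle_trans; [|apply Rmax_r]. destruct n as [|n]; [lia|].
    pose proof (HN (S n) ltac:(lia)) as H1. pose proof (HN n ltac:(lia)) as H2.
    rewrite Rmult_comm, <- Cmod_pow, <- enorm_scal.
    norm_replace (minus (psum a z (S n)) (psum a z n)); [rewrite psum_S; vec|].
    pose proof (enorm_minus_triangle (psum a z (S n)) l (psum a z n)) as T.
    rewrite (enorm_minus_sym l) in T. lra.
Qed.

(** Comparison with the geometric series of ratio |z| / r. The explicit rate is what makes sums and
    integrals commute later on. *)
Lemma psum_tail (a : nat -> E) (z : C) (l : E) (K r : R) : 0 < r -> 0 <= K -> Cmod z < r ->
  (forall n, norm (a n) * r ^ n <= K) -> is_cpseries a z l ->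
  forall N, norm (minus l (psum a z N)) <= K * (Cmod z / r) ^ S N * (r / (r - Cmod z)).
Proof.
  intros Hr HK Hz Ha Hl N.
  pose proof (Cmod_ge_0 z) as Hz0. set (x := Cmod z / r).
  assert (Hx : 0 <= x < 1).
  { unfold x; split; [apply Rmult_le_pos; [exact Hz0|apply Rinv_nonneg, Hr]|].
    apply Rmult_lt_reg_r with r; [exact Hr|]. unfold Rdiv. rewrite Rmult_assoc, Rinv_l; lra. }
  replace (r / (r - Cmod z)) with (/ (1 - x)) by (unfold x; field; lra).
  assert (Hterm : forall n, norm (cscal (z ^ n)%C (a n)) <= K * x ^ n).
  { intros n. eapply Rle_trans; [apply enorm_scal_le|]. rewrite Cmod_pow.
    specialize (Ha n). unfold x, Rdiv. rewrite Rpow_mult_distr, pow_inv.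
    assert (Hrn : 0 < r ^ n) by (apply pow_lt, Hr).
    apply Rmult_le_reg_r with (r ^ n); [exact Hrn|].
    replace (K * (Cmod z ^ n * / r ^ n) * r ^ n) with (Cmod z ^ n * K) by (field; lra).
    rewrite Rmult_assoc. apply Rmult_le_compat_l; [apply pow_le, Hz0|exact Ha]. }
  assert (Hdiff : forall k, norm (minus (psum a z (N + k)) (psum a z N)) <=
      K * x ^ S N * ((1 - x ^ k) / (1 - x))).
  { induction k as [|k IH].
    - rewrite Nat.add_0_r. norm_replace (zero : E); [vec|]. rewrite enorm_zero. simpl. right;
        field; lra.
    - rewrite Nat.add_succ_r.
      eapply Rle_trans; [apply (enorm_minus_triangle _ (psum a z (N + k)))|].
      assert (H1 : norm (minus (psum a z (S (N + k))) (psum a z (N + k))) <= K * x ^ S (N + k)).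
      { norm_replace (cscal (z ^ S (N + k))%C (a (S (N + k)))); [rewrite psum_S;
          vec|]. apply Hterm. }
      eapply Rle_trans; [apply Rplus_le_compat; [exact H1|exact IH]|].
      right. replace (S (N + k)) with (S N + k)%nat by lia. rewrite pow_add.
      change (x ^ S k) with (x * x ^ k). field; lra. }
  assert (HB : forall k, norm (minus (psum a z (N + k)) (psum a z N)) <= K * x ^ S N * / (1 - x)).
  { intros k. eapply Rle_trans; [apply Hdiff|]. apply Rmult_le_compat_l.
    - apply Rmult_le_pos; [exact HK|apply pow_le; lra].
    - rewrite <- (Rmult_1_l (/ (1 - x))) at 1. apply Rmult_le_compat_r; [apply Rinv_nonneg; lra|].
      assert (0 <= x ^ k) by (apply pow_le; lra). lra. }
  apply Rnot_lt_le; intros Hc.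
  set (e := norm (minus l (psum a z N)) - K * x ^ S N * / (1 - x)).
  destruct (proj1 (is_pseries_eps a z l) Hl e ltac:(unfold e; lra)) as [M HM].
  specialize (HM (N + M)%nat ltac:(lia)). specialize (HB M).
  pose proof (enorm_minus_triangle l (psum a z (N + M)) (psum a z N)) as T.
  rewrite (enorm_minus_sym l (psum a z (N + M))) in T. unfold e in HM. lra.
Qed.

(** The first nonzero coefficient c_n of the difference would contribute t^n |c_n| at a small t > 0,
    while the remaining terms are O(t^(n+1)). *)
Lemma pseries_unique (a b : nat -> E) (f : C -> E) r : 0 < r ->
  (forall z, Cmod z < r -> is_cpseries a z (f z)) ->
  (forall z, Cmod z < r -> is_cpseries b z (f z)) -> forall n, a n = b n.
Proof.
  intros Hr Ha Hb.
  set (c := fun n => plus (a n) (opp (b n)) : E).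
  assert (Hc : forall z, Cmod z < r -> is_cpseries c z (zero : E)).
  { intros z Hz. replace (zero : E) with (plus (f z) (opp (f z)) : E) by vec.
    apply is_cpseries_plus; [apply Ha, Hz|apply is_cpseries_opp, Hb, Hz]. }
  set (p := r / 2).
  assert (Hp : Cmod (RtoC p) = p) by (apply Cmod_RtoC_pos; unfold p; lra).
  destruct (pseries_coef_bound c (RtoC p) zero) as [K [HK0 HK]]; [apply Hc; rewrite Hp; unfold p;
      lra|].
  rewrite Hp in HK.
  assert (Hp0 : 0 < p) by (unfold p; lra).
  enough (H : forall n k, (k < n)%nat -> c k = zero).
  { intros n. specialize (H (S n) n ltac:(lia)). unfold c in H.
    transitivity (plus (plus (a n) (opp (b n))) (b n)); [vec|]. rewrite H; vec. }
  induction n as [|n IH]; intros k Hk; [lia|].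
  destruct (Nat.eq_dec k n) as [->|Hne]; [|apply IH; lia].
  assert (Hsum : forall z, psum c z n = cscal (z ^ n)%C (c n)).
  { intros z. assert (Hz : forall m, (m < n)%nat -> psum c z m = zero).
    { induction m as [|m IHm]; intros Hm; [rewrite psum_0; apply IH, Hm|].
      rewrite psum_S, IHm, (IH (S m)) by lia. vec. }
    destruct n as [|m].
    - rewrite psum_0. symmetry. exact (scal_one (c 0%nat)).
    - rewrite psum_S, Hz by lia. vec. }
  apply enorm_eq_zero, Rle_antisym; [|apply norm_ge_0].
  (* For t < p/2 the factor p / (p - t) of the tail is at most 2, and division by t^n leaves one
     factor t. *)
  apply Rle_0_of_small with (2 * K / p ^ S n).
  exists (p / 2). split; [lra|]. intros t Ht.
  assert (Htm : Cmod (RtoC t) = t) by (apply Cmod_RtoC_pos; lra).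
  pose proof (psum_tail c (RtoC t) zero K p Hp0 HK0 ltac:(rewrite Htm; lra) HK
                (Hc (RtoC t) ltac:(rewrite Htm; unfold p in *; lra)) n) as T.
  rewrite Htm, Hsum in T.
  assert (Htn : 0 < t ^ n) by (apply pow_lt; lra).
  assert (T' : t ^ n * norm (c n) <= K * (t / p) ^ S n * (p / (p - t))).
  { replace (t ^ n) with (Cmod (RtoC t ^ n)%C) by (rewrite Cmod_pow, Htm; reflexivity).
    rewrite <- enorm_scal, <- enorm_opp.
    norm_replace (minus (zero : E) (cscal (RtoC t ^ n)%C (c n))); [vec|exact T]. }
  apply Rmult_le_reg_l with (t ^ n); [exact Htn|]. eapply Rle_trans; [exact T'|].
  assert (Hq : p / (p - t) <= 2).
  { apply Rmult_le_reg_r with (p - t); [lra|]. unfold Rdiv. rewrite Rmult_assoc, Rinv_l; lra. }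
  apply Rle_trans with (K * (t / p) ^ S n * 2).
  - apply Rmult_le_compat_l; [|exact Hq]. apply Rmult_le_pos; [exact HK0|].
    apply pow_le. apply Rmult_le_pos; [lra|apply Rinv_nonneg, Hp0].
  - unfold Rdiv. rewrite Rpow_mult_distr, pow_inv. simpl. right. field.
    split; [apply pow_nonzero|]; lra.
Qed.

Lemma psum_scal_vector (a : nat -> C) (v : E) z N :
  psum (fun n => cscal (a n) v) z N
  = cscal (sum_n (fun n => (z ^ n * a n)%C : C_AbsRing) N) v.
Proof.
  induction N as [|N IH].
  - rewrite psum_0, sum_O. f_equal. simpl. ring.
  - rewrite psum_S, IH, sum_Sn.
    generalize (sum_n (fun n => (z ^ n * a n)%C : C_AbsRing) N); intros s.
    change (plus (scal s v) (cscal (z ^ S N)%C (cscal (a (S N)) v))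
      = cscal (s + z ^ S N * a (S N))%C v). vec.
Qed.

(** Along a nonzero vector, convergence amounts to convergence of the scalar coefficients. The
    kernel, found along one vector, can thus act on all values of v. *)
Lemma pseries_change_vector (a : nat -> C) (g z : C) (e v : E) : norm e <> 0 ->
  is_cpseries (fun n => cscal (a n) e) z (cscal g e) ->
  is_cpseries (fun n => cscal (a n) v) z (cscal g v).
Proof.
  intros He H. apply is_pseries_eps. intros eps Heps.
  assert (He0 : 0 < norm e) by (destruct (norm_ge_0 e) as [|Hz]; [assumption|exfalso; apply He;
      auto]).
  pose proof (norm_ge_0 v) as Hv.
  destruct (proj1 (is_pseries_eps _ z _) H (eps * norm e / (norm v + 1))) as [N HN].
  { apply Rdiv_lt_0_compat; [apply Rmult_lt_0_compat; assumption|lra]. }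
  exists N. intros n Hn. specialize (HN n Hn).
  rewrite psum_scal_vector in *.
  set (s := sum_n (fun n => (z ^ n * a n)%C : C_AbsRing) n : C) in *.
  assert (H1 : Cmod (s - g) * norm e < eps * norm e / (norm v + 1)).
  { rewrite <- enorm_scal. norm_replace (minus (cscal s e) (cscal g e)); [vec|exact HN]. }
  norm_replace (cscal (s - g)%C v); [vec|].
  eapply Rle_lt_trans; [apply enorm_scal_le|].
  assert (H2 : Cmod (s - g) < eps / (norm v + 1)).
  { apply Rmult_lt_reg_r with (norm e); [exact He0|].
    replace (eps / (norm v + 1) * norm e) with (eps * norm e / (norm v + 1)) by (field;
        lra). exact H1. }
  apply Rle_lt_trans with (Cmod (s - g) * (norm v + 1)).
  - apply Rmult_le_compat_l; [apply Cmod_ge_0|lra].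
  - apply Rmult_lt_reg_r with (/ (norm v + 1)); [apply Rinv_0_lt_compat; lra|].
    rewrite Rmult_assoc, Rinv_r, Rmult_1_r by lra. exact H2.
Qed.

Lemma geometric_pseries (v : E) z : Cmod z < 1 ->
  is_cpseries (fun n => cscal (RtoC 1) v) z (cscal (/ (1 - z))%C v).
Proof.
  intros Hz. apply is_pseries_eps. intros eps He.
  assert (Hn : (1 - z)%C <> RtoC 0).
  { intros H0. assert (Hz1 : z = RtoC 1) by (symmetry; apply Cminus_0_eq, H0).
    rewrite Hz1, Cmod_1 in Hz. lra. }
  pose proof (proj1 (Cmod_gt_0 _) Hn) as Hp. pose proof (norm_ge_0 v) as Hv.
  destruct (pow_lt_1_zero (Cmod z) ltac:(rewrite Rabs_pos_eq; [exact Hz|apply Cmod_ge_0])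
     (eps * Cmod (1 - z) / (norm v + 1))) as [N HN].
  { apply Rdiv_lt_0_compat; [apply Rmult_lt_0_compat; assumption|lra]. }
  exists N. intros n Hn'. specialize (HN (S n) ltac:(lia)).
  rewrite Rabs_pos_eq in HN by (apply pow_le, Cmod_ge_0).
  assert (Hs : psum (fun _ => cscal (RtoC 1) v) z n
     = cscal ((1 - z ^ S n) / (1 - z))%C v).
  { clear Hn' HN. induction n as [|n IH].
    - rewrite psum_0. f_equal. simpl. field; exact Hn.
    - rewrite psum_S, IH. vec_coefs. rewrite (Cpow_S z (S n)). field; exact Hn. }
  rewrite Hs. norm_replace (cscal (- (z ^ S n * / (1 - z)))%C v).
  { vec_coefs. field; exact Hn. }
  eapply Rle_lt_trans; [apply enorm_scal_le|].
  rewrite Cmod_opp, Cmod_mult, Cmod_pow, Cmod_inv by exact Hn.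
  apply Rle_lt_trans with (Cmod z ^ S n * / Cmod (1 - z) * (norm v + 1)).
  - apply Rmult_le_compat_l; [|lra]. apply Rmult_le_pos; [apply pow_le, Cmod_ge_0|].
    apply Rinv_nonneg, Hp.
  - apply Rmult_lt_reg_r with (Cmod (1 - z) / (norm v + 1)); [apply Rdiv_lt_0_compat; lra|].
    replace (Cmod z ^ S n * / Cmod (1 - z) * (norm v + 1) * (Cmod (1 - z) / (norm v + 1)))
      with (Cmod z ^ S n) by (field; split; lra).
    replace (eps * (Cmod (1 - z) / (norm v + 1))) with (eps * Cmod (1 - z) / (norm v + 1)) by
        (field; lra).
    exact HN.
Qed.

(* A holomorphic kernel [G] on a disc, given by the scalar power series [a]; the series is only
   ever applied to vectors. *)
Definition scalar_sum (a : nat -> C) (G : C -> C) (rho : R) : Prop :=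
  0 < rho /\
  (forall z, Cmod z < rho -> cderivable1 G z) /\
  (exists K, 0 <= K /\ forall n, Cmod (a n) * rho ^ n <= K) /\
  (forall z (v : E), Cmod z < rho ->
     is_cpseries (fun n => cscal (a n) v) z (cscal (G z) v)).

Lemma ex_int_kernel (k : C -> C) (phi : R -> E) x al be : al <= be ->
  (forall s, al <= s <= be -> cderivable1 k (cexp (x, s))) ->
  (forall s, al <= s <= be -> continuous phi s) ->
  ex_int (fun s => cscal (k (cexp (x, s))) (phi s)) al be.
Proof.
  intros Hab Hk Hphi. apply ex_int_continuous; [exact Hab|]. intros s Hs.
  apply (continuous_scal (U := R_UniformSpace) (K := C_AbsRing) (V := E) (fun s => k (cexp (x,
      s)))); [|apply Hphi, Hs].
  apply (continuous_comp (U := R_UniformSpace) (V := CU) (W := CU) (fun s : R => (x, s) : C)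
      (fun z => k (cexp z)));
    [apply continuous_vertical|].
  apply cderivable1_continuous, (cderivable_comp (V := CN) k cexp);
      [apply cderivable_cexp|apply Hk, Hs].
Qed.

Lemma cderivable_pow_inv w n : w <> RtoC 0 -> cderivable1 (fun w => (/ w) ^ n)%C w.
Proof.
  intros Hw. induction n as [|n IH]; [exact (cderivable_cst (V := CN) (RtoC 1) w)|].
  apply cderivable_Cmult; [apply cderivable_inv, Hw|exact IH].
Qed.

(** Sum and integral commute because |t/w| is constant along the arc and smaller than rho, so the
    tails are bounded uniformly in s. *)
Lemma integral_pseries (a : nat -> C) (G : C -> C) rho (phi : R -> E) x al be t :
  scalar_sum a G rho -> al <= be -> (forall s, al <= s <= be -> continuous phi s) ->
  Cmod t < rho * exp x ->
  is_cpseries (fun n => cscal (a n)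
      (int (fun s => cscal ((/ cexp (x, s)) ^ n)%C (phi s)) al be)) t
    (int (fun s => cscal (G (t / cexp (x, s))%C) (phi s)) al be).
Proof.
  intros [Hrho [HG [[K [HK0 HK]] Hser]]] Hab Hphi Ht.
  destruct (continuous_bounded phi al be Hab Hphi) as [M [HM0 HM]].
  pose proof (exp_pos x) as Hx. pose proof (Cmod_ge_0 t) as Ht0.
  set (r := Cmod t / exp x).
  assert (Hr : 0 <= r < rho).
  { unfold r; split; [apply Rmult_le_pos; [exact Ht0|apply Rinv_nonneg, Hx]|].
    apply Rmult_lt_reg_r with (exp x); [exact Hx|]. unfold Rdiv. rewrite Rmult_assoc, Rinv_l; lra. }
  assert (Hw0 : forall s, cexp (x, s) <> RtoC 0) by (intros; apply cexp_neq_0).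
  assert (Hrs : forall s, Cmod (t / cexp (x, s)) = r).
  { intros s. rewrite Cmod_div, Cmod_cexp by apply Hw0. reflexivity. }
  set (b := fun n => cscal (a n)
      (int (fun s => cscal ((/ cexp (x, s)) ^ n)%C (phi s)) al be) : E).
  assert (Hexn : forall n, ex_int (fun s => cscal ((/ cexp (x, s)) ^ n)%C (phi s)) al be).
  { intros n. apply (ex_int_kernel (fun w => (/ w) ^ n)%C); [exact Hab| |exact Hphi].
    intros s _; apply cderivable_pow_inv, Hw0. }
  assert (HexG : ex_int (fun s => cscal (G (t / cexp (x, s))%C) (phi s)) al be).
  { apply (ex_int_kernel (fun w => G (t / w)%C)); [exact Hab| |exact Hphi].
    intros s _. apply (cderivable_comp (V := CN) G (fun w => t / w)%C).
    - apply cderivable_Cmult; [apply cderivable1_cst|apply cderivable_inv, Hw0].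
    - apply HG. rewrite Hrs; lra. }
  set (S := fun N s => psum (fun n => cscal (a n) (phi s)) (t / cexp (x, s))%C N).
  assert (HS : forall N, ex_int (S N) al be /\ psum b t N = int (S N) al be).
  { assert (Hterm : forall n, ex_int (fun s => cscal ((t / cexp (x, s)) ^ n)%C (cscal (a n)
      (phi s))) al be
       /\ cscal (t ^ n)%C (b n)
          = int (fun s => cscal ((t / cexp (x, s)) ^ n)%C (cscal (a n) (phi s))) al be).
    { intros n.
      assert (Heq : forall s, al <= s <= be -> 
          cscal (t ^ n * a n)%C (cscal ((/ cexp (x, s)) ^ n)%C (phi s))
          = cscal ((t / cexp (x, s)) ^ n)%C (cscal (a n) (phi s))).
      { intros s _. unfold Cdiv. rewrite Cpow_mult_l. vec. }
      split.
      - eapply ex_int_ext; [exact Hab|exact Heq|]. apply ex_int_scal, Hexn.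
      - rewrite <- (int_ext _ _ al be Hab Heq), int_scal by apply Hexn. unfold b. vec. }
    induction N as [|N [IH1 IH2]].
    - destruct (Hterm O) as [T1 T2].
      assert (Heq : forall s, cscal ((t / cexp (x, s)) ^ 0)%C (cscal (a 0%nat) (phi s)) = S O s).
      { intros s. unfold S. rewrite psum_0. exact (scal_one _). }
      split.
      + eapply ex_int_ext; [exact Hab|intros s _; apply Heq|exact T1].
      + rewrite psum_0. rewrite <- (int_ext _ _ al be Hab (fun s _ => Heq s)), <- T2.
        symmetry. exact (scal_one (b 0%nat)).
    - destruct (Hterm (Datatypes.S N)) as [T1 T2].
      assert (Heq : forall s, plus (S N s) (cscal ((t / cexp (x, s))
          ^ Datatypes.S N)%C (cscal (a (Datatypes.S N)) (phi s))) = S (Datatypes.S N) s).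
      { intros s. unfold S. rewrite psum_S. reflexivity. }
      split.
      + eapply ex_int_ext; [exact Hab|intros s _; apply Heq|].
        apply ex_int_plus; [exact IH1|exact T1].
      + rewrite psum_S, <- (int_ext _ _ al be Hab (fun s _ => Heq s)), int_plus by assumption.
        rewrite <- T2, IH2. reflexivity. }
  assert (Hbound : forall N, norm (minus (psum b t N) (int (fun s => cscal (G (t / cexp (x, s))%C)
      (phi s)) al be))
     <= (be - al) * (K * M * (r / rho) ^ Datatypes.S N * (rho / (rho - r)))).
  { intros N. destruct (HS N) as [S1 S2]. rewrite S2, <- int_minus by assumption.
    apply norm_int_le; [exact Hab|apply ex_int_minus; assumption|].
    intros s Hs. rewrite enorm_minus_sym. rewrite <- (Hrs s) at 1 2.
    unfold S. apply psum_tail.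
    - exact Hrho.
    - apply Rmult_le_pos; assumption.
    - rewrite Hrs; lra.
    - intros n. rewrite enorm_scal.
      replace (Cmod (a n) * norm (phi s) * rho ^ n) with (Cmod (a n) * rho ^ n * norm (phi s)) by
          ring.
      apply Rmult_le_compat; [|apply norm_ge_0|apply HK|apply HM, Hs].
      apply Rmult_le_pos; [apply Cmod_ge_0|apply pow_le; lra].
    - apply Hser. rewrite Hrs; lra. }
  apply is_pseries_eps. intros eps He.
  set (Q := (be - al) * (K * M * (rho / (rho - r)))).
  assert (HQ : 0 <= Q).
  { unfold Q. apply Rmult_le_pos; [lra|]. apply Rmult_le_pos; [apply Rmult_le_pos; assumption|].
    apply Rmult_le_pos; [lra|apply Rinv_nonneg; lra]. }
  assert (Hq : 0 <= r / rho < 1).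
  { split; [apply Rmult_le_pos; [lra|apply Rinv_nonneg, Hrho]|].
    apply Rmult_lt_reg_r with rho; [exact Hrho|]. unfold Rdiv. rewrite Rmult_assoc, Rinv_l; lra. }
  destruct (pow_lt_1_zero (r / rho) ltac:(rewrite Rabs_pos_eq; lra) (eps / (Q + 1))) as [N HN];
    [apply Rdiv_lt_0_compat; lra|].
  exists N. intros n Hn. specialize (HN (Datatypes.S n) ltac:(lia)).
  rewrite Rabs_pos_eq in HN by (apply pow_le; lra).
  eapply Rle_lt_trans; [apply Hbound|].
  set (y := (r / rho) ^ Datatypes.S n) in *.
  replace ((be - al) * (K * M * y * (rho / (rho - r)))) with (Q * y) by (unfold Q; ring).
  apply Rle_lt_trans with ((Q + 1) * y).
  - apply Rmult_le_compat_r; [apply pow_le; lra|lra].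
  - apply Rmult_lt_reg_r with (/ (Q + 1)); [apply Rinv_0_lt_compat; lra|].
    replace ((Q + 1) * y * / (Q + 1)) with y by (field; lra). exact HN.
Qed.

End PowerSeries.

(** * Functions with values in a complex line *)

Section Line.
Context {E : CompleteNormedModule C_AbsRing}.

Definition in_line (e x : E) : Prop := exists c : C, x = cscal c e.

Lemma in_line_minus e x y : in_line e x -> in_line e y -> in_line e (minus x y).
Proof. intros [c ->] [d ->]. exists (c - d)%C. vec. Qed.

Lemma in_line_plus e x y : in_line e x -> in_line e y -> in_line e (plus x y).
Proof. intros [c ->] [d ->]. exists (c + d)%C. vec. Qed.

Lemma in_line_scal e (k : C) x : in_line e x -> in_line e (cscal k x).
Proof. intros [c ->]. exists (k * c)%C. vec. Qed.

Lemma norm_pos (e : E) : norm e <> 0 -> 0 < norm e.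
Proof. intros He. destruct (norm_ge_0 e) as [|Hz]; [assumption|exfalso; apply He; auto]. Qed.

(** As e is nonzero, the scalars of approximating multiples of e form a Cauchy sequence in C. *)
Lemma in_line_closed (e x : E) : norm e <> 0 ->
  (forall eps, 0 < eps -> exists y, in_line e y /\ norm (minus x y) < eps) -> in_line e x.
Proof.
  intros He H. pose proof (norm_pos e He) as He0.
  assert (Hn1 : forall n, 0 < INR n + 1) by (intros n; pose proof (pos_INR n); lra).
  assert (H1 : forall n : nat, exists c : C, norm (minus x (cscal c e)) < / (INR n + 1)).
  { intros n. destruct (H (/ (INR n + 1))) as [y [[c ->] Hy]]; [apply Rinv_0_lt_compat, Hn1|].
    exists c; exact Hy. }
  set (c := fun n => proj1_sig (constructive_indefinite_description _ (H1 n))).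
  assert (Hc : forall n, norm (minus x (cscal (c n) e)) < / (INR n + 1))
    by (intros n; exact (proj2_sig (constructive_indefinite_description _ (H1 n)))).
  assert (Hinv : forall eps, 0 < eps -> exists N, forall n, (N <= n)%nat -> / (INR n + 1) < eps).
  { intros eps Heps. destruct (nfloor_ex (/ eps)) as [N [_ HN]]; [apply Rinv_nonneg, Heps|].
    exists N. intros n Hn. rewrite <- (Rinv_inv eps). apply Rinv_lt_contravar.
    - apply Rmult_lt_0_compat; [apply Rinv_0_lt_compat, Heps|apply Hn1].
    - apply le_INR in Hn. lra. }
  destruct (cauchy_sequence_limit (E := C_CompleteNormedModule) c) as [mu Hmu].
  { intros eps Heps. destruct (Hinv (eps * norm e / 2)) as [N HN].
    { apply Rdiv_lt_0_compat; [apply Rmult_lt_0_compat; assumption|lra]. }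
    exists N. intros n m Hn Hm. change (Cmod (c n - c m) < eps).
    apply Rmult_lt_reg_r with (norm e); [exact He0|]. rewrite <- enorm_scal.
    norm_replace (minus (cscal (c n) e) (cscal (c m) e)); [vec|].
    pose proof (enorm_minus_triangle (cscal (c n) e) x (cscal (c m) e)) as T.
    rewrite (enorm_minus_sym (cscal (c n) e) x) in T.
    pose proof (Hc n); pose proof (Hc m); pose proof (HN n Hn); pose proof (HN m Hm).
    eapply Rle_lt_trans; [exact T|]. lra. }
  exists mu. apply enorm_minus_eq_zero, Rle_antisym; [|apply norm_ge_0].
  apply Rnot_lt_le; intros Hp. set (d := norm (minus x (cscal mu e))) in *.
  destruct (Hinv (d / 2) ltac:(lra)) as [N1 HN1].
  destruct (Hmu (d / (2 * norm e))) as [N2 HN2]; [apply Rdiv_lt_0_compat; lra|].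
  specialize (HN1 (max N1 N2) (Nat.le_max_l _ _)). specialize (HN2 (max N1 N2) (Nat.le_max_r _ _)).
  set (n := max N1 N2) in *.
  assert (H2 : Cmod (c n - mu) < d / (2 * norm e)) by exact HN2.
  assert (H3 : norm (minus (cscal (c n) e : E) (cscal mu e)) < d / 2).
  { norm_replace (cscal (c n - mu)%C e); [vec|]. eapply Rle_lt_trans; [apply enorm_scal_le|].
    apply (Rmult_lt_compat_r (norm e)) in H2; [|exact He0].
    replace (d / (2 * norm e) * norm e) with (d / 2) in H2 by (field; lra). exact H2. }
  pose proof (enorm_minus_triangle x (cscal (c n) e) (cscal mu e)) as T.
  fold d in T. pose proof (Hc n). lra.
Qed.

(** An identity theorem for the line: the Taylor coefficients at c are limits of combinations of
    values near c, so they lie in the closed line, and so do the limits of the Taylor sums. *)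
Lemma in_line_taylor (e : E) (f : C -> E) (c : C) (rho R : R) : norm e <> 0 -> 0 < rho ->
  (forall z, Cmod (z - c) < R -> cderivable f z) ->
  (forall z, Cmod (z - c) < rho -> in_line e (f z)) ->
  forall z, Cmod (z - c) < R -> in_line e (f z).
Proof.
  intros He Hrho Hf Hl z0 Hz0.
  pose proof (Cmod_ge_0 (z0 - c)) as Hz00.
  set (r := (Cmod (z0 - c) + R) / 2).
  assert (Hr : Cmod (z0 - c) < r < R) by (unfold r; lra).
  assert (Hholo : holomorphic_on (Defs.disc R) (fun h => f (c + h)%C)).
  { intros h Hh. apply (holo_comp f (fun h => c + h)%C).
    - apply cderivable_Cplus; [apply cderivable1_cst|apply cderivable_id].
    - apply Hf. replace (c + h - c)%C with h by ring. exact Hh. }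
  destruct (circle_bound _ R r ltac:(lra) Hholo) as [M [HM0 HM]].
  destruct (cauchy_taylor _ R r M ltac:(lra) Hholo HM) as [a Ha].
  fold (psum a) in Ha.
  assert (Ha' : forall N h, Cmod h < r -> norm (minus (f (c + h)%C) (psum a h N)) <=
      M * (Cmod h / r) ^ S N * (r / (r - Cmod h)))
    by exact Ha.
  (* This difference is the sum of the terms of index below N; the form covers N = 0, where it is
     the empty sum. *)
  assert (Hpre : forall N h, (forall k, (k < N)%nat -> in_line e (a k)) ->
     in_line e (minus (psum a h N) (cscal (h ^ N)%C (a N)))).
  { assert (Hps : forall N h, (forall k, (k <= N)%nat -> in_line e (a k)) ->
      in_line e (psum a h N)).
    { induction N as [|N IH]; intros h Hk.
      - rewrite psum_0. apply Hk; lia.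
      - rewrite psum_S. apply in_line_plus; [apply IH; intros; apply Hk; lia|].
        apply in_line_scal, Hk; lia. }
    intros [|N] h Hk.
    - rewrite psum_0. exists (RtoC 0).
      transitivity (zero : E); [|vec]. vec_coefs; simpl; ring.
    - assert (Heq : psum a h N = minus (psum a h (S N)) (cscal (h ^ S N)%C (a (S N))))
        by (rewrite psum_S; vec).
      rewrite <- Heq. apply Hps; intros; apply Hk; lia. }
  assert (Hcoef : forall N k, (k < N)%nat -> in_line e (a k)).
  { induction N as [|N IH]; intros k Hk; [lia|].
    destruct (Nat.eq_dec k N) as [->|Hne]; [|apply IH; lia].
    apply in_line_closed; [exact He|]. intros eps Heps.
    set (Q := 2 * M / r ^ S N).
    assert (HQ : 0 <= Q) by (apply Rmult_le_pos; [lra|apply Rinv_nonneg, pow_lt; lra]).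
    set (t := Rmin (Rmin (rho / 2) (r / 2)) (eps / (2 * (Q + 1)))).
    assert (Ht : 0 < t) by (apply Rmin_pos; [apply Rmin_pos; lra|apply Rdiv_lt_0_compat; lra]).
    assert (Ht1 : t <= rho / 2) by (eapply Rle_trans; [apply Rmin_l|apply Rmin_l]).
    assert (Ht2 : t <= r / 2) by (eapply Rle_trans; [apply Rmin_l|apply Rmin_r]).
    assert (Ht3 : t <= eps / (2 * (Q + 1))) by apply Rmin_r.
    clearbody t.
    assert (Htm : Cmod (RtoC t) = t) by (apply Cmod_RtoC_pos; lra).
    assert (Htn : RtoC t <> RtoC 0) by (intros H0; apply RtoC_inj in H0; lra).
    assert (Htp : 0 < t ^ N) by (apply pow_lt, Ht).
    assert (Htpn : (RtoC t ^ N)%C <> RtoC 0) by (apply Cpow_nz, Htn).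
    (* The values of f minus the terms below N, divided by t^N, tend to a_N; t was chosen so that
       the error t Q is below eps. *)
    exists (cscal (/ (RtoC t ^ N))%C (minus (f (c + RtoC t)%C)
       (minus (psum a (RtoC t) N) (cscal (RtoC t ^ N)%C (a N))))).
    split.
    - apply in_line_scal, in_line_minus; [|apply Hpre, IH].
      apply Hl. replace (c + RtoC t - c)%C with (RtoC t) by ring. rewrite Htm; lra.
    - norm_replace (cscal (- / (RtoC t ^ N))%C (minus (f (c + RtoC t)%C) (psum a (RtoC t) N))).
      { vec_coefs; field; exact Htpn. }
      eapply Rle_lt_trans; [apply enorm_scal_le|].
      rewrite Cmod_opp, Cmod_inv, Cmod_pow, Htm by exact Htpn.
      specialize (Ha' N (RtoC t) ltac:(rewrite Htm; lra)). rewrite Htm in Ha'.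
      apply Rle_lt_trans with (/ t ^ N * (M * (t / r) ^ S N * 2)).
      + apply Rmult_le_compat_l; [apply Rinv_nonneg, Htp|].
        eapply Rle_trans; [exact Ha'|]. apply Rmult_le_compat_l.
        * apply Rmult_le_pos; [exact HM0|apply pow_le, Rmult_le_pos; [lra|apply Rinv_nonneg; lra]].
        * apply Rmult_le_reg_r with (r - t); [lra|]. unfold Rdiv. rewrite Rmult_assoc, Rinv_l; lra.
      + replace (/ t ^ N * (M * (t / r) ^ S N * 2)) with (t * Q).
        2:{ unfold Q, Rdiv. rewrite Rpow_mult_distr, pow_inv. simpl.
            assert (0 < r ^ N) by (apply pow_lt; lra). field. repeat split; lra. }
        apply Rle_lt_trans with (eps / (2 * (Q + 1)) * (Q + 1)).
        * apply Rmult_le_compat; lra.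
        * replace (eps / (2 * (Q + 1)) * (Q + 1)) with (eps / 2) by (field; lra). lra. }
  apply in_line_closed; [exact He|]. intros eps Heps.
  set (y := Cmod (z0 - c) / r).
  assert (Hy : 0 <= y < 1).
  { unfold y; split; [apply Rmult_le_pos; [exact Hz00|apply Rinv_nonneg; lra]|].
    apply Rmult_lt_reg_r with r; [lra|]. unfold Rdiv. rewrite Rmult_assoc, Rinv_l; lra. }
  set (Q := M * (r / (r - Cmod (z0 - c)))).
  assert (HQ : 0 <= Q).
  { apply Rmult_le_pos; [exact HM0|]. apply Rmult_le_pos; [lra|apply Rinv_nonneg; lra]. }
  destruct (pow_lt_1_zero y ltac:(rewrite Rabs_pos_eq; lra) (eps / (Q + 1))) as [N HN];
    [apply Rdiv_lt_0_compat; lra|].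
  specialize (HN (S N) ltac:(lia)). rewrite Rabs_pos_eq in HN by (apply pow_le; lra).
  exists (psum a (z0 - c)%C N). split.
  - assert (Heq : minus (psum a (z0 - c)%C (S N)) (cscal ((z0 - c) ^ S N)%C (a (S N)))
                  = psum a (z0 - c)%C N) by (rewrite psum_S; vec).
    rewrite <- Heq. apply Hpre. intros k Hk. apply (Hcoef (S k)). lia.
  - specialize (Ha' N (z0 - c)%C ltac:(lra)). replace (c + (z0 - c))%C with z0 in Ha' by ring.
    eapply Rle_lt_trans; [exact Ha'|]. fold y.
    replace (M * y ^ S N * (r / (r - Cmod (z0 - c)))) with (Q * y ^ S N) by (unfold Q; ring).
    apply Rle_lt_trans with ((Q + 1) * y ^ S N).
    + apply Rmult_le_compat_r; [apply pow_le; lra|lra].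
    + apply Rmult_lt_reg_l with (/ (Q + 1)); [apply Rinv_0_lt_compat; lra|].
      rewrite <- Rmult_assoc, Rinv_l, Rmult_1_l, Rmult_comm by lra. exact HN.
Qed.

Lemma sector_scale d delta z t : 0 < t -> sector d delta z -> sector d delta (RtoC t * z)%C.
Proof.
  intros Ht [r [phi [Hr [Hp ->]]]]. exists (t * r), phi.
  split; [apply Rmult_lt_0_compat; assumption|]. split; [exact Hp|].
  apply injective_projections; simpl; ring.
Qed.

(* Analytic continuation along rays by a geometric chain of discs. *)
Lemma in_line_sector (e : E) (f : C -> E) d delta rho : norm e <> 0 -> 0 < delta -> 0 < rho ->
  holomorphic_on (fun z => sector d delta z \/ Defs.disc rho z) f ->
  (forall z, Cmod z < rho -> in_line e (f z)) ->
  forall z, sector d (delta / 2) z -> in_line e (f z).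
Proof.
  intros He Hd Hrho Hf Hl.
  destruct (sector_thick d (delta / 2) delta ltac:(lra) ltac:(lra)) as [kap [Hkap Hthick]].
  (* From z1 = z / bet, the point z is at distance kap/2 |z1|, and a point within kap/4 |z| of z
     adds less than kap/2 |z1|, so it stays in the disc of radius kap |z1| on which f is
     holomorphic. *)
  set (bet := 1 + kap / 2). assert (Hbet : 1 < bet < 2) by (unfold bet; lra).
  (* Induction on the number of discs. The claim concerns a whole disc around z, as the next disc
     needs a neighbourhood of its centre where f is known to lie in the line. *)
  assert (P : forall n z, sector d (delta / 2) z -> Cmod z < rho / 2 * bet ^ n ->
     forall z', Cmod (z' - z) < kap / 4 * Cmod z -> in_line e (f z')).
  { induction n as [|n IH]; intros z Hz Hzn z' Hz'; pose proof (Cmod_ge_0 z) as Hz0.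
    - simpl in Hzn. apply Hl.
      pose proof (Cmod_le_minus z' z) as T. nra.
    - set (z1 := (RtoC (/ bet) * z)%C).
      assert (Hb0 : 0 < / bet) by (apply Rinv_0_lt_compat; lra).
      assert (Hz1 : sector d (delta / 2) z1) by (apply sector_scale; assumption).
      assert (Hm1 : Cmod z1 = / bet * Cmod z).
      { unfold z1. rewrite Cmod_mult, Cmod_R, Rabs_pos_eq; [reflexivity|lra]. }
      pose proof (proj1 (Cmod_gt_0 z1) (sector_neq_0 _ _ _ Hz1)) as Hz1p.
      assert (Hmz : Cmod z = bet * Cmod z1) by (rewrite Hm1; field; lra).
      assert (Hz1n : Cmod z1 < rho / 2 * bet ^ n).
      { apply Rmult_lt_reg_l with bet; [lra|]. rewrite <- Hmz. simpl in Hzn. lra. }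
      apply (in_line_taylor e f z1 (kap / 4 * Cmod z1) (kap * Cmod z1)).
      + exact He.
      + apply Rmult_lt_0_compat; lra.
      + intros y Hy. apply Hf. left. apply (Hthick z1); assumption.
      + intros y Hy. apply (IH z1); assumption.
      + assert (Hzz1 : Cmod (z - z1) = kap / 2 * Cmod z1).
        { replace (z - z1)%C with (RtoC (bet - 1) * z1)%C.
          - rewrite Cmod_mult, Cmod_R, Rabs_pos_eq by lra. f_equal. unfold bet; ring.
          - unfold z1. rewrite RtoC_minus, RtoC_inv by lra. field.
            intros H0; apply RtoC_inj in H0; lra. }
        pose proof (Cmod_triangle (z' - z) (z - z1)) as T.
        replace (z' - z + (z - z1))%C with (z' - z1)%C in T by ring.
        rewrite Hmz in Hz'. rewrite Hzz1 in T.
        assert (kap / 4 * (bet * Cmod z1) <= kap / 4 * (2 * Cmod z1)).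
        { apply Rmult_le_compat_l; [lra|]. apply Rmult_le_compat_r; lra. }
        lra. }
  intros z Hz. pose proof (proj1 (Cmod_gt_0 z) (sector_neq_0 _ _ _ Hz)) as Hzp.
  assert (Hib : 0 < / bet < 1).
  { split; [apply Rinv_0_lt_compat; lra|]. rewrite <- Rinv_1. apply Rinv_lt_contravar; lra. }
  destruct (pow_lt_1_zero (/ bet) ltac:(rewrite Rabs_pos_eq; lra) (rho / 2 / Cmod z)) as [n Hn];
    [apply Rdiv_lt_0_compat; lra|].
  specialize (Hn n (le_n n)). rewrite Rabs_pos_eq in Hn by (apply pow_le; lra).
  apply (P n z Hz).
  - rewrite pow_inv in Hn. assert (Hbn : 0 < bet ^ n) by (apply pow_lt; lra).
    apply (Rmult_lt_compat_r (bet ^ n * Cmod z)) in Hn; [|apply Rmult_lt_0_compat; assumption].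
    replace (/ bet ^ n * (bet ^ n * Cmod z)) with (Cmod z) in Hn by (field; lra).
    replace (rho / 2 / Cmod z * (bet ^ n * Cmod z)) with (rho / 2 * bet ^ n) in Hn by (field; lra).
    exact Hn.
  - replace (z - z)%C with (RtoC 0) by ring. rewrite Cmod_0. apply Rmult_lt_0_compat; lra.
Qed.

(** The derivative of f is a limit of multiples of e, hence a multiple mu e, and the norm of e
    divides out of the estimate. *)
Lemma derivative_in_line (e : E) (f : C -> E) (G : C -> C) z r : norm e <> 0 -> 0 < r ->
  cderivable f z -> (forall y, Cmod (y - z) < r -> f y = cscal (G y) e) ->
  cderivable1 G z.
Proof.
  intros He Hr [D HD] HG. pose proof (norm_pos e He) as He0.
  assert (HDe := proj1 (is_derive_eps (V := E) f z D) HD).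
  assert (Hz : f z = cscal (G z) e).
  { apply HG. replace (z - z)%C with (RtoC 0) by ring. rewrite Cmod_0; exact Hr. }
  assert (HDl : in_line e D).
  { apply in_line_closed; [exact He|]. intros eps Heps.
    destruct (HDe (eps / 2) ltac:(lra)) as [del [Hdel H]].
    set (t := Rmin (del / 2) (r / 2)).
    assert (Ht : 0 < t) by (apply Rmin_pos; lra).
    assert (Ht1 : t <= del / 2) by apply Rmin_l. assert (Ht2 : t <= r / 2) by apply Rmin_r.
    clearbody t.
    assert (Htm : Cmod (RtoC t) = t) by (apply Cmod_RtoC_pos; lra).
    assert (Htn : RtoC t <> RtoC 0) by (intros H0; apply RtoC_inj in H0; lra).
    specialize (H (RtoC t) ltac:(rewrite Htm; lra)). rewrite Htm in H.
    exists (cscal (/ RtoC t)%C (minus (f (z + RtoC t)%C) (f z))). split.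
    - apply in_line_scal, in_line_minus; [|exists (G z); exact Hz].
      exists (G (z + RtoC t)%C). apply HG. replace (z + RtoC t - z)%C with (RtoC t) by
          ring. rewrite Htm; lra.
    - norm_replace (cscal (- / RtoC t)%C
         (minus (minus (f (z + RtoC t)%C) (f z)) (cscal (RtoC t) D))).
      { vec_coefs; field; exact Htn. }
      eapply Rle_lt_trans; [apply enorm_scal_le|]. rewrite Cmod_opp, Cmod_inv, Htm by exact Htn.
      apply Rle_lt_trans with (/ t * (eps / 2 * t)).
      + apply Rmult_le_compat_l; [apply Rinv_nonneg, Ht|exact H].
      + replace (/ t * (eps / 2 * t)) with (eps / 2) by (field; lra). lra. }
  destruct HDl as [mu ->]. exists mu. apply (is_derive_eps (V := CN)). intros eps Heps.
  destruct (HDe (eps * norm e)) as [del [Hdel H]]; [apply Rmult_lt_0_compat; assumption|].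
  exists (Rmin del r). split; [apply Rmin_pos; assumption|]. intros h Hh.
  pose proof (Rlt_le_trans _ _ _ Hh (Rmin_l _ _)) as Hh1.
  pose proof (Rlt_le_trans _ _ _ Hh (Rmin_r _ _)) as Hh2.
  specialize (H h Hh1). change (Cmod (G (z + h) - G z - h * mu)%C <= eps * Cmod h).
  apply Rmult_le_reg_r with (norm e); [exact He0|]. rewrite <- enorm_scal.
  norm_replace (minus (minus (f (z + h)%C) (f z)) (cscal h (cscal mu e))).
  { rewrite Hz, (HG (z + h)%C); [vec|]. replace (z + h - z)%C with h by ring. exact Hh2. }
  eapply Rle_trans; [exact H|]. right; ring.
Qed.

(** The opening is halved once for the chain of discs and once more to have a neighbourhood of each
    point on which f is a multiple of e, as differentiating [G] requires. *)
Lemma scalar_extension (e : E) (a : nat -> C) (f : C -> E) d delta : norm e <> 0 -> 0 < delta ->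
  extends_on (fun n => cscal (a n) e) (sector d delta) f ->
  exists G rho, scalar_sum (E := E) a G rho /\
    (forall z, Cmod z < rho -> f z = cscal (G z) e) /\
    forall z, sector d (delta / 4) z ->
      cderivable1 G z /\ f z = cscal (G z) e.
Proof.
  intros He Hd [rho0 [Hrho0 [Hf Hser]]].
  pose proof (norm_pos e He) as He0.
  assert (Hdisc : forall z, Cmod z < rho0 -> in_line e (f z)).
  { intros z Hz. apply in_line_closed; [exact He|]. intros eps Heps.
    destruct (proj1 (is_pseries_eps _ z (f z)) (Hser z Hz) eps Heps) as [N HN].
    exists (psum (fun n => cscal (a n) e) z N). split.
    - rewrite psum_scal_vector. eexists; reflexivity.
    - rewrite enorm_minus_sym. apply HN; lia. }
  pose proof (in_line_sector e f d delta rho0 He Hd Hrho0 Hf Hdisc) as Hsec.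
  (* The coefficient of f z along e, unique because e is nonzero; where f z is not in the line, the
     value is arbitrary. *)
  set (G := fun z => epsilon (inhabits (RtoC 0)) (fun c : C => f z = cscal c e)).
  assert (HG : forall z, in_line e (f z) -> f z = cscal (G z) e).
  { intros z Hz. exact (epsilon_spec (inhabits (RtoC 0)) (fun c : C => f z = cscal c e) Hz). }
  (* Halving the radius leaves room for difference quotients and makes rho0 / 2 itself a point of
     convergence, which bounds the coefficients. *)
  exists G, (rho0 / 2). split; [|split].
  - split; [lra|]. split; [|split].
    + intros z Hz. apply (derivative_in_line e f G z (rho0 / 2) He ltac:(lra)).
      * apply Hf. right. unfold Defs.disc; lra.
      * intros y Hy. apply HG, Hdisc.
        pose proof (Cmod_le_minus y z) as T. lra.
    + assert (Hr : Cmod (RtoC (rho0 / 2)) = rho0 / 2) by (apply Cmod_RtoC_pos; lra).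
      destruct (pseries_coef_bound _ (RtoC (rho0 / 2)) _ (Hser (RtoC (rho0 / 2))
          ltac:(unfold Defs.disc; rewrite Hr; lra)))
        as [K [HK0 HK]].
      exists (K / norm e). split; [apply Rmult_le_pos; [exact HK0|apply Rinv_nonneg, He0]|].
      intros n. specialize (HK n). rewrite Hr in HK. cbv beta in HK. rewrite enorm_scal in HK.
      apply Rmult_le_reg_r with (norm e); [exact He0|].
      replace (K / norm e * norm e) with K by (field; lra). lra.
    + intros z v Hz. apply (pseries_change_vector a (G z) z e v He).
      rewrite <- HG by (apply Hdisc; lra). apply Hser. unfold Defs.disc; lra.
  - intros z Hz; apply HG, Hdisc; lra.
  - intros z Hz.
    destruct (sector_thick d (delta / 4) (delta / 2) ltac:(lra) ltac:(lra)) as [kap [Hkap Hthick]].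
    pose proof (proj1 (Cmod_gt_0 z) (sector_neq_0 _ _ _ Hz)) as Hzp.
    split.
    + apply (derivative_in_line e f G z (kap * Cmod z) He).
      * apply Rmult_lt_0_compat; lra.
      * apply Hf. left. apply (sector_mono d (delta / 4)); [lra|exact Hz].
      * intros y Hy. apply HG, Hsec, (Hthick z); assumption.
    + apply HG, Hsec, (sector_mono d (delta / 4)); [lra|exact Hz].
Qed.

End Line.

(** With r = exp x, |1 - r e^(iy)|^2 = 1 - 2 r cos y + r^2 >= (r - cos h)^2 + sin^2 h: a ray at
    angle at least h from the positive axis keeps the distance sin h from 1. *)
Lemma sin_le_Cmod_one_minus h x y : 0 < h < PI / 2 -> h <= Rabs y <= 2 * PI - h ->
  sin h <= Cmod (1 - cexp (x, y)).
Proof.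
  intros Hh Hy. pose proof PI_RGT_0 as HPI.
  assert (Hcos : cos y <= cos h).
  { assert (Hc : cos y = cos (Rabs y)) by (unfold Rabs; destruct (Rcase_abs y); [symmetry;
      apply cos_neg|reflexivity]).
    rewrite Hc. destruct (Rle_dec (Rabs y) PI) as [Hle|Hgt].
    - apply cos_decr_1; lra.
    - replace (cos (Rabs y)) with (cos (2 * PI - Rabs y)).
      + apply cos_decr_1; lra.
      + rewrite cos_minus, cos_2PI, sin_2PI. ring. }
  assert (Hs : 0 < sin h) by (apply sin_gt_0; lra).
  assert (Hch : 0 < cos h) by (apply cos_gt_0; lra).
  apply Rnot_lt_le; intros Hc.
  pose proof (Cmod_ge_0 (1 - cexp (x, y))) as H0.
  assert (Hsq : Cmod (1 - cexp (x, y)) ^ 2 < sin h ^ 2).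
  { simpl. rewrite !Rmult_1_r. apply Rmult_le_0_lt_compat; assumption. }
  rewrite Cmod2_alt in Hsq. simpl in Hsq.
  pose proof (exp_pos x) as Hx. set (r := exp x) in *.
  pose proof (sin2_cos2 y) as S1. pose proof (sin2_cos2 h) as S2. unfold Rsqr in *.
  assert (Hrc : r * cos y <= r * cos h) by (apply Rmult_le_compat_l; lra).
  pose proof (pow2_ge_0 (r - cos h)) as P. simpl in P. 
  assert (Hr2 : r * r * (sin y * sin y + cos y * cos y) = r * r) by (rewrite S1; ring).
  nra.
Qed.

(** * Comparison of q-exponential growth with growth of order k *)

Lemma exp_monotone x y : x <= y -> exp x <= exp y.
Proof. intros [H| ->]; [left; apply exp_increasing, H|lra]. Qed.

Lemma Rpower_nonneg x y : 0 <= Rpower x y.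
Proof. left; apply exp_pos. Qed.

Lemma ln_le_self x : 0 < x -> ln x <= x.
Proof.
  intros Hx. rewrite <- (exp_ln x) at 2 by exact Hx. left.
  pose proof (exp_ineq1_le (ln x)). lra.
Qed.

Lemma ln_le_Rpower k x : 0 < k -> 0 < x -> ln x <= Rpower x k / k.
Proof.
  intros Hk Hx. replace (ln x) with (ln (Rpower x k) / k).
  - apply Rmult_le_compat_r; [apply Rinv_nonneg, Hk|]. apply ln_le_self, exp_pos.
  - unfold Rpower. rewrite ln_exp. field; lra.
Qed.

Lemma Rpower_add_one k x : 0 < k -> 0 < x -> Rpower (x + 1) k <= Rpower 2 k * (1 + Rpower x k).
Proof.
  intros Hk Hx. pose proof (exp_pos (k * ln 2)) as H2. fold (Rpower 2 k) in H2.
  pose proof (Rpower_nonneg x k) as Hxk.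
  destruct (Rle_dec x 1) as [Hle|Hgt].
  - apply Rle_trans with (Rpower 2 k); [apply Rle_Rpower_l; lra|]. nra.
  - apply Rle_trans with (Rpower (2 * x) k); [apply Rle_Rpower_l; lra|].
    rewrite <- Rpower_mult_distr by lra. nra.
Qed.

(** Squaring ln x <= (2/k) x^(k/2) gives a multiple of x^k. The constant c absorbs the shift by h
    and the negative logarithms near 0. *)
Lemma log_square_growth K h alpha k : 0 < K -> 0 < h -> 0 < k ->
  exists A B, 0 < A /\ 0 < B /\ forall x, 0 < x ->
    exp (ln (x + h) ^ 2 / K) * Rpower (x + h) alpha <= A * exp (B * Rpower x k).
Proof.
  intros HK Hh Hk.
  set (m := Rmax 1 h). assert (Hm1 : 1 <= m) by apply Rmax_l. assert (Hmh : h <= m) by apply Rmax_r.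
  assert (Hlm : 0 <= ln (2 * m)) by (rewrite <- ln_1; apply ln_le; lra).
  set (c := Rabs (ln h) + ln (2 * m)).
  assert (Hc : 0 <= c) by (pose proof (Rabs_pos (ln h)); unfold c; lra).
  set (P := / K + Rabs alpha).
  assert (HP : 0 < P) by (pose proof (Rabs_pos alpha); pose proof (Rinv_0_lt_compat K HK);
      unfold P; lra).
  exists (exp (2 * P * c ^ 2 + Rabs alpha)), (8 * P / k ^ 2).
  split; [apply exp_pos|]. split; [apply Rdiv_lt_0_compat; [lra|apply pow_lt, Hk]|].
  intros x Hx. set (L := ln (x + h)). set (y := Rpower x (k / 2)).
  assert (Hy : 0 < y) by apply exp_pos.
  assert (Hy2 : y ^ 2 = Rpower x k).
  { unfold y. simpl. rewrite Rmult_1_r, <- Rpower_plus. f_equal. field. }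
  assert (HL : Rabs L <= c + 2 / k * y).
  { assert (Hky : 0 < 2 / k * y) by (apply Rmult_lt_0_compat; [apply Rdiv_lt_0_compat;
      lra|exact Hy]).
    apply Rabs_le; split.
    - assert (ln h <= L) by (apply ln_le; lra).
      pose proof (Rle_abs (- ln h)) as Ha. rewrite Rabs_Ropp in Ha. unfold c; lra.
    - pose proof (Rabs_pos (ln h)). destruct (Rle_dec x m) as [Hle|Hgt].
      + assert (L <= ln (2 * m)) by (apply ln_le; lra). unfold c; lra.
      + assert (L <= ln (2 * x)) by (apply ln_le; lra).
        rewrite ln_mult in * by lra.
        assert (ln 2 <= ln (2 * m)) by (apply ln_le; lra). rewrite ln_mult in * by lra.
        pose proof (ln_le_Rpower (k / 2) x ltac:(lra) Hx) as Hl. fold y in Hl.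
        replace (y / (k / 2)) with (2 / k * y) in Hl by (field; lra). unfold c.
        rewrite ln_mult by lra. lra. }
  assert (HL2 : L ^ 2 <= 2 * c ^ 2 + 8 / k ^ 2 * Rpower x k).
  { rewrite <- Hy2. rewrite <- (pow2_abs L).
    apply Rle_trans with ((c + 2 / k * y) ^ 2).
    - apply pow_incr. split; [apply Rabs_pos|exact HL].
    - replace (8 / k ^ 2 * y ^ 2) with (2 * (2 / k * y) ^ 2) by (field; lra).
      pose proof (pow2_ge_0 (c - 2 / k * y)). nra. }
  unfold Rpower at 1. fold L. rewrite <- !exp_plus.
  apply exp_monotone.
  apply Rle_trans with (P * L ^ 2 + Rabs alpha).
  - unfold P. assert (HaL : alpha * L <= Rabs alpha * (L ^ 2 + 1)).
    { apply Rle_trans with (Rabs alpha * Rabs L); [rewrite <- Rabs_mult; apply Rle_abs|].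
      apply Rmult_le_compat_l; [apply Rabs_pos|]. rewrite <- (pow2_abs L).
      pose proof (pow2_ge_0 (Rabs L - 1)). pose proof (Rabs_pos L). nra. }
    unfold Rdiv. lra.
  - apply Rle_trans with (P * (2 * c ^ 2 + 8 / k ^ 2 * Rpower x k) + Rabs alpha).
    + apply Rplus_le_compat_r, Rmult_le_compat_l; [lra|exact HL2].
    + right. field; lra.
Qed.

(** * Extendability and the continued kernel *)

Section Extensions.
Context {E : CompleteNormedModule C_AbsRing}.

(** Summability read on the Borel transform, so that the Gamma factors disappear from the
    argument. *)
Definition exp_extendable (k d : R) (a : nat -> E) : Prop :=
  exists (delta : R) (f : C -> E), 0 < delta /\
    extends_on a (sector d delta) f /\ exp_growth k (sector d delta) f.

Lemma extends_on_convergent (a : nat -> E) U f : extends_on a U f -> convergent a.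
Proof.
  intros [rho [Hrho [_ H]]]. exists rho. split; [exact Hrho|].
  intros z Hz. exists (f z). apply H, Hz.
Qed.

(** The way out of the q-setting: everything the hypothesis returns is used through this weaker
    bound, valid for every order k. *)
Lemma q_exp_growth_exp_growth q s k U (f : C -> E) : 1 < q -> 0 < s -> 0 < k ->
  (forall z, U z -> z <> RtoC 0) -> q_exp_growth q s U f -> exp_growth k U f.
Proof.
  intros Hq Hs Hk HU [A [h [alpha [HA [Hh H]]]]].
  assert (Hlq : 0 < ln q) by (rewrite <- ln_1; apply ln_increasing; lra).
  assert (HK : 0 < 2 * s * ln q) by (apply Rmult_lt_0_compat; [lra|exact Hlq]).
  destruct (log_square_growth (2 * s * ln q) h alpha k HK Hh Hk) as [A' [B' [HA' [HB' H']]]].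
  exists (A * A'), B'. split; [apply Rmult_lt_0_compat; assumption|]. split; [exact HB'|].
  intros z Hz. eapply Rle_trans; [apply H, Hz|].
  rewrite !Rmult_assoc. apply Rmult_le_compat_l; [lra|].
  rewrite <- !Rmult_assoc. apply H'. apply Cmod_gt_0, HU, Hz.
Qed.

Lemma q_extendable_exp_extendable q s k d (a : nat -> E) : 1 < q -> 0 < s -> 0 < k ->
  q_extendable q s d a -> exp_extendable k d a.
Proof.
  intros Hq Hs Hk [_ [delta [f [Hd [Hext Hg]]]]].
  exists delta, f. split; [exact Hd|]. split; [exact Hext|].
  apply (q_exp_growth_exp_growth q s); try assumption. apply sector_neq_0.
Qed.

(** The way into the q-setting: the hypothesis is only ever fed with bounded extensions. *)
Lemma bounded_q_extendable q s d delta (a : nat -> E) f M : 1 < q -> 0 < s -> 0 < delta ->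
  extends_on a (sector d delta) f -> (forall z, sector d delta z -> norm (f z) <= M) ->
  q_extendable q s d a.
Proof.
  intros Hq Hs Hd Hext HM. split; [exact (extends_on_convergent _ _ _ Hext)|].
  exists delta, f. split; [exact Hd|]. split; [exact Hext|].
  assert (Hlq : 0 < ln q) by (rewrite <- ln_1; apply ln_increasing; lra).
  (* With h = 1 and alpha = 0 the growth factor is at least 1 everywhere. *)
  exists (Rabs M + 1), 1, 0. pose proof (Rabs_pos M) as HM0. split; [lra|]. split; [lra|].
  intros z Hz. eapply Rle_trans; [apply HM, Hz|].
  assert (HR : Rpower (Cmod z + 1) 0 = 1).
  { apply Rpower_O. pose proof (Cmod_ge_0 z); lra. }
  rewrite HR, Rmult_1_r.
  assert (1 <= exp (ln (Cmod z + 1) ^ 2 / (2 * s * ln q))).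
  { rewrite <- exp_0. apply exp_monotone. apply Rmult_le_pos; [apply pow2_ge_0|].
    apply Rinv_nonneg. apply Rmult_lt_0_compat; [lra|exact Hlq]. }
  pose proof (Rle_abs M). nra.
Qed.

Lemma exp_extendable_plus k d (a b : nat -> E) : 0 < k ->
  exp_extendable k d a -> exp_extendable k d b ->
  exp_extendable k d (fun n => plus (a n) (b n)).
Proof.
  intros Hk [da [fa [Hda [[ra [Hra [Hfa Hsa]]] [A1 [B1 [HA1 [HB1 Ha]]]]]]]].
  intros [db [fb [Hdb [[rb [Hrb [Hfb Hsb]]] [A2 [B2 [HA2 [HB2 Hb]]]]]]]].
  set (del := Rmin da db).
  assert (Hda' : del <= da) by apply Rmin_l. assert (Hdb' : del <= db) by apply Rmin_r.
  assert (Hrl : Rmin ra rb <= ra) by apply Rmin_l. assert (Hrr : Rmin ra rb <= rb) by apply Rmin_r.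
  exists del, (fun z => plus (fa z) (fb z)).
  split; [apply Rmin_pos; assumption|]. split.
  - exists (Rmin ra rb). split; [apply Rmin_pos; assumption|]. split.
    + intros z Hz. apply holo_plus; [apply Hfa|apply Hfb]; unfold Defs.disc in *;
        (destruct Hz as [Hz|Hz]; [left; apply (sector_mono d del); assumption|right; lra]).
    + intros z Hz. unfold Defs.disc in *.
      apply is_cpseries_plus; [apply Hsa|apply Hsb]; unfold Defs.disc; lra.
  - exists (A1 + A2), (B1 + B2). split; [lra|]. split; [lra|]. intros z Hz.
    specialize (Ha z (sector_mono d del da z Hda' Hz)). specialize (Hb z (sector_mono d del db z
        Hdb' Hz)).
    pose proof (enorm_plus_le (fa z) (fb z)) as T.
    pose proof (Rpower_nonneg (Cmod z) k) as HX. set (X := Rpower (Cmod z) k) in *.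
    assert (E1 : exp (B1 * X) <= exp ((B1 + B2) * X)) by (apply exp_monotone; nra).
    assert (E2 : exp (B2 * X) <= exp ((B1 + B2) * X)) by (apply exp_monotone; nra).
    eapply Rle_trans; [exact T|]. nra.
Qed.

Lemma geometric_scalar_sum : scalar_sum (E := E) (fun _ => RtoC 1) (fun z => / (1 - z))%C 1.
Proof.
  split; [lra|]. split; [|split].
  - intros z Hz. apply (cderivable_Cinv (fun z => 1 - z)%C).
    + apply cderivable_Cminus; [apply cderivable1_cst|apply cderivable_id].
    + intros H0. assert (Hz1 : z = RtoC 1) by (symmetry; apply Cminus_0_eq, H0).
      rewrite Hz1, Cmod_1 in Hz. lra.
  - exists 1. split; [lra|]. intros n. rewrite Cmod_1, pow1. lra.
  - intros z v Hz. apply geometric_pseries, Hz.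
Qed.

(** In the sector of opening eta around +-eta the argument has modulus between eta/2 and 3 eta/2,
    hence 1 - z stays away from 0. *)
Lemma geometric_q_extendable (e : E) q s phi eta : 1 < q -> 0 < s -> 0 < eta <= 1 ->
  Rabs phi = eta -> q_extendable q s phi (fun _ => cscal (RtoC 1) e).
Proof.
  intros Hq Hs Heta Hphi. pose proof PI_RGT_0 as HPI. pose proof PI2_1 as HPI2.
  set (f := fun z : C => cscal (/ (1 - z))%C e : E).
  assert (Hb : forall z, sector phi eta z -> sin (eta / 2) <= Cmod (1 - z)).
  { intros z Hz. destruct (sector_polar phi eta z Hz) as [x [y [-> Hy]]].
    apply sin_le_Cmod_one_minus; [lra|].
    pose proof (Rabs_triang (y - phi) phi) as T1. replace (y - phi + phi) with y in T1 by ring.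
    pose proof (Rabs_triang (phi - y) y) as T2. replace (phi - y + y) with phi in T2 by ring.
    rewrite Rabs_minus_sym in T2. rewrite Hphi in *. lra. }
  assert (Hsin : 0 < sin (eta / 2)) by (apply sin_gt_0; lra).
  apply (bounded_q_extendable q s phi eta _ f (/ sin (eta / 2) * norm e)); try assumption; [lra| |].
  - exists 1. split; [lra|]. split.
    + intros z Hz. apply (holo_scal (fun z => / (1 - z))%C); [|apply holo_cst].
      apply (cderivable_Cinv (fun z => 1 - z)%C).
      * apply cderivable_Cminus; [apply cderivable1_cst|apply cderivable_id].
      * destruct Hz as [Hz|Hz]; [apply Cmod_gt_0; specialize (Hb z Hz); lra|].
        intros H0. assert (Hz1 : z = RtoC 1) by (symmetry; apply Cminus_0_eq, H0).
        unfold Defs.disc in Hz. rewrite Hz1, Cmod_1 in Hz. lra.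
    + intros z Hz. apply geometric_pseries, Hz.
  - intros z Hz. specialize (Hb z Hz). unfold f. eapply Rle_trans; [apply enorm_scal_le|].
    apply Rmult_le_compat_r; [apply norm_ge_0|]. rewrite Cmod_inv by (apply Cmod_gt_0; lra).
    apply Rinv_le_contravar; lra.
Qed.

Lemma scalar_sum_shrink (a : nat -> C) G rho rho' : 0 < rho' <= rho ->
  scalar_sum (E := E) a G rho -> scalar_sum (E := E) a G rho'.
Proof.
  intros Hr [_ [HG [[K [HK0 HK]] Hs]]]. split; [lra|]. split; [|split].
  - intros z Hz; apply HG; lra.
  - exists K. split; [exact HK0|]. intros n. eapply Rle_trans; [|apply HK].
    apply Rmult_le_compat_l; [apply Cmod_ge_0|]. apply pow_incr; lra.
  - intros z v Hz; apply Hs; lra.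
Qed.

(** [M] bounds the kernel on the disc of its power series, [A] and [B] its growth on the sector. It
    is used for phi = eta and phi = -eta, with two functions linked only by their common series. *)
Definition continued_kernel k (l : nat -> R) phi (G : C -> C) rho delta M A B : Prop :=
  0 < delta /\ 0 <= M /\ 0 < A /\ 0 < B /\
  scalar_sum (E := E) (fun n => RtoC (l n)) G rho /\
  (forall z, Cmod z < rho -> Cmod (G z) <= M) /\
  (forall z, sector phi delta z ->
     cderivable1 G z /\ Cmod (G z) <= A * exp (B * Rpower (Cmod z) k)).

Lemma kernel_extension (e : E) q s k (l : nat -> R) phi eta : norm e <> 0 ->
  1 < q -> 0 < s -> 0 < k -> 0 < eta <= 1 -> Rabs phi = eta ->
  (forall d (b : nat -> E), q_extendable q s d b ->
     q_extendable q s d (fun n => cscal (RtoC (l n)) (b n))) ->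
  exists G rho delta M A B, continued_kernel k l phi G rho delta M A B.
Proof.
  intros He Hq Hs Hk Heta Hphi H.
  destruct (H phi _ (geometric_q_extendable e q s phi eta Hq Hs Heta Hphi))
    as [_ [delta [f [Hd [Hext Hg]]]]].
  apply (q_exp_growth_exp_growth q s k) in Hg; try assumption; [|apply sector_neq_0].
  destruct Hg as [A [B [HA [HB Hg]]]].
  assert (Hext' : extends_on (fun n => cscal (RtoC (l n)) e) (sector phi delta) f).
  { replace (fun n => cscal (RtoC (l n)) e)
      with (fun n => cscal (RtoC (l n)) (cscal (RtoC 1) e)); [exact Hext|].
    apply functional_extensionality; intros n. vec. }
  destruct (scalar_extension e (fun n => RtoC (l n)) f phi delta He Hd Hext')
    as [G [rho [HG [HGd HGs]]]].
  pose proof (norm_pos e He) as He0.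
  assert (Hrho : 0 < rho) by apply HG.
  assert (HGn : forall z, f z = cscal (G z) e -> Cmod (G z) = norm (f z) / norm e).
  { intros z Hz. rewrite Hz, enorm_scal. field; lra. }
  destruct (continuous_locally_bounded f 0) as [r [Hr Hb]].
  { apply holo_continuous. destruct Hext' as [r [Hr [Hf _]]]. apply Hf. right.
    unfold Defs.disc. rewrite Cmod_0; exact Hr. }
  (* The radius r is one on which f is bounded by continuity at 0; division by the norm of e turns
     bounds on f into bounds on [G]. *)
  exists G, (Rmin rho r), (delta / 4), ((norm (f 0) + 1) / norm e), (A / norm e), B.
  assert (Hmin1 : Rmin rho r <= rho) by apply Rmin_l. assert (Hmin2 : Rmin rho r <= r) by
      apply Rmin_r.
  pose proof (norm_ge_0 (f 0)) as Hf0.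
  split; [lra|]. split; [apply Rmult_le_pos; [lra|apply Rinv_nonneg, He0]|].
  split; [apply Rdiv_lt_0_compat; assumption|]. split; [exact HB|].
  split; [apply (scalar_sum_shrink _ _ rho); [split; [apply Rmin_pos;
      assumption|exact Hmin1]|exact HG]|].
  split.
  - intros z Hz. rewrite HGn by (apply HGd; lra).
    apply Rmult_le_compat_r; [apply Rinv_nonneg, He0|].
    apply Hb. replace (z - 0)%C with z by ring. lra.
  - intros z Hz. destruct (HGs z Hz) as [H1 H2]. split; [exact H1|].
    rewrite HGn by exact H2. unfold Rdiv.
    rewrite (Rmult_comm A), Rmult_assoc, (Rmult_comm (/ norm e)).
    apply Rmult_le_compat_r; [apply Rinv_nonneg, He0|].
    apply Hg. apply (sector_mono phi (delta / 4)); [lra|exact Hz].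
Qed.

(** A single statement for arcs and rays: the path is merely continuous and avoids 0. *)
Lemma path_kernel_holomorphic (G : C -> C) (gam : R -> C) (phi : R -> E) al be t0 R M :
  al <= be -> 0 < R ->
  (forall s, al <= s <= be -> continuous (T := R_UniformSpace) (U := CU) gam s /\ gam s <> RtoC 0)
      ->
  (forall s, al <= s <= be -> continuous phi s) ->
  (forall t s, Cmod (t - t0) < R -> al <= s <= be ->
     cderivable1 G (t / gam s)%C /\ Cmod (G (t / gam s)%C) <= M) ->
  cderivable (fun t => int (fun s => cscal (G (t / gam s)%C) (phi s)) al be) t0.
Proof.
  intros Hab HR Hgam Hphi HG.
  destruct (continuous_bounded phi al be Hab Hphi) as [M' [HM'0 HM']].
  apply (holomorphic_parametric_integral
    (fun t s => cscal (G (t / gam s)%C) (phi s)) t0 R (M * M')); [exact Hab|exact HR| | |].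
  - intros t s Ht Hs. apply (holo_scal (fun t => G (t / gam s)%C)); [|apply holo_cst].
    apply (cderivable_comp (V := CN) G (fun t => t / gam s)%C); [|apply HG; assumption].
    apply cderivable_Cmult; [apply cderivable_id|apply cderivable1_cst].
  - intros t s Ht Hs. eapply Rle_trans; [apply enorm_scal_le|].
    destruct (HG t s Ht Hs) as [_ H1].
    apply Rmult_le_compat; [apply Cmod_ge_0|apply norm_ge_0|exact H1|apply HM', Hs].
  - intros t Ht. apply ex_int_continuous; [exact Hab|]. intros s Hs.
    apply (continuous_scal (U := R_UniformSpace) (K := C_AbsRing) (V := E)
        (fun s => G (t / gam s)%C)); [|apply Hphi, Hs].
    apply (continuous_comp (U := R_UniformSpace) (V := CU) (W := CU) gam (fun w => G (t / w)%C));
        [apply Hgam, Hs|].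
    apply cderivable1_continuous, (cderivable_comp (V := CN) G (fun w => t / w)%C).
    + apply cderivable_Cmult; [apply cderivable1_cst|apply cderivable_inv, Hgam, Hs].
    + apply HG; assumption.
Qed.

End Extensions.

(** * Coefficients as circle integrals and the far arc *)

Section Hadamard.
Context {E : CompleteNormedModule C_AbsRing}.

Lemma geometric_integral_pseries (phi : R -> E) x al be t : al <= be ->
  (forall s, al <= s <= be -> continuous phi s) -> Cmod t < exp x ->
  is_cpseries (fun n => int (fun s => cscal ((/ cexp (x, s)) ^ n)%C (phi s)) al be) t
    (int (fun s => cscal (/ (1 - t / cexp (x, s)))%C (phi s)) al be).
Proof.
  intros Hab Hphi Ht.
  pose proof (integral_pseries (fun _ => RtoC 1) (fun z => / (1 - z))%C 1 phi x al be t
    geometric_scalar_sum Hab Hphi ltac:(lra)) as H.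
  match type of H with @is_pseries _ _ ?a _ _ => match goal with |- @is_pseries _ _ ?b _ _ =>
    replace b with a; [exact H|] end end.
  apply functional_extensionality; intros n. vec.
Qed.

(** The integrals are the coefficients of a series with sum v near 0, by Cauchy's formula and 1 / (1
    - z/w) = w / (w - z); power series with the same sum coincide. *)
Lemma cauchy_coefficients (b : nat -> E) (v : C -> E) R x a n :
  holomorphic_on (Defs.disc R) v -> (forall z, Cmod z < R -> is_cpseries b z (v z)) -> exp x < R ->
  b n = int (fun s => cscal ((/ cexp (x, s)) ^ n)%C
                (cscal (RtoC (/ (2 * PI))) (v (cexp (x, s))))) a (a + 2 * PI).
Proof.
  intros Hv Hb Hx. pose proof PI_RGT_0 as HPI. pose proof (exp_pos x) as Hxp.
  set (p := RtoC (/ (2 * PI))).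
  set (phi := fun s => cscal p (v (cexp (x, s))) : E).
  assert (Hw0 : forall s, cexp (x, s) <> RtoC 0) by (intros; apply cexp_neq_0).
  assert (Hw : forall s, Cmod (cexp (x, s)) = exp x) by (intros; apply Cmod_cexp).
  assert (Hvc : forall s, continuous (T := R_UniformSpace) (fun s => v (cexp (x, s))) s).
  { intros s. apply (continuous_along_vertical (fun z => v (cexp z))).
    apply continuous_cexp, holo_continuous, Hv. unfold Defs.disc. rewrite Hw. exact Hx. }
  assert (Hphi : forall s, a <= s <= a + 2 * PI -> continuous phi s).
  { intros s _. unfold phi.
    apply (continuous_scal (U := R_UniformSpace) (K := C_AbsRing) (V := E) (fun _ => p));
        [|apply Hvc].
    apply (continuous_const (U := R_UniformSpace) (V := CU)). }
  apply (pseries_unique b (fun n => int (fun s => cscal ((/ cexp (x, s)) ^ n)%C (phi s))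
      a (a + 2 * PI)) v (exp x)).
  - exact Hxp.
  - intros z Hz. apply Hb; lra.
  - intros z Hz.
    pose proof (geometric_integral_pseries phi x a (a + 2 * PI) z ltac:(lra) Hphi Hz) as H.
    replace (v z) with (int (fun s => cscal (/ (1 - z / cexp (x, s)))%C (phi s)) a (a + 2 * PI)).
    + exact H.
    + assert (Hn : forall s, (cexp (x, s) - z)%C <> RtoC 0).
      { intros s. apply (Cmod_kernel _ z (exp x)); [apply Hw|exact Hz]. }
      assert (Hpi : a <= a + 2 * PI) by lra.
      rewrite (int_ext _ (fun s => cscal p (cscal (cexp (x, s) / (cexp (x, s) - z))%C (v (cexp (x,
          s))))) _ _ Hpi).
      * rewrite int_scal.
        -- rewrite (cauchy_formula v R x z a Hv) by lra. unfold p. vec_coefs.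
           rewrite RtoC_inv by lra. field. intros Hc. apply (RtoC_inj _ 0) in Hc. lra.
        -- apply (ex_int_kernel (fun w => w / (w - z))%C (fun s => v (cexp (x, s))));
            [exact Hpi| |intros s _; apply Hvc].
           intros s _. apply cderivable_Cmult; [apply cderivable_id|].
           apply (cderivable_Cinv (fun w => w - z)%C); [|apply Hn].
           apply cderivable_Cminus; [apply cderivable_id|apply cderivable1_cst].
      * intros s _. unfold phi. specialize (Hn s). specialize (Hw0 s).
        assert (Hd : (1 - z / cexp (x, s))%C <> RtoC 0).
        { intros H0. apply Hn. transitivity (cexp (x, s) * (1 - z / cexp (x, s)))%C; [field;
            exact Hw0|].
          rewrite H0. ring. }
        vec_coefs. field. repeat split; assumption.
Qed.

(** If t has argument within eta/2 of d and w is on the far arc, then the argument of t/w lies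
    between -2 PI + eta/2 and -eta/2, so |1 - t/w| >= sin (eta/2) however large t is. *)
Lemma far_arc_q_extendable q s d eta x (phi : R -> E) : 1 < q -> 0 < s -> 0 < eta <= 1 ->
  (forall sg, d + eta <= sg <= d - eta + 2 * PI -> continuous phi sg) ->
  q_extendable q s d (fun n => int (fun sg => cscal ((/ cexp (x, sg)) ^ n)%C (phi sg))
                                   (d + eta) (d - eta + 2 * PI)).
Proof.
  intros Hq Hs Heta Hphi. pose proof PI_RGT_0 as HPI. pose proof PI2_1 as HPI2.
  set (al := d + eta) in *. set (be := d - eta + 2 * PI) in *.
  assert (Hab : al <= be) by (unfold al, be; lra).
  destruct (continuous_bounded phi al be Hab Hphi) as [M [HM0 HM]].
  pose proof (exp_pos x) as Hxp.
  set (G := fun z : C => (/ (1 - z))%C).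
  assert (HGd : forall z, (1 - z)%C <> RtoC 0 -> cderivable1 G z).
  { intros z Hz. apply (cderivable_Cinv (fun z => 1 - z)%C); [|exact Hz].
    apply cderivable_Cminus; [apply cderivable1_cst|apply cderivable_id]. }
  assert (HGb : forall z m, 0 < m -> m <= Cmod (1 - z) -> cderivable1 G z /\ Cmod (G z) <= / m).
  { intros z m Hm Hz. assert (Hn : (1 - z)%C <> RtoC 0) by (apply Cmod_gt_0; lra).
    split; [apply HGd, Hn|]. unfold G. rewrite Cmod_inv by exact Hn. apply Rinv_le_contravar; lra. }
  assert (Hsin : 0 < sin (eta / 2)) by (apply sin_gt_0; lra).
  assert (Hsec : forall t sg, sector d eta t -> al <= sg <= be ->
     cderivable1 G (t / cexp (x, sg))%C /\ Cmod (G (t / cexp (x, sg))%C) <= / sin (eta / 2)).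
  { intros t sg Ht Hsg. apply HGb; [exact Hsin|].
    destruct (sector_polar d eta t Ht) as [x' [y [-> Hy]]].
    rewrite <- cexp_minus. change ((x', y) - (x, sg))%C with ((x' - x, y - sg) : C).
    apply sin_le_Cmod_one_minus; [lra|].
    apply Rabs_lt_between in Hy. unfold al, be in Hsg. rewrite Rabs_left; lra. }
  set (gam := fun sg : R => cexp (x, sg)).
  assert (Hgam : forall sg, al <= sg <= be -> continuous (T := R_UniformSpace) (U := CU)
      gam sg /\ gam sg <> RtoC 0).
  { intros sg _. split; [|apply cexp_neq_0].
    apply (continuous_comp (U := R_UniformSpace) (V := CU) (W := CU) (fun s : R => (x, s) : C)
        cexp);
      [apply continuous_vertical|apply cderivable1_continuous, cderivable_cexp]. }
  set (f := fun t => int (fun sg => cscal (G (t / gam sg)%C) (phi sg)) al be).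
  (* The kernel bound holds for opening eta; the extension is claimed for eta/2 only, to have discs
     around each point. *)
  destruct (sector_thick d (eta / 2) eta ltac:(lra) ltac:(lra)) as [kap [Hkap Hthick]].
  apply (bounded_q_extendable q s d (eta / 2) _ f ((be - al) * (/ sin (eta / 2) * M)));
      try assumption; [lra| |].
  - exists (exp x). split; [exact Hxp|]. split.
    + intros t0 [Ht0|Ht0].
      * pose proof (proj1 (Cmod_gt_0 t0) (sector_neq_0 _ _ _ Ht0)) as Ht0p.
        apply (path_kernel_holomorphic G gam phi al be t0 (kap * Cmod t0) (/ sin (eta / 2)));
            try assumption.
        -- apply Rmult_lt_0_compat; lra.
        -- intros t sg Ht Hsg. apply Hsec; [|exact Hsg]. apply (Hthick t0); assumption.
      * unfold Defs.disc in Ht0. set (R := (exp x - Cmod t0) / 2).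
        pose proof (Cmod_ge_0 t0) as Ht00.
        (* Near a point of the disc it is |t/w| < 1, and not the argument, that keeps 1 - t/w away
           from 0. *)
        set (m := 1 - (Cmod t0 + R) / exp x).
        assert (Hm : 0 < m).
        { unfold m. enough ((Cmod t0 + R) / exp x < 1) by lra.
          apply Rmult_lt_reg_r with (exp x); [exact Hxp|]. unfold Rdiv. rewrite Rmult_assoc,
              Rinv_l by lra.
          unfold R; lra. }
        apply (path_kernel_holomorphic G gam phi al be t0 R (/ m)); try assumption; [unfold R;
            lra|].
        intros t sg Ht _. apply HGb; [exact Hm|].
        set (z := (t / gam sg)%C).
        assert (Hz : Cmod z <= (Cmod t0 + R) / exp x).
        { unfold z, gam. rewrite Cmod_div, Cmod_cexp by apply cexp_neq_0.
          apply Rmult_le_compat_r; [apply Rinv_nonneg, Hxp|].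
          pose proof (Cmod_le_minus t t0) as T. lra. }
        pose proof (Cmod_triangle (1 - z) z) as T. replace (1 - z + z)%C with (RtoC 1) in T by ring.
        rewrite Cmod_1 in T. unfold m. lra.
    + intros t Ht. unfold Defs.disc in Ht.
      exact (geometric_integral_pseries phi x al be t Hab Hphi Ht).
  - intros t Ht. assert (Ht' : sector d eta t) by (apply (sector_mono d (eta / 2)); [lra|exact Ht]).
    apply norm_int_le; [exact Hab| |].
    + apply (ex_int_kernel (fun w => G (t / w)%C)); [exact Hab| |exact Hphi].
      intros sg Hsg. apply (cderivable_comp (V := CN) G (fun w => t / w)%C); [|apply Hsec;
          assumption].
      apply cderivable_Cmult; [apply cderivable1_cst|apply cderivable_inv, cexp_neq_0].
    + intros sg Hsg. eapply Rle_trans; [apply enorm_scal_le|].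
      destruct (Hsec t sg Ht' Hsg) as [_ H1].
      apply Rmult_le_compat; [apply Cmod_ge_0|apply norm_ge_0|exact H1|apply HM, Hsg].
Qed.

End Hadamard.

(** * The near arc and its deformation *)

Section NearArc.
Context {E : CompleteNormedModule C_AbsRing}.

Definition integrand (G : C -> C) (V : C -> E) (t zeta : C) : E :=
  cscal (G (t / cexp zeta)%C) (V (cexp zeta)).

Lemma integrand_holomorphic G V t zeta :
  cderivable1 G (t / cexp zeta)%C -> cderivable V (cexp zeta) ->
  cderivable (integrand G V t) zeta.
Proof.
  intros HG HV. apply (holo_scal (fun zeta => G (t / cexp zeta)%C)).
  - apply (cderivable_comp (V := CN) G (fun zeta => t / cexp zeta)%C); [|exact HG].
    apply cderivable_Cmult; [apply cderivable1_cst|].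
    apply (cderivable_Cinv cexp); [apply cderivable_cexp|apply cexp_neq_0].
  - apply (holo_comp V cexp); [apply cderivable_cexp|exact HV].
Qed.

Definition arc_integral (G : C -> C) (V : C -> E) (y0 y1 X : R) (t : C) : E :=
  int (fun y => integrand G V t (X, y)) y0 y1.

Definition ray_integral (G : C -> C) (V : C -> E) (y x0 X : R) (t : C) : E :=
  int (fun x => integrand G V t (x, y)) x0 X.

(* The arc from [y0] to [y1] at radius [exp x0], pushed out to radius [exp X] at the expense of
   the two rays; [Ga] and [Gb] are the kernels continued along the lower and upper ray. *)
Definition deformed_arc (Ga Gb : C -> C) (V : C -> E) (x0 y0 y1 X : R) (t : C) : E :=
  plus (arc_integral Ga V y0 y1 X t)
       (cscal (- Ci)%C
          (minus (ray_integral Ga V y0 x0 X t) (ray_integral Gb V y1 x0 X t))).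

Lemma Cmod_div_cexp t zeta : Cmod (t / cexp zeta) = Cmod t * exp (- fst zeta).
Proof.
  rewrite Cmod_div, Cmod_cexp by apply cexp_neq_0. rewrite exp_Ropp. reflexivity.
Qed.

Lemma Cmod_div_cexp_lt t zeta rho : Cmod t < rho * exp (fst zeta) -> Cmod (t / cexp zeta) < rho.
Proof.
  intros H. pose proof (exp_pos (fst zeta)) as Hp.
  rewrite Cmod_div_cexp, exp_Ropp. apply Rmult_lt_reg_r with (exp (fst zeta)); [exact Hp|].
  rewrite Rmult_assoc, Rinv_l, Rmult_1_r by lra. exact H.
Qed.

(** Between the radii exp X1 and exp X2 the quotient t/w lies in the common disc, where [Gb] may be
    replaced by [Ga]. Goursat's theorem then applies to a single integrand, and solving for the arc
    at X1 produces the factor -i in front of the rays. *)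
Lemma deformed_arc_independent (Ga Gb : C -> C) (V : C -> E) rho x0 y0 y1 X1 X2 t :
  x0 <= X1 -> X1 <= X2 -> y0 <= y1 ->
  (forall x y, y0 <= y <= y1 -> cderivable V (cexp (x, y))) ->
  (forall z, Cmod z < rho -> cderivable1 Ga z) ->
  (forall z (u : E), Cmod z < rho -> cscal (Ga z) u = cscal (Gb z) u) ->
  0 < rho -> Cmod t < rho * exp X1 ->
  (forall x, x0 <= x -> cderivable1 Ga (t / cexp (x, y0))%C) ->
  (forall x, x0 <= x -> cderivable1 Gb (t / cexp (x, y1))%C) ->
  deformed_arc Ga Gb V x0 y0 y1 X1 t = deformed_arc Ga Gb V x0 y0 y1 X2 t.
Proof.
  intros Hx0 HX Hy HV HGa HGab Hrho Ht Hra Hrb.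
  assert (Hray : forall G y, y0 <= y <= y1 -> (forall x, x0 <= x -> cderivable1 G (t / cexp (x,
      y))%C) ->
    ray_integral G V y x0 X2 t = plus (ray_integral G V y x0 X1 t)
       (int (fun x => integrand G V t (x, y)) X1 X2)).
  { intros G y Hyy HG. symmetry. apply int_chasles; apply ex_int_continuous; try assumption;
      intros x Hx; apply continuous_along_horizontal, holo_continuous, integrand_holomorphic;
      first [apply HG; lra | apply HV; assumption]. }
  assert (Hin : forall x y, X1 <= x <= X2 -> Cmod (t / cexp (x, y)) < rho).
  { intros x y Hx. apply Cmod_div_cexp_lt. simpl. eapply Rlt_le_trans; [exact Ht|].
    apply Rmult_le_compat_l; [lra|]. apply exp_monotone; lra. }
  assert (Hb : int (fun x => integrand Gb V t (x, y1)) X1 X2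
             = int (fun x => integrand Ga V t (x, y1)) X1 X2).
  { apply int_ext; [exact HX|]. intros x Hx. symmetry. apply HGab, Hin, Hx. }
  assert (HG : rect (integrand Ga V t) X1 X2 y0 y1 = zero).
  { apply goursat; [exact HX|exact Hy|]. intros x y Hx Hyy.
    apply integrand_holomorphic; [apply HGa, Hin, Hx|apply HV, Hyy]. }
  unfold deformed_arc. rewrite (Hray Ga y0), (Hray Gb y1), Hb by (assumption || lra).
  unfold rect in HG.
  change (int (fun y => integrand Ga V t (X2, y)) y0 y1) with (arc_integral Ga V y0 y1 X2 t) in HG.
  change (int (fun y => integrand Ga V t (X1, y)) y0 y1) with (arc_integral Ga V y0 y1 X1 t) in HG.
  set (A1 := arc_integral Ga V y0 y1 X1 t) in *. set (A2 := arc_integral Ga V y0 y1 X2 t) in *.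
  set (I := int (fun x => integrand Ga V t (x, y0)) X1 X2) in *.
  set (J := int (fun x => integrand Ga V t (x, y1)) X1 X2) in *.
  set (P := ray_integral Ga V y0 x0 X1 t). set (Q := ray_integral Gb V y1 x0 X1 t).
  transitivity (minus (plus A2 (cscal (- Ci)%C (minus (plus P I) (plus Q J))))
     (cscal (- Ci)%C (plus (minus I J) (cscal Ci (minus A2 A1))))).
  - vec_coefs; apply injective_projections; simpl; ring.
  - rewrite HG. vec.
Qed.

Lemma near_arc_exp_extendable k d delta A B x0 eta (V : C -> E) (l : nat -> R)
    Ga rhoa da Ma Aa Ba Gb rhob db Mb Ab Bb :
  0 < k -> 0 < eta < delta / 2 -> 0 < A -> 0 < B ->
  (forall z, sector d delta z -> cderivable V z /\ norm (V z) <= A * exp (B * Rpower (Cmod z) k)) ->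
  continued_kernel (E := E) k l eta Ga rhoa da Ma Aa Ba ->
  continued_kernel (E := E) k l (- eta) Gb rhob db Mb Ab Bb ->
  exp_extendable k d (fun n => cscal (RtoC (l n))
     (int (fun s => cscal ((/ cexp (x0, s)) ^ n)%C (V (cexp (x0, s)))) (d - eta) (d + eta))).
Proof.
  intros Hk Heta HA HB HV [Hda [HMa [HAa [HBa [HGa [HGaM HGas]]]]]]
    [Hdb [HMb [HAb [HBb [HGb [HGbM HGbs]]]]]].
  set (rho := Rmin rhoa rhob).
  assert (Hra : rho <= rhoa) by apply Rmin_l. assert (Hrb : rho <= rhob) by apply Rmin_r.
  assert (Hrho : 0 < rho) by (apply Rmin_pos; [apply HGa|apply HGb]).
  set (del := Rmin da db).
  assert (Hdela : del <= da) by apply Rmin_l. assert (Hdelb : del <= db) by apply Rmin_r.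
  assert (Hdel : 0 < del) by (apply Rmin_pos; assumption).
  set (y0 := d - eta). set (y1 := d + eta). assert (Hy01 : y0 <= y1) by (unfold y0, y1; lra).
  set (eps := exp x0). assert (Heps : 0 < eps) by apply exp_pos.
  assert (HVs : forall x y, y0 <= y <= y1 -> sector d delta (cexp (x, y))).
  { intros x y Hy. apply sector_cexp. apply Rabs_lt_between. unfold y0, y1 in Hy. lra. }
  assert (HVd : forall x y, y0 <= y <= y1 -> cderivable V (cexp (x, y))) by (intros; apply HV, HVs;
      assumption).
  (* On the ray at angle d - eta, the argument of t/w differs from eta by as much as that of t
     differs from d. *)
  assert (Hseca : forall t x, sector d del t -> sector eta da (t / cexp (x, y0))%C).
  { intros t x Ht. destruct (sector_polar d del t Ht) as [x' [y [-> Hy]]]. rewrite <- cexp_minus.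
    change ((x', y) - (x, y0))%C with ((x' - x, y - y0) : C). apply sector_cexp. unfold y0.
    replace (y - (d - eta) - eta) with (y - d) by ring. lra. }
  assert (Hsecb : forall t x, sector d del t -> sector (- eta) db (t / cexp (x, y1))%C).
  { intros t x Ht. destruct (sector_polar d del t Ht) as [x' [y [-> Hy]]]. rewrite <- cexp_minus.
    change ((x', y) - (x, y1))%C with ((x' - x, y - y1) : C). apply sector_cexp. unfold y1.
    replace (y - (d + eta) - - eta) with (y - d) by ring. lra. }
  assert (Hdin : forall t x y X, X <= x -> Cmod t < rho * exp X -> Cmod (t / cexp (x, y)) < rho).
  { intros t x y X HX Ht. apply Cmod_div_cexp_lt. simpl. eapply Rlt_le_trans; [exact Ht|].
    apply Rmult_le_compat_l; [lra|]. apply exp_monotone; lra. }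
  (* The points t for which the kernels are defined along both rays: by continuation in the sector,
     by the power series near 0, since |w| >= eps on the rays. *)
  set (adm := fun t : C => sector d del t \/ Cmod t < rho * eps).
  assert (Hraya : forall t, adm t -> forall x, x0 <= x -> cderivable1 Ga (t / cexp (x, y0))%C).
  { intros t [Ht|Ht] x Hx; [apply HGas, Hseca, Ht|apply HGa].
    eapply Rlt_le_trans; [apply (Hdin t x y0 x0 Hx Ht)|exact Hra]. }
  assert (Hrayb : forall t, adm t -> forall x, x0 <= x -> cderivable1 Gb (t / cexp (x, y1))%C).
  { intros t [Ht|Ht] x Hx; [apply HGbs, Hsecb, Ht|apply HGb].
    eapply Rlt_le_trans; [apply (Hdin t x y1 x0 Hx Ht)|exact Hrb]. }
  assert (HGab : forall z (u : E), Cmod z < rho -> cscal (Ga z) u = cscal (Gb z) u).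
  { intros z u Hz. apply (pseries_sum_unique (fun n => cscal (RtoC (l n)) u) z).
    - apply HGa; lra.
    - apply HGb; lra. }
  assert (HGad : forall z, Cmod z < rho -> cderivable1 Ga z) by (intros z Hz; apply HGa; lra).
  set (D := deformed_arc Ga Gb V x0 y0 y1).
  assert (Hind : forall t X1 X2, adm t -> x0 <= X1 -> X1 <= X2 -> Cmod t < rho * exp X1 -> D X1 t =
      D X2 t).
  { intros t X1 X2 Ht H1 H2 Htr. apply (deformed_arc_independent Ga Gb V rho); try assumption.
    - apply Hraya, Ht.
    - apply Hrayb, Ht. }
  (* The arc is pushed to radius Lam (|t| + 1). Lam >= 2 / rho puts t/w into the disc of the power
     series, Lam >= eps makes the push outward. *)
  set (Lam := Rmax (2 / rho) eps).
  assert (HLe : eps <= Lam) by apply Rmax_r. assert (HLr : 2 / rho <= Lam) by apply Rmax_l.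
  assert (HLp : 0 < Lam) by lra.
  assert (HLrho : 2 <= Lam * rho).
  { apply (Rmult_le_compat_r rho) in HLr; [|lra]. replace (2 / rho * rho) with 2 in HLr by (field;
      lra). exact HLr. }
  set (Xr := fun T => ln (Lam * (T + 1))).
  assert (HXr : forall T, 0 <= T -> exp (Xr T) = Lam * (T + 1)).
  { intros T HT. apply exp_ln. apply Rmult_lt_0_compat; lra. }
  assert (HXx0 : forall T, 0 <= T -> x0 <= Xr T).
  { intros T HT. rewrite <- (ln_exp x0). apply ln_le; [exact Heps|]. fold eps. nra. }
  assert (HXrho : forall T, 0 <= T -> T < rho * exp (Xr T)).
  { intros T HT. rewrite HXr by exact HT. nra. }
  (* The radius varies with t for the sake of the growth bound. For holomorphy it is frozen near
     each point, which [HfD] permits. *)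
  set (f := fun t : C => D (Xr (Cmod t)) t).
  assert (HfD : forall t X, adm t -> Xr (Cmod t) <= X -> f t = D X t).
  { intros t X Ht HX.
    exact (Hind t (Xr (Cmod t)) X Ht (HXx0 _ (Cmod_ge_0 t)) HX (HXrho _ (Cmod_ge_0 t))). }
  assert (Harc : forall t0 X, x0 <= X -> Cmod t0 < rho * exp X ->
      cderivable (arc_integral Ga V y0 y1 X) t0).
  { intros t0 X HX Ht0. set (R := rho * exp X - Cmod t0).
    apply (path_kernel_holomorphic Ga (fun s => cexp (X, s)) (fun s => V (cexp (X, s)))
        y0 y1 t0 R Ma);
      [exact Hy01|unfold R; lra| | |].
    - intros s Hs. split; [|apply cexp_neq_0].
      apply (continuous_comp (U := R_UniformSpace) (V := CU) (W := CU) (fun s :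
          R_UniformSpace => (X, s) : C) cexp);
        [apply continuous_vertical|apply cderivable1_continuous, cderivable_cexp].
    - intros s Hs. apply (continuous_along_vertical (fun z => V (cexp z))).
      apply continuous_cexp, holo_continuous, HVd, Hs.
    - intros t s Ht Hs.
      assert (Htr : Cmod t < rho * exp X).
      { pose proof (Cmod_le_minus t t0) as T. unfold R in Ht; lra. }
      pose proof (Hdin t X s X ltac:(lra) Htr) as Hz.
      split; [apply HGad, Hz|apply HGaM; lra]. }
  assert (Hray : forall G y t0 X R M, x0 <= X -> y0 <= y <= y1 -> 0 < R ->
     (forall t x, Cmod (t - t0) < R -> x0 <= x <= X -> cderivable1 G (t / cexp (x,
         y))%C /\ Cmod (G (t / cexp (x, y))%C) <= M) ->
     cderivable (ray_integral G V y x0 X) t0).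
  { intros G y t0 X R M HX Hy HR HG.
    apply (path_kernel_holomorphic G (fun s => cexp (s, y)) (fun s => V (cexp (s, y))) x0 X t0 R M);
      [exact HX|exact HR| | |exact HG].
    - intros s Hs. split; [|apply cexp_neq_0].
      apply (continuous_comp (U := R_UniformSpace) (V := CU) (W := CU) (fun s :
          R_UniformSpace => (s, y) : C) cexp);
        [apply continuous_horizontal|apply cderivable1_continuous, cderivable_cexp].
    - intros s Hs. apply (continuous_along_horizontal (fun z => V (cexp z))).
      apply continuous_cexp, holo_continuous, HVd, Hy. }
  destruct (sector_thick d (del / 2) del ltac:(lra) ltac:(lra)) as [kap [Hkap Hthick]].
  assert (Hsub : forall t, sector d (del / 2) t -> sector d del t).
  { intros t Ht. apply (sector_mono d (del / 2)); [lra|exact Ht]. }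
  (* On the rays |w| >= eps, so |t/w| <= T / eps and the kernel grows with order k in T. *)
  assert (Hray_bound : forall G phi dd Ag Bg y, 0 < Ag -> 0 < Bg ->
     (forall z, sector phi dd z -> cderivable1 G z /\ Cmod (G z) <= Ag * exp (Bg * Rpower (Cmod z)
         k)) ->
     (forall t x, sector d del t -> sector phi dd (t / cexp (x, y))%C) ->
     forall t x T, sector d del t -> Cmod t <= T -> x0 <= x ->
       Cmod (G (t / cexp (x, y))%C) <= Ag * exp (Bg * Rpower (T * / eps) k)).
  { intros G phi dd Ag Bg y HAg HBg HG Hsec t x T Ht HT Hx.
    destruct (HG _ (Hsec t x Ht)) as [_ H1]. eapply Rle_trans; [exact H1|].
    apply Rmult_le_compat_l; [lra|]. apply exp_monotone. apply Rmult_le_compat_l; [lra|].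
    apply Rle_Rpower_l; [lra|].
    assert (Htp : 0 < Cmod t) by (apply Cmod_gt_0, (sector_neq_0 d del), Ht).
    rewrite Cmod_div_cexp; cbn [fst]. split; [apply Rmult_lt_0_compat; [exact Htp|apply exp_pos]|].
    apply Rmult_le_compat; [lra|left; apply exp_pos|exact HT|].
    unfold eps. rewrite <- exp_Ropp. apply exp_monotone; lra. }
  assert (Hholo : forall t0 X, sector d (del / 2) t0 \/ Cmod t0 < rho * eps -> x0 <= X ->
     Cmod t0 < rho * exp X -> cderivable (D X) t0).
  { intros t0 X Ht0 HX Htr. unfold D, deformed_arc.
    apply holo_plus; [apply Harc; assumption|].
    apply (holo_scal (fun _ => (- Ci)%C)); [apply cderivable1_cst|].
    destruct Ht0 as [Ht0|Ht0].
    - pose proof (proj1 (Cmod_gt_0 t0) (sector_neq_0 _ _ _ Ht0)) as Ht0p.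
      set (R := kap * Cmod t0). assert (HR : 0 < R) by (apply Rmult_lt_0_compat; lra).
      assert (HR2 : forall t, Cmod (t - t0) < R -> Cmod t <= 2 * Cmod t0).
      { intros t Ht. pose proof (Cmod_le_minus t t0) as T.
        unfold R in Ht. nra. }
      apply holo_minus.
      + apply (Hray Ga y0 t0 X R (Aa * exp (Ba * Rpower (2 * Cmod t0 * / eps) k)));
          [exact HX|lra|exact HR|].
        intros t x Ht Hx. assert (Hts : sector d del t) by (apply (Hthick t0); assumption).
        split; [apply HGas, Hseca, Hts|].
        apply (Hray_bound Ga eta da Aa Ba y0 HAa HBa HGas Hseca t x); [exact Hts|apply HR2, Ht|lra].
      + apply (Hray Gb y1 t0 X R (Ab * exp (Bb * Rpower (2 * Cmod t0 * / eps) k)));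
          [exact HX|lra|exact HR|].
        intros t x Ht Hx. assert (Hts : sector d del t) by (apply (Hthick t0); assumption).
        split; [apply HGbs, Hsecb, Hts|].
        apply (Hray_bound Gb (- eta) db Ab Bb y1 HAb HBb HGbs Hsecb t x); [exact Hts|apply HR2,
            Ht|lra].
    - set (R := rho * eps - Cmod t0).
      assert (HR2 : forall t, Cmod (t - t0) < R -> Cmod t < rho * exp x0).
      { intros t Ht. pose proof (Cmod_le_minus t t0) as T.
        unfold R in Ht. fold eps. lra. }
      apply holo_minus.
      + apply (Hray Ga y0 t0 X R Ma); [exact HX|lra|unfold R; lra|].
        intros t x Ht Hx. pose proof (Hdin t x y0 x0 (proj1 Hx) (HR2 t Ht)) as Hz.
        split; [apply HGad, Hz|apply HGaM; lra].
      + apply (Hray Gb y1 t0 X R Mb); [exact HX|lra|unfold R; lra|].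
        intros t x Ht Hx. pose proof (Hdin t x y1 x0 (proj1 Hx) (HR2 t Ht)) as Hz.
        split; [apply HGb; lra|apply HGbM; lra]. }
  exists (del / 2), f. split; [lra|]. split.
  - exists (rho * eps). split; [apply Rmult_lt_0_compat; assumption|]. split.
    + intros t0 Ht0. unfold Defs.disc in Ht0.
      (* Large enough for all t within distance 1 of t0. *)
      set (X := Xr (Cmod t0 + 1)).
      pose proof (Cmod_ge_0 t0) as Ht00.
      assert (HX : x0 <= X) by (apply HXx0; lra).
      assert (HXt : Cmod t0 < rho * exp X) by (pose proof (HXrho (Cmod t0 + 1) ltac:(lra)) as H1;
          fold X in H1; lra).
      assert (Hnbh : exists r, 0 < r /\ r <= 1 /\ forall t, Cmod (t - t0) < r -> adm t).
      { destruct Ht0 as [Ht0|Ht0].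
        - pose proof (proj1 (Cmod_gt_0 t0) (sector_neq_0 _ _ _ Ht0)) as Ht0p.
          exists (Rmin 1 (kap * Cmod t0)). split; [apply Rmin_pos; [lra|apply Rmult_lt_0_compat;
              lra]|].
          split; [apply Rmin_l|]. intros t Ht. left. apply (Hthick t0); [exact Ht0|].
          eapply Rlt_le_trans; [exact Ht|apply Rmin_r].
        - exists (Rmin 1 (rho * eps - Cmod t0)). split; [apply Rmin_pos; lra|].
          split; [apply Rmin_l|]. intros t Ht. right.
          pose proof (Rlt_le_trans _ _ _ Ht (Rmin_r _ _)) as Ht'.
          pose proof (Cmod_le_minus t t0) as T. lra. }
      destruct Hnbh as [r [Hr [Hr1 Hadm]]].
      apply (holo_ext_loc (D X) f t0 r Hr).
      * intros t Ht. symmetry. apply HfD; [apply Hadm, Ht|].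
        unfold X, Xr. pose proof (Cmod_ge_0 t).
        apply ln_le; [apply Rmult_lt_0_compat; lra|]. apply Rmult_le_compat_l; [lra|].
        pose proof (Cmod_le_minus t t0) as T. lra.
      * apply Hholo; assumption.
    + intros t Ht. unfold Defs.disc in Ht.
      (* Near 0 the contour may be pulled back to its initial radius, where the rays have length
         zero and the original arc, with its power series, is left. *)
      assert (Hft : f t = arc_integral Ga V y0 y1 x0 t).
      { unfold f. rewrite <- (Hind t x0 (Xr (Cmod t))).
        - unfold D, deformed_arc, ray_integral.
          assert (Hpt : forall g : R -> E, int g x0 x0 = zero) by (intros g;
              exact (RInt_point (V := ER E) x0 g)).
          rewrite !Hpt. vec.
        - right; exact Ht.
        - lra.
        - apply HXx0, Cmod_ge_0.
        - exact Ht. }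
      rewrite Hft. apply (integral_pseries (fun n => RtoC (l n)) Ga rho (fun s => V (cexp (x0, s)))
          x0 y0 y1 t).
      * apply (scalar_sum_shrink _ _ rhoa); [lra|exact HGa].
      * exact Hy01.
      * intros s Hs. apply (continuous_along_vertical (fun z => V (cexp z))).
        apply continuous_cexp, holo_continuous, HVd, Hs.
      * exact Ht.
  - set (ek := Rpower (/ eps) k). set (Lk := Rpower Lam k).
    assert (Hek : 0 < ek) by apply exp_pos. assert (HLk : 0 < Lk) by apply exp_pos.
    assert (Hik : 0 < / k) by (apply Rinv_0_lt_compat, Hk).
    (* The three exponents per unit of (T + 1)^k: the length of the rays, the kernels on them, and V
       at radius at most Lam (T + 1). *)
    set (C2 := / k + (Ba + Bb) * ek + B * Lk).
    assert (HC2 : 0 < C2).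
    { unfold C2. pose proof (Rmult_lt_0_compat (Ba + Bb) ek ltac:(lra) Hek).
      pose proof (Rmult_lt_0_compat B Lk HB HLk). lra. }
    set (C1 := 2 * eta * (Ma * A) + Lam * / eps * (Aa * A) + Lam * / eps * (Ab * A)).
    assert (HLe0 : 0 < Lam * / eps) by (apply Rmult_lt_0_compat; [exact HLp|apply Rinv_0_lt_compat,
        Heps]).
    assert (HC1 : 0 < C1).
    { unfold C1. pose proof (Rmult_lt_0_compat Aa A HAa HA). pose proof (Rmult_lt_0_compat Ab A HAb
        HA).
      pose proof (Rmult_le_pos Ma A HMa ltac:(lra)). 
      pose proof (Rmult_lt_0_compat _ _ HLe0 H). pose proof (Rmult_lt_0_compat _ _ HLe0 H0). nra. }
    set (tk := Rpower 2 k). assert (Htk : 0 < tk) by apply exp_pos.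
    exists (C1 * exp (C2 * tk)), (C2 * tk).
    split; [apply Rmult_lt_0_compat; [exact HC1|apply exp_pos]|].
    split; [apply Rmult_lt_0_compat; assumption|].
    intros t Ht. pose proof (Hsub t Ht) as Hts.
    assert (HT : 0 < Cmod t) by (apply Cmod_gt_0, (sector_neq_0 d del), Hts).
    set (T := Cmod t) in *. set (X := Xr T).
    assert (HX : exp X = Lam * (T + 1)) by (apply HXr; lra).
    assert (HXx : x0 <= X) by (apply HXx0; lra).
    set (S := Rpower (T + 1) k).
    assert (HS : 0 < S) by apply exp_pos.
    assert (HTS : T + 1 <= exp (/ k * S)).
    { rewrite <- (exp_ln (T + 1)) at 1 by lra. apply exp_monotone.
      pose proof (ln_le_Rpower k (T + 1) Hk ltac:(lra)) as H. fold S in H. unfold Rdiv in H. lra. }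
    assert (HVb : forall x y, y0 <= y <= y1 -> x <= X -> norm (V (cexp (x, y))) <=
        A * exp (B * Lk * S)).
    { intros x y Hy Hx. destruct (HV _ (HVs x y Hy)) as [_ H1]. eapply Rle_trans; [exact H1|].
      apply Rmult_le_compat_l; [lra|]. apply exp_monotone. rewrite Rmult_assoc.
      apply Rmult_le_compat_l; [lra|]. unfold Lk, S. rewrite Rpower_mult_distr by lra.
      rewrite <- HX, Cmod_cexp. cbn [fst]. apply Rle_Rpower_l; [lra|].
      split; [apply exp_pos|apply exp_monotone; lra]. }
    assert (Hray_norm : forall G phi dd Ag Bg y, 0 < Ag -> 0 < Bg -> Bg <= Ba + Bb -> y0 <= y <=
        y1 ->
       (forall z, sector phi dd z -> cderivable1 G z /\ Cmod (G z) <=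
           Ag * exp (Bg * Rpower (Cmod z) k)) ->
       (forall t x, sector d del t -> sector phi dd (t / cexp (x, y))%C) ->
       norm (ray_integral G V y x0 X t) <= Lam * / eps * (Ag * A) * exp (C2 * S)).
    { intros G phi dd Ag Bg y HAg HBg HBB Hy HG Hsec.
      apply Rle_trans with ((X - x0) * (Ag * exp (Bg * ek * S) * (A * exp (B * Lk * S)))).
      - apply norm_int_le; [exact HXx| |].
        + apply ex_int_continuous; [exact HXx|]. intros x Hx.
          apply continuous_along_horizontal, holo_continuous, integrand_holomorphic;
            [apply HG, Hsec, Hts|apply HVd, Hy].
        + intros x Hx. eapply Rle_trans; [apply enorm_scal_le|].
          apply Rmult_le_compat; [apply Cmod_ge_0|apply norm_ge_0| |apply HVb; [exact Hy|lra]].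
          eapply Rle_trans; [apply (Hray_bound G phi dd Ag Bg y HAg HBg HG Hsec t x (T + 1) Hts);
              [unfold T; lra|lra]|].
          rewrite <- Rpower_mult_distr by (try apply Rinv_0_lt_compat; lra). fold S ek.
          right. f_equal. f_equal. ring.
      (* A crude bound is enough: X - x0 is at most its exponential Lam (T + 1) / eps, and T + 1 <=
         exp (S / k). *)
      - assert (Hlen : X - x0 <= Lam * / eps * exp (/ k * S)).
        { apply Rle_trans with (exp (X - x0)).
          - pose proof (exp_ineq1_le (X - x0)). lra.
          - unfold Rminus. rewrite exp_plus, exp_Ropp, HX. fold eps.
            replace (Lam * (T + 1) * / eps) with (Lam * / eps * (T + 1)) by ring.
            apply Rmult_le_compat_l; [lra|exact HTS]. }
        apply Rle_trans with (Lam * / eps * exp (/ k * S) * (Ag * exp (Bg * ek * S)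
            * (A * exp (B * Lk * S)))).
        + apply Rmult_le_compat_r; [|exact Hlen].
          apply Rmult_le_pos; apply Rmult_le_pos; try (left; apply exp_pos); lra.
        + replace (Lam * / eps * exp (/ k * S) * (Ag * exp (Bg * ek * S) * (A * exp (B * Lk * S))))
            with (Lam * / eps * (Ag * A) * (exp (/ k * S) * exp (Bg * ek * S) * exp (B * Lk * S)))
                by ring.
          apply Rmult_le_compat_l.
          * apply Rmult_le_pos; [lra|]. apply Rmult_le_pos; lra.
          * rewrite <- !exp_plus. apply exp_monotone. unfold C2.
            assert (Bg * ek * S <= (Ba + Bb) * ek * S).
            { apply Rmult_le_compat_r; [lra|]. apply Rmult_le_compat_r; lra. }
            lra. }
    assert (Harc_norm : norm (arc_integral Ga V y0 y1 X t) <= 2 * eta * (Ma * A) * exp (C2 * S)).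
    { assert (HtX : Cmod t < rho * exp X) by (apply HXrho; unfold T in HT; lra).
      apply Rle_trans with ((y1 - y0) * (Ma * (A * exp (B * Lk * S)))).
      - apply norm_int_le; [exact Hy01| |].
        + apply ex_int_continuous; [exact Hy01|]. intros y Hy.
          apply continuous_along_vertical, holo_continuous, integrand_holomorphic;
            [apply HGad, (Hdin t X y X); [lra|exact HtX]|apply HVd, Hy].
        + intros y Hy. eapply Rle_trans; [apply enorm_scal_le|].
          apply Rmult_le_compat; [apply Cmod_ge_0|apply norm_ge_0| |apply HVb; [exact Hy|lra]].
          apply HGaM. eapply Rlt_le_trans; [apply (Hdin t X y X); [lra|exact HtX]|exact Hra].
      - replace (y1 - y0) with (2 * eta) by (unfold y0, y1; ring).
        rewrite <- !Rmult_assoc. apply Rmult_le_compat_l.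
        + repeat apply Rmult_le_pos; lra.
        + apply exp_monotone. apply Rmult_le_compat_r; [lra|]. unfold C2.
          pose proof (Rmult_lt_0_compat (Ba + Bb) ek ltac:(lra) Hek). lra. }
    pose proof (Hray_norm Ga eta da Aa Ba y0 HAa HBa ltac:(lra) ltac:(lra) HGas Hseca) as Na.
    pose proof (Hray_norm Gb (- eta) db Ab Bb y1 HAb HBb ltac:(lra) ltac:(lra) HGbs Hsecb) as Nb.
    apply Rle_trans with (C1 * exp (C2 * S)).
    + unfold f. fold T. fold X. unfold D, deformed_arc.
      eapply Rle_trans; [apply enorm_plus_le|].
      pose proof (enorm_scal_le (- Ci) (minus (ray_integral Ga V y0 x0 X t)
          (ray_integral Gb V y1 x0 X t))) as N1.
      rewrite Cmod_opp, Cmod_Ci, Rmult_1_l in N1.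
      pose proof (enorm_minus_le (ray_integral Ga V y0 x0 X t) (ray_integral Gb V y1 x0 X t)) as N2.
      apply Rle_trans with (norm (arc_integral Ga V y0 y1 X t)
          + (norm (ray_integral Ga V y0 x0 X t) + norm (ray_integral Gb V y1 x0 X t))).
      * apply Rplus_le_compat_l. eapply Rle_trans; [exact N1|exact N2].
      * unfold C1. lra.
    (* Passes from (T + 1)^k to T^k by (T + 1)^k <= 2^k (1 + T^k). *)
    + rewrite Rmult_assoc, <- exp_plus. apply Rmult_le_compat_l; [lra|]. apply exp_monotone.
      pose proof (Rpower_add_one k T Hk HT) as H. fold S tk in H.
      apply (Rmult_le_compat_l C2) in H; [|lra]. lra.
Qed.

Lemma exp_extendable_multiplier q s k (l : nat -> R) : 1 < q -> 0 < s -> 0 < k ->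
  (forall d (b : nat -> E), q_extendable q s d b ->
     q_extendable q s d (fun n => cscal (RtoC (l n)) (b n))) ->
  forall d (b : nat -> E), exp_extendable k d b ->
    exp_extendable k d (fun n => cscal (RtoC (l n)) (b n)).
Proof.
  intros Hq Hs Hk H d b Hb. pose proof PI_RGT_0 as HPI.
  (* The scalar kernel is read off a nonzero vector. If there is none, E = 0 and multiplication by l
     changes nothing. *)
  destruct (classic (exists e : E, norm e <> 0)) as [[e He]|Hne].
  2:{ replace (fun n => cscal (RtoC (l n)) (b n)) with b; [exact Hb|].
      assert (Hz : forall x : E, x = zero).
      { intros x. apply enorm_eq_zero. apply NNPP. intros Hx. apply Hne. exists x; exact Hx. }
      apply functional_extensionality; intros n.
      rewrite (Hz (b n)). vec. }
  destruct Hb as [delta [v [Hd [[R [HR [Hv Hser]]] [A [B [HA [HB Hgr]]]]]]]].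
  (* The bound delta/4 keeps the closed near arc inside the sector of v; the bound 1 makes the far
     arc nonempty and eta/2 less than PI/2. *)
  set (eta := Rmin 1 (delta / 4)).
  assert (Heta1 : eta <= 1) by apply Rmin_l. assert (Heta2 : eta <= delta / 4) by apply Rmin_r.
  assert (Heta : 0 < eta) by (apply Rmin_pos; lra).
  set (x0 := ln (R / 2)). assert (Hx0 : exp x0 = R / 2) by (apply exp_ln; lra).
  set (p := RtoC (/ (2 * PI))).
  (* The factor 1 / (2 PI) of Cauchy's formula is absorbed here. *)
  set (V := fun z => cscal p (v z) : E).
  assert (Hp : 0 < / (2 * PI)) by (apply Rinv_0_lt_compat; lra).
  assert (HVd : forall z, sector d delta z \/ Cmod z < R -> cderivable V z).
  { intros z Hz. apply (holo_scal (fun _ => p)); [apply cderivable1_cst|]. apply Hv, Hz. }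
  assert (HVc : forall s, continuous (T := R_UniformSpace) (fun s => V (cexp (x0, s))) s).
  { intros y. apply (continuous_along_vertical (fun z => V (cexp z))).
    apply continuous_cexp, holo_continuous, HVd. right. rewrite Cmod_cexp. cbn [fst]. lra. }
  destruct (kernel_extension e q s k l eta eta He Hq Hs Hk ltac:(lra) ltac:(apply Rabs_pos_eq; lra)
      H)
    as [Ga [rhoa [da [Ma [Aa [Ba HGa]]]]]].
  destruct (kernel_extension e q s k l (- eta) eta He Hq Hs Hk ltac:(lra)
              ltac:(rewrite Rabs_Ropp; apply Rabs_pos_eq; lra) H)
    as [Gb [rhob [db [Mb [Ab [Bb HGb]]]]]].
  set (coef := fun n y0 y1 => int (fun s => cscal ((/ cexp (x0, s)) ^ n)%C (V (cexp (x0, s))))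
      y0 y1).
  assert (Hcoef : forall n, b n = plus (coef n (d - eta) (d + eta)) (coef n (d + eta)
      (d - eta + 2 * PI))).
  { intros n. unfold coef. rewrite int_chasles.
    - apply (cauchy_coefficients b v R x0 (d - eta) n); [|exact Hser|lra].
      intros z Hz. apply Hv. right; exact Hz.
    - apply (ex_int_kernel (fun w => (/ w) ^ n)%C (fun s => V (cexp (x0, s)))); [lra| |intros y _;
        apply HVc].
      intros y _. apply cderivable_pow_inv, cexp_neq_0.
    - pose proof PI2_1. apply (ex_int_kernel (fun w => (/ w) ^ n)%C (fun s => V (cexp (x0, s))));
        [lra| |intros y _; apply HVc].
      intros y _. apply cderivable_pow_inv, cexp_neq_0. }
  replace (fun n => cscal (RtoC (l n)) (b n)) with
    (fun n => plus (cscal (RtoC (l n)) (coef n (d - eta) (d + eta)))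
                   (cscal (RtoC (l n)) (coef n (d + eta) (d - eta + 2 * PI)))).
  2:{ apply functional_extensionality; intros n. rewrite Hcoef. vec. }
  apply exp_extendable_plus; [exact Hk| |].
  - apply (near_arc_exp_extendable k d delta (/ (2 * PI) * A) B x0 eta V l
             Ga rhoa da Ma Aa Ba Gb rhob db Mb Ab Bb); try assumption; [lra| |].
    + apply Rmult_lt_0_compat; assumption.
    + intros z Hz. split; [apply HVd; left; exact Hz|].
      unfold V. eapply Rle_trans; [apply enorm_scal_le|]. unfold p.
      rewrite Cmod_R, Rabs_pos_eq, Rmult_assoc by lra.
      apply Rmult_le_compat_l; [lra|]. apply Hgr, Hz.
  - apply (q_extendable_exp_extendable q s); try assumption. apply H.
    apply (far_arc_q_extendable q s d eta x0 (fun s => V (cexp (x0, s)))); try assumption; [lra|].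
    intros y _. apply HVc.
Qed.

End NearArc.

(** * From the Gevrey hypothesis to multipliers *)

Lemma borel_comm {E : CompleteNormedModule C_AbsRing} (m m' : nat -> R) (u : nat -> E) :
  borel m (borel m' u) = borel m' (borel m u).
Proof.
  apply functional_extensionality; intros n. unfold borel. vec.
Qed.

Theorem corollary1 (q : R) (E : CompleteNormedModule C_AbsRing) (m : nat -> R)
    (hq : 1 < q) (hm : forall p : nat, 0 < m p) (hm0 : m 0%nat = 1) :
  preserves_q_Gevrey E q m -> preserves_summability E m.
Proof.
  intros H.
  (* The weights of [borel_q] for s = 1. Multiplying by them realises any series b as a q-Borel
     transform. *)
  set (w := fun p => Rpower q (1 * INR p * (INR p - 1) / 2)).
  assert (Hw : forall p, RtoC (w p) <> RtoC 0).
  { intros p Hp. apply RtoC_inj in Hp. pose proof (exp_pos (1 * INR p * (INR p - 1) / 2 * ln q)).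
    unfold w, Rpower in Hp. lra. }
  assert (Hm : forall p, RtoC (m p) <> RtoC 0).
  { intros p Hp. apply RtoC_inj in Hp. specialize (hm p). lra. }
  assert (Hwr : forall p, w p <> 0) by (intros p Hp; apply (Hw p); rewrite Hp; reflexivity).
  assert (Hmr : forall p, m p <> 0) by (intros p; specialize (hm p); lra).
  (* The forward implication of the hypothesis at u = w b, whose transforms are b and b / m. *)
  assert (Hinv : forall d (b : nat -> E), q_extendable q 1 d b ->
     q_extendable q 1 d (fun n => cscal (RtoC (/ m n)) (b n))).
  { intros d b Hb.
    pose proof (proj1 (H 1 d (fun p => cscal (RtoC (w p)) (b p)) Rlt_0_1)) as H1.
    assert (E1 : borel_q q 1 (fun p => cscal (RtoC (w p)) (b p)) = b).
    { apply functional_extensionality; intros n. unfold borel_q, borel. fold w.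
      change (Rpower q (1 * INR n * (INR n - 1) / 2)) with (w n). 
      vec_coefs. rewrite RtoC_inv by apply Hwr. field. apply Hw. }
    assert (E2 : borel_q q 1 (borel m (fun p => cscal (RtoC (w p)) (b p)))
                 = fun n => cscal (RtoC (/ m n)) (b n)).
    { unfold borel_q. rewrite borel_comm. fold (borel_q q 1 (fun p => cscal (RtoC (w p)) (b p))).
      rewrite E1. reflexivity. }
    rewrite E1, E2 in H1. exact (H1 Hb). }
  (* The backward implication at u = m w b, whose transforms are m b and b. *)
  assert (Hmul : forall d (b : nat -> E), q_extendable q 1 d b ->
     q_extendable q 1 d (fun n => cscal (RtoC (m n)) (b n))).
  { intros d b Hb.
    pose proof (proj2 (H 1 d (fun p => cscal (RtoC (m p) * RtoC (w p))%C (b p)) Rlt_0_1)) as H1.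
    assert (E1 : borel_q q 1 (borel m (fun p => cscal (RtoC (m p) * RtoC (w p))%C (b p))) = b).
    { apply functional_extensionality; intros n. unfold borel_q, borel.
      change (Rpower q (1 * INR n * (INR n - 1) / 2)) with (w n).
      vec_coefs. rewrite !RtoC_inv by (apply Hwr || apply Hmr). field. split; [apply Hm|apply Hw]. }
    assert (E2 : borel_q q 1 (fun p => cscal (RtoC (m p) * RtoC (w p))%C (b p))
                 = fun n => cscal (RtoC (m n)) (b n)).
    { apply functional_extensionality; intros n. unfold borel_q, borel.
      change (Rpower q (1 * INR n * (INR n - 1) / 2)) with (w n).
      vec_coefs. rewrite RtoC_inv by apply Hwr. field. apply Hw. }
    rewrite E1, E2 in H1. exact (H1 Hb). }
  intros k d u Hk. set (g := fun p => Gamma (1 + INR p / k)).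
  assert (Hsum : forall u' : nat -> E, summable k d u' <-> exp_extendable k d (borel g u')).
  { intros u'. split; [intros [_ Hs]; exact Hs|]. intros Hs. split; [|exact Hs].
    destruct Hs as [delta [v [_ [Hext _]]]]. exact (extends_on_convergent _ _ _ Hext). }
  rewrite !Hsum. rewrite borel_comm. split.
  - apply (exp_extendable_multiplier q 1 k (fun n => / m n) hq Rlt_0_1 Hk Hinv).
  - intros Hb.
    replace (borel g u) with (fun n => cscal (RtoC (m n)) (borel m (borel g u) n)).
    + apply (exp_extendable_multiplier q 1 k m hq Rlt_0_1 Hk Hmul). exact Hb.
    + apply functional_extensionality; intros n. unfold borel at 1.
      vec_coefs. rewrite RtoC_inv by apply Hmr. field. apply Hm.
Qed.
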